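(* For every integer $k\geq 3$, $$\Sigma_{k,4}=\alpha(k)\sum_{\substack{i,j,m\geq 0\\ i+j+m=k-3}}C_iC_jC_m+\beta(k)\sum_{\substack{i,j,m\geq 0\\ i+j+m=k-3}}i^2\,C_iC_jC_m,$$ where $$\alpha(k)=-\tfrac{1}{17280}(k-3)(k-1)^2k(k+1)(k^2-4k-6),\qquad \beta(k)=\tfrac{1}{2880}(k-1)k(k+1)(2k^2-3).$$
   Context: Kerov's character polynomials. For $k\ge1$, $\Sigma_k$ denotes Kerov's character polynomial: the universal polynomial with integer coefficients in indeterminates $R_2,R_3,\ldots,R_{k+1}$ such that $\widehat{\chi}_\omega(k1^{n-k})=\Sigma_k(R_2(\omega),\ldots,R_{k+1}(\omega))$ for all partitions $\omega\vdash n$ and all $n\geq k$. Here $\widehat{\chi}_\omega(k1^{n-k})=n(n-1)\cdots(n-k+1)\,\chi_\omega(k1^{n-k})/\chi_\omega(1^n)$, where $\chi_\omega(\lambda)$ is the character of the irreducible representation of the symmetric group $\mathfrak{S}_n$ indexed by $\omega$ on the class of cycle type $\lambda$. The free cumulants $R_i(\omega)$ are defined by $z^{-1}+\sum_{i\ge1}R_i(\omega)z^{i-1}=H_\omega^{\langle -1\rangle}(z)$ (compositional inverse, $H_\omega$ being expanded in powers of $1/z$ at infinity), where $H_\omega(z)=\prod_{i=1}^{m-1}(z-y_i)/\prod_{i=1}^{m}(z-x_i)$, with $x_1,\ldots,x_m$ the local minima and $y_1,\ldots,y_{m-1}$ the local maxima of the boundary curve of the Young diagram of $\omega$ (French convention)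 rotated counterclockwise by $45^\circ$, scaled so that these are integers (i.e. the $x_i$ are the contents, column minus row, of the addable boxes of $\omega$, and the $y_i$ the contents of the removable boxes). Equivalently, by a known theorem (Okounkov, Biane, Stanley): with $R(x)=1+\sum_{i\ge2}R_ix^i$, $F(x)=x/R(x)$, $G(x)=1/F^{\langle-1\rangle}(x^{-1})$, where $\langle -1\rangle$ is compositional inverse, one has $\Sigma_k=-\frac1k[x^{-1}]_\infty\prod_{j=0}^{k-1}G(x-j)$, where $[x^{-1}]_\infty$ is the coefficient of $x^{-1}$ in the expansion at $x=\infty$ (in descending powers of $x$). Graded pieces: $\Sigma_{k,2n}=[u^{k+1-2n}]\,\Sigma_k(R_2u^2,R_3u^3,\ldots,R_{k+1}u^{k+1})$; in particular $\Sigma_{k,4}$ is the sum of all terms of weight $k-3$ in $\Sigma_k$, where $R_{j_1}\cdots R_{j_i}$ has weight $j_1+\cdots+j_i$. The polynomials $C_m$ in the $R_i$'s are defined by $C_0=1$, $C_1=0$, and for $m\ge2$ $$C_m=\sum_{\substack{j_2,j_3,\ldots\geq0\\2j_2+3j_3+\cdots=m}}(j_2+j_3+\cdots)!\prod_{i\ge2}\frac{((i-1)R_i)^{j_i}}{j_i!};$$ equivalently $\sum_{m\ge0}C_mt^m=\bigl(1-\sum_{i\ge2}(i-1)R_it^i\bigr)^{-1}$. *)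

(* Defs.v *)
From HB Require Import structures.
From mathcomp Require Import all_boot all_order all_algebra all_fingroup.
From mathcomp Require Import all_field all_character.
From mathcomp Require Import mpoly.

Set Implicit Arguments.
Unset Strict Implicit.
Unset Printing Implicit Defensive.

Import GRing.Theory Num.Theory.
Local Open Scope ring_scope.

(** * Partitions *)

(* A partition of n is the weakly decreasing list of its positive parts. *)
Definition is_partition_of (n : nat) (w : seq nat) : bool :=
  [&& sorted geq w, all (leq 1) w & sumn w == n].

(* Contents (column minus row) of the addable boxes: row r of the diagram,
   0 <= r <= size w, accepts a new box in column nth 0 w r when it is the first
   row or is strictly shorter than the row before it. *)
Definition addable_contents (w : seq nat) : seq int :=
  [seq (nth 0%N w r)%:Z - r%:Z | r <- iota 0 (size w).+1
     & (r == 0%N) || (nth 0%N w r < nth 0%N w r.-1)%N].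

(* Contents of the removable boxes: the last box of row r, in column
   nth 0 w r - 1, when the next row is strictly shorter. *)
Definition removable_contents (w : seq nat) : seq int :=
  [seq (nth 0%N w r)%:Z - 1 - r%:Z | r <- iota 0 (size w)
     & (nth 0%N w r.+1 < nth 0%N w r)%N].

(** * Irreducible characters of the symmetric groups *)

Section Specht.

Variables (n : nat) (w : seq nat).

(* The standard tableau of shape w obtained by filling the rows one after the
   other: i sits in row [reshape_index w i], column [reshape_offset w i]. *)
Definition row_stab : {set 'S_n} :=
  [set p : 'S_n | [forall i, reshape_index w (p i) == reshape_index w i]].

Definition col_stab : {set 'S_n} :=
  [set q : 'S_n | [forall i, reshape_offset w (q i) == reshape_offset w i]].

(* The row vector that represents the group algebra element
   \sum_(p, q) sgn(q) p q in the regular representation, whose basis vectors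
   are indexed by the group elements through [gring_index]. *)
Definition young_symmetrizer : 'rV[algC]_#|[set: 'S_n]| :=
  \sum_(p in row_stab) \sum_(q in col_stab)
    (-1) ^+ odd_perm q *: delta_mx 0 (gring_index [set: 'S_n]%G (p * q)%g).

(* The irreducible (Specht) module of w: the submodule of the group algebra
   generated by the Young symmetrizer. *)
Definition specht_mx :=
  cyclic_mx (regular_repr algC [set: 'S_n]%G) young_symmetrizer.

Definition specht_repr :=
  submod_repr (cyclic_mx_module (regular_repr algC [set: 'S_n]%G)
                                young_symmetrizer).

Definition specht_char : 'CF([set: 'S_n]) := cfRepr specht_repr.

End Specht.

Definition has_cycle_type (n : nat) (g : 'S_n) (mu : seq nat) : bool :=
  perm_eq [seq #|C| | C : {set 'I_n} <- enum (porbits g)] mu.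

(* n (n - 1) ... (n - k + 1) chi_w(g) / chi_w(1) *)
Definition normalized_char (k n : nat) (w : seq nat) (g : 'S_n) : algC :=
  (n ^_ k)%:R * specht_char n w g / specht_char n w 1%g.

(** * Formal power series over the rationals, as coefficient functions *)

Definition fps_X : nat -> rat := fun n => (n == 1%N)%:R.

Definition fps_one : nat -> rat := fun n => (n == 0%N)%:R.

Definition fps_mul (f g : nat -> rat) : nat -> rat :=
  fun n => \sum_(i < n.+1) f i * g (n - i)%N.

Definition fps_exp (f : nat -> rat) (m : nat) : nat -> rat :=
  iter m (fps_mul f) fps_one.

(* f(g(t)); meaningful when g has no constant term, so that g^m does not
   contribute to the coefficients of index less than m. *)
Definition fps_comp (f g : nat -> rat) : nat -> rat :=
  fun n => \sum_(m < n.+1) f m * fps_exp g m n.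

(** * Free cumulants *)

(* The expansion of H_w in powers of t = 1/z at infinity:
   H_w(1/t) = t \prod_y (1 - y t) \prod_x (1 - x t)^-1. *)
Definition H_expansion (w : seq nat) : nat -> rat :=
  fps_mul (fun n => ('X * \prod_(y <- removable_contents w)
                            (1 - y%:~R *: 'X) : {poly rat})`_n)
    (foldr fps_mul fps_one
       [seq (fun n : nat => (x%:~R : rat) ^+ n) | x <- addable_contents w]).

(* R_i (i >= 1) are the free cumulants of w.  With
     K(z) = z^-1 + \sum_(i >= 1) R_i z^(i-1) = (1 + \sum_(i >= 1) R_i z^i) / z,
   V below is the power series 1/K(z), and since H_w is expanded in powers of
   1/z the last conjunct says H_w(K(z)) = z.  The value R 0 is irrelevant. *)
Definition free_cumulants (w : seq nat) (R : nat -> rat) : Prop :=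
  exists V : nat -> rat,
    fps_mul V (fun i => if i == 0%N then 1 else R i) =1 fps_X /\
    fps_comp (H_expansion w) V =1 fps_X.

(** * Kerov's character polynomials *)

(* In a polynomial in k variables, the variable of index i : 'I_k stands for
   R_(i+2). *)
Definition is_kerov_polynomial (k : nat) (Sigma : {mpoly int[k]}) : Prop :=
  forall (n : nat) (w : seq nat) (g : 'S_n) (R : nat -> rat),
    (k <= n)%N -> is_partition_of n w ->
    has_cycle_type g (k :: nseq (n - k) 1%N) -> free_cumulants w R ->
    normalized_char k w g = ratr (mmap intr (fun i : 'I_k => R i.+2) Sigma).

(* Sigma_(k,j) = [u^(k+1-j)] Sigma (R_2 u^2, ..., R_(k+1) u^(k+1)), for
   j <= k + 1, with rational coefficients. *)
Definition graded_piece (k j : nat) (Sigma : {mpoly int[k]}) : {mpoly rat[k]} :=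
  (mmap (fun c : int => (c%:~R : {poly {mpoly rat[k]}}))
        (fun i : 'I_k => ('X_i : {mpoly rat[k]})%:P * 'X^(i.+2))
        Sigma)`_(k + 1 - j).

(* R_i, for i >= 2, as an element of Q[R_2, ..., R_(k+1)]; 0 if i > k + 1. *)
Definition R_ (k i : nat) : {mpoly rat[k]} :=
  if insub (i - 2)%N is Some s then 'X_(s : 'I_k) else 0.

(* For m >= 2, the value at s : 'I_m of the summation index j is the exponent
   j_(s+2); exponents j_i with i > m + 1, or values j_i > m, cannot occur.
   Only R_i with i <= m matter, so C_ k m is the C_m of the text when
   m <= k + 1. *)
Definition C_ (k m : nat) : {mpoly rat[k]} :=
  match m with
  | 0%N => 1
  | 1%N => 0
  | _ =>
    \sum_(j : {ffun 'I_m -> 'I_m.+1} | (\sum_(s < m) s.+2 * j s)%N == m)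
      ((\sum_(s < m) j s)%N`!)%:R *:
        \prod_(s < m) (((j s)`!%:R : rat)^-1 *:
                        (s.+1%:R *: R_ k s.+2) ^+ j s)
  end.

Definition alpha (k : nat) : rat :=
  let K := k%:R in
  - (1 / 17280%:R)
  * (K - 3%:R) * (K - 1) ^+ 2 * K * (K + 1) * (K ^+ 2 - 4%:R * K - 6%:R).

Definition beta (k : nat) : rat :=
  let K := k%:R in
  1 / 2880%:R * (K - 1) * K * (K + 1) * (2%:R * K ^+ 2 - 3%:R).

(* Main.v *)
Require Import Defs.
From HB Require Import structures.
From mathcomp Require Import all_boot all_order all_algebra all_fingroup.
From mathcomp Require Import all_field all_character.
From mathcomp Require Import mpoly.
From mathcomp Require Import boolp.
From mathcomp Require Import ring zify.

(** Write G for the function such that x = R(y) / y and y = 1 / G(x) are inverse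
    to each other, R(y) = 1 + sum_i R_i y^i being the generating series of the
    free cumulants. The theorem rests on the identity

      Sigma_k = - (1/k) [x^-1] prod_(0 <= j < k) G(x - j)      ([kerov_series])

    and on its expansion in the size of the shifts.

    The identity. For a diagram w, G = 1 / H_w is a quotient of products over the
    rows, and the right-hand side is a sum of residues, one for each row
    ([gseries_frobenius]). Frobenius' formula ([frobenius_cycle]) says that this
    sum is the normalized character on a k-cycle. It is proved as follows. A
    permutation between the row sum and the signed column sum of a tableau gives
    zero or, up to sign, the Young symmetrizer ([sandwich]); therefore the Specht
    modules are irreducible ([specht_irr]), and they are pairwise distinct
    ([specht_char_inj]).
    Restriction to a smaller symmetric group contains each shape with one box less
    ([specht_restrict_gt0]), and a count of dimensions shows that it contains
    nothing else ([branching]). The sum of all transpositions acts by the content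
    sum, so the transpositions that move the last point act by the content of the
    removed box ([content_step]); this yields recursions for the characters of
    cycles that are also satisfied by the determinants det (1 / (l_i - j)!)
    ([kcycle_fcyc]), which are quotients of Vandermonde determinants by factorials.

    So the identity holds at the free cumulants of large diagrams. Both sides are
    polynomials in the lengths of the rows, hence it holds for arbitrary complex
    lengths ([mpoly_eq0_decreasing], [kerov_defect_algC]); and with k complex rows
    one reaches any prescribed values of R_2, ..., R_(k+1) ([gseries_approx]).

    The expansion. Replacing R_i by u^i R_i replaces G(x) by u G(x / u), that is,
    the shifts j by j / u in the variable x / u. Therefore Sigma_(k,4) is the term
    of fourth order in the shifts ([shift_product_graded]). It is a sum of five
    products of derivatives of G, with symmetric functions of 0, ..., k - 1 as
    factors ([shift_product_coefs]). Up to total derivatives, which have no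
    residue, only G^(k-4) G'^4 and G^(k-2) G''^2 remain ([fourth_coef]). In the
    variable y their residues become the coefficients of y^(k-3) in C^3 and in
    C (y C')^2, where C = 1 / (1 - sum_i (i - 1) R_i y^i) is the generating series
    of the C_m, since G'(x) = C(y) ([transfer_C3], [transfer_CdC2]). One more
    integration by parts turns the second one into C^2 (y d/dy)^2 C, which is the
    sum with the weights i^2. *)

Set Implicit Arguments.
Unset Strict Implicit.
Unset Printing Implicit Defensive.

Import Order.TTheory GRing.Theory Num.Theory.
Local Open Scope ring_scope.

(** * Formal power series *)

Record fps (R : Type) := Fps { fcoef :> nat -> R }.

Lemma fpsP (R : Type) (f g : fps R) : (forall n, f n = g n) -> f = g.
Proof. by case: f g => f [g] /= e; congr Fps; apply/funext. Qed.

HB.instance Definition _ (R : Type) := gen_eqMixin (fps R).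
HB.instance Definition _ (R : Type) := gen_choiceMixin (fps R).

Section FpsRing.
Variable R : comNzRingType.
Implicit Types f g h : fps R.

Definition fps_zero : fps R := Fps (fun=> 0).
Definition fps_opp f : fps R := Fps (fun n => - f n).
Definition fps_add f g : fps R := Fps (fun n => f n + g n).
Definition fps_unit : fps R := Fps (fun n => (n == 0%N)%:R).
Definition fps_prod f g : fps R := Fps (fun n => \sum_(i < n.+1) f i * g (n - i)%N).

Fact fps_addA : associative fps_add.
Proof. by move=> f g h; apply: fpsP => n /=; rewrite addrA. Qed.
Fact fps_addC : commutative fps_add.
Proof. by move=> f g; apply: fpsP => n /=; rewrite addrC. Qed.
Fact fps_add0 : left_id fps_zero fps_add.
Proof. by move=> f; apply: fpsP => n /=; rewrite add0r. Qed.
Fact fps_addN : left_inverse fps_zero fps_opp fps_add.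
Proof. by move=> f; apply: fpsP => n /=; rewrite addNr. Qed.

HB.instance Definition _ := GRing.isZmodule.Build (fps R)
  fps_addA fps_addC fps_add0 fps_addN.

Definition truncp (L : nat) f : {poly R} := \poly_(i < L) f i.

(** Products of series are read off products of truncations, which is how the
    ring axioms are inherited from polynomials. *)
Lemma fps_prodE f g n (p q : {poly R}) :
  (forall i, (i <= n)%N -> p`_i = f i) -> (forall i, (i <= n)%N -> q`_i = g i) ->
  fps_prod f g n = (p * q)`_n.
Proof.
move=> pf qg; rewrite coefM /=; apply: eq_bigr => i _.
by rewrite pf ?qg ?leq_subr // -ltnS.
Qed.

Lemma truncpE L f i : (i < L)%N -> (truncp L f)`_i = f i.
Proof. by move=> iL; rewrite coef_poly iL. Qed.

Fact fps_prodC : commutative fps_prod.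
Proof.
move=> f g; apply: fpsP => n.
have tE k : forall i, (i <= n)%N -> (truncp n.+1 k)`_i = k i.
  by move=> i le_in; rewrite truncpE.
rewrite (fps_prodE (tE f) (tE g)) mulrC; symmetry.
exact: fps_prodE (tE g) (tE f).
Qed.

Fact fps_prodA : associative fps_prod.
Proof.
move=> f g h; apply: fpsP => n.
have tE k : forall i, (i <= n)%N -> (truncp n.+1 k)`_i = k i.
  by move=> i le_in; rewrite truncpE.
have tE2 k1 k2 : forall i, (i <= n)%N ->
    (truncp n.+1 k1 * truncp n.+1 k2)`_i = fps_prod k1 k2 i.
  by move=> i le_in; symmetry; apply: fps_prodE => j le_ji; apply: tE;
    apply: leq_trans le_ji le_in.
rewrite (fps_prodE (tE f) (tE2 g h)) mulrA; symmetry.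
exact: fps_prodE (tE2 f g) (tE h).
Qed.

Fact fps_prod1 : left_id fps_unit fps_prod.
Proof.
move=> f; apply: fpsP => n /=.
by rewrite big_ord_recl /= mul1r subn0 big1 ?addr0 // => i _; rewrite mul0r.
Qed.

Fact fps_prodDl : left_distributive fps_prod fps_add.
Proof.
move=> f g h; apply: fpsP => n /=.
by rewrite -big_split; apply: eq_bigr => i _; rewrite mulrDl.
Qed.

Fact fps_unit_neq0 : fps_unit != 0.
Proof.
apply/eqP => /(congr1 (fun f : fps R => f 0%N)) /= /eqP.
by rewrite oner_eq0.
Qed.

HB.instance Definition _ := GRing.Zmodule_isComNzRing.Build (fps R)
  fps_prodA fps_prodC fps_prod1 fps_prodDl fps_unit_neq0.

Lemma fcoef1 n : (1 : fps R) n = (n == 0%N)%:R. Proof. by []. Qed.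
Lemma fcoefD f g n : (f + g) n = f n + g n. Proof. by []. Qed.
Lemma fcoefN f n : (- f) n = - f n. Proof. by []. Qed.
Lemma fcoefB f g n : (f - g) n = f n - g n. Proof. by []. Qed.
Lemma fcoefM f g n : (f * g) n = \sum_(i < n.+1) f i * g (n - i)%N.
Proof. by []. Qed.
Lemma fcoef_sum I (r : seq I) (P : pred I) (F : I -> fps R) n :
  (\sum_(i <- r | P i) F i) n = \sum_(i <- r | P i) F i n.
Proof. exact: (big_morph (fun f : fps R => f n)). Qed.

Lemma fcoefM0 f g : (f * g) 0%N = f 0%N * g 0%N.
Proof. by rewrite fcoefM big_ord_recl big_ord0 addr0. Qed.

Lemma fcoefX0 f m : (f ^+ m) 0%N = f 0%N ^+ m.
Proof. by elim: m => [|m IH]; rewrite ?fcoef1 // !exprS fcoefM0 IH. Qed.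

Definition fC (c : R) : fps R := Fps (fun n => if n == 0%N then c else 0).
Definition fX : fps R := Fps (fun n => (n == 1%N)%:R).

Lemma fcoefC c n : fC c n = if n == 0%N then c else 0. Proof. by []. Qed.

Lemma fcoefCM c f n : (fC c * f) n = c * f n.
Proof.
by rewrite fcoefM big_ord_recl /= subn0 big1 ?addr0 // => i _; rewrite mul0r.
Qed.

Lemma fcoefXM f n : (fX * f) n = if n is n'.+1 then f n' else 0.
Proof.
case: n => [|n]; first by rewrite fcoefM0 mul0r.
rewrite fcoefM !big_ord_recl /= mul0r add0r mul1r subSS subn0 big1 ?addr0 //.
by move=> i _; rewrite mul0r.
Qed.

Lemma fcoefXnM m f n : (fX ^+ m * f) n = if (m <= n)%N then f (n - m)%N else 0.
Proof.
elim: m n => [|m IH] [|n]; rewrite ?expr0 ?mul1r ?subn0 // exprS -mulrA fcoefXM ?IH //.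
Qed.

Lemma fcoefXn m n : (fX ^+ m) n = (n == m)%:R.
Proof.
rewrite -[fX ^+ m]mulr1 fcoefXnM fcoef1; by case: ltngtP => [lt_mn|//|->]; rewrite ?subnn // subn_eq0 leqNgt lt_mn.
Qed.

Fact fC_zmod : zmod_morphism fC.
Proof. by move=> c d; apply: fpsP => -[|n] //=; rewrite subr0. Qed.
Fact fC_monoid : monoid_morphism fC.
Proof.
split=> [|c d]; first by apply: fpsP => -[].
by apply: fpsP => n; rewrite fcoefCM !fcoefC; case: n => // n; rewrite mulr0.
Qed.
HB.instance Definition _ := GRing.isZmodMorphism.Build R (fps R) fC fC_zmod.
HB.instance Definition _ := GRing.isMonoidMorphism.Build R (fps R) fC fC_monoid.

Lemma natr_fC m : m%:R = fC m%:R :> fps R.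
Proof. by rewrite rmorph_nat. Qed.

Lemma fcoef_natM m f n : (m%:R * f) n = m%:R * f n.
Proof. by rewrite natr_fC fcoefCM. Qed.

(** ** Truncation *)

(** Equality modulo t^L. *)
Definition eqt (L : nat) f g := forall n, (n < L)%N -> f n = g n.

Lemma eqtM L f f' g g' : eqt L f f' -> eqt L g g' -> eqt L (f * g) (f' * g').
Proof.
move=> ef eg n nL; rewrite !fcoefM; apply: eq_bigr => i _.
have iL : (i < L)%N := leq_trans (ltn_ord i) nL.
have jL : (n - i < L)%N by apply: leq_ltn_trans nL; rewrite leq_subr.
by rewrite ef ?eg.
Qed.

Lemma eqtX L f f' m : eqt L f f' -> eqt L (f ^+ m) (f' ^+ m).
Proof. by move=> e; elim: m => // m IH; rewrite !exprS; apply: eqtM. Qed.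

Lemma eqt_prod L I (r : seq I) (F G : I -> fps R) :
  (forall i, eqt L (F i) (G i)) ->
  eqt L (\prod_(i <- r) F i) (\prod_(i <- r) G i).
Proof.
move=> e; elim: r => [|i r IH]; first by rewrite !big_nil.
by rewrite !big_cons; apply: eqtM.
Qed.

Lemma fcoefX_lt f m n : f 0%N = 0 -> (n < m)%N -> (f ^+ m) n = 0.
Proof.
move=> f0; elim: m n => // m IH n lt_nm; rewrite exprS fcoefM big_ord_recl /= f0.
rewrite mul0r add0r big1 // => i _; rewrite IH ?mulr0 //= /bump /= add1n.
by case: n lt_nm i => [|n] lt_nm [i //= lt_i]; rewrite subSS ltnS in lt_nm *;
  apply: leq_ltn_trans lt_nm; rewrite leq_subr.
Qed.

End FpsRing.

Arguments fX {R}.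

(** ** Recursive definition of coefficients *)

(** A sequence whose n-th term is prescribed by the earlier ones exists; this
    produces inverses, compositional inverses and all series defined by
    triangular systems of equations. *)
Lemma recursive_sequence (T : Type) (t0 : T) (Phi : (nat -> T) -> nat -> T) :
  (forall f g n, (forall i, (i < n)%N -> f i = g i) -> Phi f n = Phi g n) ->
  exists f, forall n, f n = Phi f n.
Proof.
move=> loc; pose it n := iter n (fun f => Phi f) (fun=> t0).
have stable n i : (i < n)%N -> it n i = it n.+1 i.
  elim: n i => // n IH i; rewrite ltnS => le_in; apply: loc => j lt_ji.
  by apply: IH; apply: leq_trans lt_ji le_in.
have stab2 n m i : (i < n <= m)%N -> it n i = it m i.
  case/andP => lt_in; elim: m => [|m IH]; first by rewrite leqn0 => /eqP->.
  rewrite leq_eqVlt => /orP[/eqP-> //|]; rewrite ltnS => le_nm.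
  rewrite IH // stable //; exact: leq_trans lt_in le_nm.
exists (fun n => it n.+1 n) => n; rewrite -[LHS]/(Phi (it n) n); apply: loc.
by move=> i lt_in; symmetry; apply: stab2; rewrite ltnSn lt_in.
Qed.

Section FpsTheory.
Variable R : comNzRingType.
Implicit Types f g h : fps R.

Lemma finv_exists f : f 0%N = 1 -> exists g, f * g = 1.
Proof.
move=> f0.
have [|g gE] := @recursive_sequence R 0
  (fun u n => (n == 0%N)%:R - \sum_(i < n) f i.+1 * u (n - i.+1)%N).
  move=> g1 g2 n e; congr (_ - _); apply: eq_bigr => i _; rewrite e //.
  by rewrite ltn_subrL /= (leq_ltn_trans _ (ltn_ord i)).
exists (Fps g); apply: fpsP => n; rewrite fcoefM big_ord_recl /= f0 mul1r subn0.
rewrite gE addrAC -addrA; under [in X in _ + X]eq_bigr do rewrite /bump /= add1n.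
by rewrite subrr addr0.
Qed.

(** An inverse exists only when the constant coefficient is invertible; all
    uses have constant coefficient 1, and 0 is a default value. *)
Definition finv f : fps R :=
  if pselect (exists g, f * g = 1) is left e then sval (cid e) else 0.

Lemma fmulV f : f 0%N = 1 -> f * finv f = 1.
Proof.
by rewrite /finv => /finv_exists f_inv; case: pselect => // e; case: cid.
Qed.

Lemma finv_uniq f g : f * g = 1 -> f 0%N = 1 -> finv f = g.
Proof.
move=> fg f0; rewrite -[finv f]mul1r -fg mulrAC fmulV //.
by rewrite mul1r.
Qed.

Lemma finv0 f : f 0%N = 1 -> finv f 0%N = 1.
Proof.
by move=> f0; have /(congr1 (fun h : fps R => h 0%N)) := fmulV f0;
  rewrite fcoefM0 f0 mul1r.
Qed.

Lemma finvM f g : f 0%N = 1 -> g 0%N = 1 -> finv (f * g) = finv f * finv g.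
Proof.
move=> f0 g0; apply: finv_uniq; last by rewrite fcoefM0 f0 mul1r.
by rewrite mulrACA !fmulV // mul1r.
Qed.

Lemma finvK f : f 0%N = 1 -> finv (finv f) = f.
Proof. by move=> f0; apply: finv_uniq; rewrite ?finv0 // mulrC fmulV. Qed.

Lemma finv1 : finv 1 = 1 :> fps R.
Proof. by apply: finv_uniq; rewrite ?mulr1. Qed.

Lemma finv_prod I (r : seq I) (F : I -> fps R) :
  (forall i, F i 0%N = 1) ->
  (\prod_(i <- r) F i) 0%N = 1 /\
  finv (\prod_(i <- r) F i) = \prod_(i <- r) finv (F i).
Proof.
move=> F0; elim: r => [|i r [p0 IH]]; first by rewrite !big_nil finv1.
by rewrite !big_cons fcoefM0 F0 p0 mul1r finvM ?IH.
Qed.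

Lemma fmulI f g h : f 0%N = 1 -> f * g = f * h -> g = h.
Proof.
move=> f0 e; rewrite -[g]mul1r -[h]mul1r -(fmulV f0) [f * _]mulrC.
by rewrite -!mulrA e.
Qed.

(** ** The Euler derivation *)

(** The derivation t d/dt; unlike d/dt it does not shift the coefficients. *)
Definition theta f : fps R := Fps (fun n => n%:R * f n).

Lemma thetaE f n : theta f n = n%:R * f n. Proof. by []. Qed.

Fact theta_zmod : zmod_morphism theta.
Proof. by move=> f g; apply: fpsP => n; rewrite /= mulrBr. Qed.
HB.instance Definition _ := GRing.isZmodMorphism.Build (fps R) (fps R) theta theta_zmod.

Lemma theta_sum I (r : seq I) (P : pred I) (F : I -> fps R) :
  theta (\sum_(i <- r | P i) F i) = \sum_(i <- r | P i) theta (F i).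
Proof. exact: raddf_sum. Qed.

Lemma thetaM f g : theta (f * g) = theta f * g + f * theta g.
Proof.
apply: fpsP => n; rewrite fcoefD thetaE !fcoefM mulr_sumr -big_split.
apply: eq_bigr => i _ /=; have le_in : (i <= n)%N by rewrite -ltnS.
by rewrite -[X in X%:R * (_ * _) = _](subnKC le_in) natrD; ring.
Qed.

Lemma thetaC c : theta (fC c) = 0.
Proof. by apply: fpsP => -[|n]; rewrite /= ?mul0r ?mulr0. Qed.

Lemma theta1 : theta 1 = 0. Proof. by rewrite -(rmorph1 (@fC R)) thetaC. Qed.

Lemma theta_nat m : theta m%:R = 0. Proof. by rewrite natr_fC thetaC. Qed.

Lemma thetaX f m : theta (f ^+ m) = m%:R * f ^+ m.-1 * theta f.
Proof.
elim: m => [|[|m] IH]; first by rewrite theta1 !mul0r.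
  by rewrite expr1 /= expr0 !mul1r.
by rewrite exprS thetaM IH /= exprS -[m.+2%:R]natr1; ring.
Qed.

Lemma thetaV f : f 0%N = 1 -> theta (finv f) = - theta f * finv f ^+ 2.
Proof.
move=> f0; apply: (fmulI f0); have := congr1 theta (fmulV f0).
rewrite thetaM theta1 addrC => /eqP; rewrite addr_eq0 => /eqP ->.
by rewrite expr2 -{1}[finv f]mul1r -{1}(fmulV f0); ring.
Qed.

Lemma theta_fX : theta fX = fX :> fps R.
Proof. by apply: fpsP => -[|[|n]] /=; rewrite ?mulr0 ?mulr1. Qed.

(** Total derivatives have no residue: this is integration by parts. *)
Lemma theta_coef f n : (theta f - n%:R * f) n = 0.
Proof. by rewrite fcoefB thetaE fcoef_natM subrr. Qed.

(** ** Substitution *)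

(** The value at h of a power series whose coefficients are themselves power
    series; meaningful when h has no constant term. *)
Definition fev (F : fps (fps R)) h : fps R :=
  Fps (fun n => \sum_(m < n.+1) (F m * h ^+ m) n).

Lemma fevE F h n : fev F h n = \sum_(m < n.+1) (F m * h ^+ m) n.
Proof. by []. Qed.

Lemma fev_trunc F h n L : h 0%N = 0 -> (n < L)%N ->
  fev F h n = (\sum_(m < L) F m * h ^+ m) n.
Proof.
move=> h0 nL; rewrite fcoef_sum /= -!(big_mkord xpredT (fun m => (F m * h ^+ m) n)).
rewrite [RHS](big_cat_nat _ (n := n.+1)) //=.
rewrite [X in _ + X]big_nat_cond [X in _ + X]big1 ?addr0 // => m.
move=> /andP[/andP[lt_nm _] _]; rewrite big1 // => i _.
by rewrite fcoefX_lt ?mulr0 // (leq_ltn_trans _ lt_nm) ?leq_subr.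
Qed.

Lemma fevD F G h : fev (F + G) h = fev F h + fev G h.
Proof.
apply: fpsP => n.
transitivity (\sum_(m < n.+1) ((F m * h ^+ m) n + (G m * h ^+ m) n)).
  by apply: eq_bigr => i _; rewrite -fcoefD -mulrDl.
by rewrite big_split.
Qed.

Lemma fevN F h : fev (- F) h = - fev F h.
Proof.
apply: fpsP => n; rewrite fcoefN -sumrN; apply: eq_bigr => i _.
by rewrite -fcoefN -mulNr.
Qed.

Lemma fevB F G h : fev (F - G) h = fev F h - fev G h.
Proof. by rewrite fevD fevN. Qed.

Lemma sum_shift (V : nmodType) m n (G : nat -> V) :
  (forall i, (i < m)%N -> G i = 0) ->
  \sum_(i < m + n) G i = \sum_(i < n) G (m + i)%N.
Proof. by move=> G0; rewrite big_split_ord /= big1 ?add0r // => i _; apply: G0. Qed.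

Lemma fev_mulXn F f m h : h 0%N = 0 ->
  fev (fC f * fX ^+ m * F) h = f * h ^+ m * fev F h.
Proof.
move=> h0; apply: fpsP => n.
rewrite (fev_trunc _ h0 (ltn_addl m (ltnSn n))).
have e : eqt n.+1 (fev F h) (\sum_(i < n.+1) F i * h ^+ i).
  by move=> i iL; exact: fev_trunc.
have e1 : eqt n.+1 (f * h ^+ m) (f * h ^+ m) by [].
rewrite (eqtM e1 e (ltnSn n)); congr (fcoef _ n).
rewrite (@sum_shift _ m n.+1 (fun i => (fC f * fX ^+ m * F) i * h ^+ i)) => [|i lt_im].
  rewrite mulr_sumr; apply: eq_bigr => i _.
  by rewrite -mulrA fcoefCM fcoefXnM leq_addr addKn exprD; ring.
by rewrite -mulrA fcoefCM fcoefXnM leqNgt lt_im mulr0 mul0r.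
Qed.

Lemma fev1 h : h 0%N = 0 -> fev 1 h = 1.
Proof.
move=> h0; apply: fpsP => n; rewrite fevE big_ord_recl big1 ?addr0.
  by rewrite !fcoef1 mul1r.
by move=> i _; rewrite fcoef1 mul0r.
Qed.

Lemma fev_mono f m h : h 0%N = 0 -> fev (fC f * fX ^+ m) h = f * h ^+ m.
Proof. by move=> h0; rewrite -[fC f * _]mulr1 fev_mulXn // fev1 ?mulr1. Qed.

Lemma fev_sum I (r : seq I) (F : I -> fps (fps R)) h :
  fev (\sum_(i <- r) F i) h = \sum_(i <- r) fev (F i) h.
Proof.
apply: (big_morph (fun F => fev F h)) => [F1 F2|]; first exact: fevD.
by apply: fpsP => n; rewrite fevE big1 // => i _; rewrite mul0r.
Qed.

Lemma fps_truncE (S : comNzRingType) (f : fps S) L n : (n < L)%N ->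
  (\sum_(m < L) fC (f m) * fX ^+ m) n = f n.
Proof.
move=> nL; rewrite fcoef_sum (bigD1 (Ordinal nL)) // fcoefCM fcoefXn eqxx mulr1.
rewrite big1 => [|i ne]; first by rewrite [LHS]addr0.
rewrite fcoefCM fcoefXn eq_sym.
by rewrite (negPf (ne : (i : nat) != n)) mulr0.
Qed.

Lemma fevM F G h : h 0%N = 0 -> fev (F * G) h = fev F h * fev G h.
Proof.
move=> h0; apply: fpsP => n; set L := n.+1.
pose F' := \sum_(m < L) fC (F m) * fX ^+ m.
have FF' : eqt L F F' by move=> i iL; rewrite /F' fps_truncE.
have evL (A B : fps (fps R)) i : eqt L A B -> (i < L)%N -> fev A h i = fev B h i.
  move=> AB iL; rewrite !(fev_trunc _ h0 iL) !fcoef_sum.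
  by apply: eq_bigr => m _; rewrite AB.
have -> : fev (F * G) h n = fev (F' * G) h n by apply: evL; rewrite // => i iL; apply: eqtM iL.
have -> : (fev F h * fev G h) n = (fev F' h * fev G h) n.
  by apply: (eqtM (L := L)) => // i iL; apply: evL.
congr (fcoef _ n); rewrite /F' mulr_suml !fev_sum mulr_suml; apply: eq_bigr => i _.
by rewrite fev_mulXn // fev_mono.
Qed.

End FpsTheory.

Section FpsMap.
Variables (R S : comNzRingType) (phi : {rmorphism R -> S}).
Implicit Types f g : fps R.

Definition fmap (f : fps R) : fps S := Fps (fun n => phi (f n)).

Fact fmap_zmod : zmod_morphism fmap.
Proof. by move=> f g; apply: fpsP => n /=; rewrite rmorphB. Qed.
Fact fmap_monoid : monoid_morphism fmap.
Proof.
split=> [|f g]; first by apply: fpsP => n /=; rewrite rmorph_nat.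
by apply: fpsP => n /=; rewrite rmorph_sum; apply: eq_bigr => i _; rewrite rmorphM.
Qed.
HB.instance Definition _ := GRing.isZmodMorphism.Build (fps R) (fps S) fmap fmap_zmod.
HB.instance Definition _ := GRing.isMonoidMorphism.Build (fps R) (fps S) fmap fmap_monoid.

Lemma fmapE f n : fmap f n = phi (f n). Proof. by []. Qed.

Lemma fmapC c : fmap (fC c) = fC (phi c).
Proof. by apply: fpsP => n /=; case: eqP => // _; rewrite rmorph0. Qed.

Lemma fmap_fX : fmap fX = fX.
Proof. by apply: fpsP => n /=; rewrite rmorph_nat. Qed.

Lemma fmapV f : f 0%N = 1 -> fmap (finv f) = finv (fmap f).
Proof.
move=> f0; symmetry; apply: finv_uniq; last by rewrite /= f0 rmorph1.
by rewrite -rmorphM fmulV // rmorph1.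
Qed.

End FpsMap.

Section FpsComp.
Variable R : comNzRingType.
Implicit Types f g h : fps R.

(** Defined through [fev], so that multiplicativity is proved only once. *)
Definition fcomp f h : fps R := fev (fmap (@fC R) f) h.

Lemma fcompE f h n : fcomp f h n = \sum_(m < n.+1) f m * (h ^+ m) n.
Proof. by apply: eq_bigr => m _; rewrite fmapE fcoefCM. Qed.

Lemma fcomp_trunc f h n L : h 0%N = 0 -> (n < L)%N ->
  fcomp f h n = (\sum_(m < L) fC (f m) * h ^+ m) n.
Proof. by move=> h0 nL; rewrite /fcomp (fev_trunc _ h0 nL). Qed.

Lemma fcompM f g h : h 0%N = 0 -> fcomp (f * g) h = fcomp f h * fcomp g h.
Proof. by move=> h0; rewrite /fcomp rmorphM fevM. Qed.
Lemma fcompD f g h : fcomp (f + g) h = fcomp f h + fcomp g h.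
Proof. by rewrite /fcomp rmorphD fevD. Qed.
Lemma fcompB f g h : fcomp (f - g) h = fcomp f h - fcomp g h.
Proof. by rewrite /fcomp rmorphB fevB. Qed.

Lemma fcomp1 h : h 0%N = 0 -> fcomp 1 h = 1.
Proof. by move=> h0; rewrite /fcomp rmorph1 fev1. Qed.
Lemma fcompC c h : h 0%N = 0 -> fcomp (fC c) h = fC c.
Proof.
move=> h0; rewrite /fcomp fmapC; by have := fev_mono (fC c) 0 h0; rewrite !expr0 !mulr1.
Qed.
Lemma fcompfX h : h 0%N = 0 -> fcomp fX h = h.
Proof.
by move=> h0; rewrite /fcomp fmap_fX; have := fev_mono 1 1 h0; rewrite rmorph1 !mul1r.
Qed.
Lemma fcompX f h m : h 0%N = 0 -> fcomp (f ^+ m) h = fcomp f h ^+ m.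
Proof. by move=> h0; elim: m => [|m IH]; rewrite ?fcomp1 // !exprS fcompM // IH. Qed.
Lemma fcomp0 f h : fcomp f h 0%N = f 0%N.
Proof. by rewrite fcompE big_ord_recl big_ord0 expr0 fcoef1 mulr1 addr0. Qed.
Lemma fcomp_prod I (r : seq I) (F : I -> fps R) h : h 0%N = 0 ->
  fcomp (\prod_(i <- r) F i) h = \prod_(i <- r) fcomp (F i) h.
Proof.
by move=> h0; apply: (big_morph (fun f => fcomp f h)) => [f g|];
  [exact: fcompM | exact: fcomp1].
Qed.
Lemma fcompV f h : h 0%N = 0 -> f 0%N = 1 -> fcomp (finv f) h = finv (fcomp f h).
Proof.
move=> h0 f0; symmetry; apply: finv_uniq; last by rewrite fcomp0.
by rewrite -fcompM // fmulV // fcomp1.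
Qed.
Lemma fcomp_nat m h : h 0%N = 0 -> fcomp m%:R h = m%:R.
Proof. by move=> h0; rewrite natr_fC fcompC. Qed.

Lemma fcomp_eqt L f g h : h 0%N = 0 -> eqt L f g -> eqt L (fcomp f h) (fcomp g h).
Proof.
move=> h0 e n nL; rewrite !fcompE; apply: eq_bigr => i _.
by rewrite e // (leq_trans (ltn_ord i) nL).
Qed.

Lemma fcompA f g h : g 0%N = 0 -> h 0%N = 0 ->
  fcomp (fcomp f g) h = fcomp f (fcomp g h).
Proof.
move=> g0 h0; apply: fpsP => n.
have gh0 : fcomp g h 0%N = 0 by rewrite fcomp0.
have e : eqt n.+1 (fcomp f g) (\sum_(m < n.+1) fC (f m) * g ^+ m).
  by move=> i iL; exact: fcomp_trunc.
rewrite (fcomp_eqt h0 e (ltnSn n)) (fcomp_trunc _ gh0 (ltnSn n)); congr (fcoef _ n).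
rewrite /fcomp rmorph_sum fev_sum; apply: eq_bigr => m _.
by rewrite -[LHS]/(fcomp _ _) fcompM // fcompC // fcompX.
Qed.

Lemma fcoefX_diag h n : h 0%N = 0 -> h 1%N = 1 -> (h ^+ n) n = 1.
Proof.
move=> h0 h1; elim: n => // n IH.
rewrite exprS fcoefM !big_ord_recl /= h0 mul0r add0r h1 mul1r.
rewrite subSS subn0 IH big1 ?addr0 // => i _; rewrite fcoefX_lt ?mulr0 //=.
rewrite /bump /= !add1n subSS.
by case: i => i /= lt_i; rewrite ltn_subrL /= (leq_ltn_trans _ lt_i).
Qed.

(** Substituting h = t + O(t^2) is a unitriangular linear map on coefficients,
    hence bijective. *)
Lemma fcomp_surj f h : h 0%N = 0 -> h 1%N = 1 -> exists g, fcomp g h = f.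
Proof.
move=> h0 h1.
have hnn n : (h ^+ n) n = 1 by exact: fcoefX_diag.
have [|g gE] := @recursive_sequence R 0
  (fun u n => f n - \sum_(m < n) u m * (h ^+ m) n).
  by move=> g1 g2 n e; congr (_ - _); apply: eq_bigr => i _; rewrite e.
by exists (Fps g); apply: fpsP => n; rewrite fcompE big_ord_recr /= hnn mulr1 gE addrC subrK.
Qed.

Lemma fcomp_inj f g h : h 0%N = 0 -> h 1%N = 1 -> fcomp f h = fcomp g h -> f = g.
Proof.
move=> h0 h1 e; apply: fpsP => n; elim/ltn_ind: n => n IH.
have hnn m : (h ^+ m) m = 1 by exact: fcoefX_diag.
have /(congr1 (fun f : fps R => f n)) := e.
rewrite !fcompE !big_ord_recr /= !hnn !mulr1.
rewrite (eq_bigr (fun i : 'I_n => g i * (h ^+ i) n)); first by move/addrI.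
by move=> i _; rewrite IH.
Qed.

(** The chain rule for t d/dt; multiplying by v avoids a division by h = t v. *)
Lemma theta_fcomp f v :
  theta (fcomp f (fX * v)) * v = fcomp (theta f) (fX * v) * (v + theta v).
Proof.
set h := fX * v.
have h0 : h 0%N = 0 by rewrite fcoefM0 mul0r.
apply: fpsP => n.
have e : eqt n.+1 (fcomp f h) (\sum_(m < n.+1) fC (f m) * h ^+ m).
  by move=> i iL; exact: fcomp_trunc.
have e2 : eqt n.+1 (fcomp (theta f) h) (\sum_(m < n.+1) fC (theta f m) * h ^+ m).
  by move=> i iL; exact: fcomp_trunc.
have e3 : eqt n.+1 (theta (fcomp f h)) (theta (\sum_(m < n.+1) fC (f m) * h ^+ m)).
  by move=> i iL; rewrite !thetaE e.
rewrite (eqtM e3 (fun _ _ => erefl) (ltnSn n)) (eqtM e2 (fun _ _ => erefl) (ltnSn n)).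
congr (fcoef _ n); rewrite theta_sum !mulr_suml; apply: eq_bigr => m _.
rewrite thetaM thetaC mul0r add0r thetaX thetaE rmorphM /= -natr_fC.
have -> : theta h = fX * (v + theta v) by rewrite /h thetaM theta_fX mulrDr.
case: (nat_of_ord m) => [|j]; first by rewrite !mul0r !mulr0 !mul0r.
have -> : h ^+ j.+1 = fX * v * h ^+ j by rewrite exprS.
rewrite -pred_Sn; move: (h ^+ j) (theta v) (fC _) => a b c; ring.
Qed.

End FpsComp.

(** * Change of variable and Lagrange inversion *)

Section Transfer.
Variable K : numFieldType.
Implicit Types (f g q v R : fps K).

(** The residue theorem for a substitution s = V(y): the coefficient of s^N in
    q(s) is the residue of q s^(-N-1) ds, computed in the variable y. *)
Lemma transfer q v N : v 0%N = 1 ->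
  q N = (fcomp q (fX * v) * (v + theta v) * finv v ^+ N.+1) N.
Proof.
move=> v0; set w := finv v; set V := fX * v.
have V0 : V 0%N = 0 by rewrite fcoefM0 mul0r.
have vw : v * w = 1 := fmulV v0.
have w0 : w 0%N = 1 := finv0 v0.
have key p : (w ^+ p + w ^+ p.+1 * theta v) p = (p == 0%N)%:R.
  case: p => [|p]; first by rewrite expr0 fcoefD fcoef1 fcoefM0 thetaE !mul0r mulr0 addr0.
  apply: (@mulfI _ p.+1%:R); first by rewrite pnatr_eq0.
  rewrite mulr0; have := theta_coef (w ^+ p.+1) p.+1.
  rewrite thetaX thetaV // -fcoef_natM => e.
  rewrite -[RHS]oppr0 -e -fcoefN; congr (fcoef _ _).
  by rewrite /= -/w [w ^+ p.+2]exprSr [w ^+ p.+1]exprSr; ring.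
rewrite -mulrA.
have e : eqt N.+1 (fcomp q V) (\sum_(m < N.+1) fC (q m) * V ^+ m).
  by move=> i iL; exact: fcomp_trunc.
rewrite (eqtM e (fun _ _ => erefl) (ltnSn N)) mulr_suml fcoef_sum.
have termE m : (m < N.+1)%N ->
    (fC (q m) * V ^+ m * ((v + theta v) * w ^+ N.+1)) N = q m * (N - m == 0)%N%:R.
  rewrite ltnS => le_mN; rewrite -mulrA fcoefCM /V exprMn -!mulrA fcoefXnM le_mN.
  rewrite -key; congr (_ * fcoef _ _).
  rewrite -{1}(subnK le_mN) -addSn exprD.
  have -> : v ^+ m * ((v + theta v) * (w ^+ (N - m).+1 * w ^+ m)) =
         (v * w) ^+ m * ((v + theta v) * w ^+ (N - m).+1) by rewrite exprMn; ring.
  rewrite vw expr1n mul1r mulrDl -[X in _ = X + _]mul1r -vw exprS; ring.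
rewrite (eq_bigr (fun m : 'I_N.+1 => q m * (N - m == 0)%N%:R)) => [|m _]; last exact: termE.
rewrite big_ord_recr /= subnn eqxx mulr1 big1 ?add0r // => i _.
by rewrite subn_eq0 leqNgt ltn_ord mulr0.
Qed.

(** With G(x) = x g(1/x), the functions x = R(y) / y and y = 1 / G(x) are inverse
    to each other exactly when g(V) = v, where v = 1 / R(y) and V = y v = 1 / x. *)
Definition cumulants_of g R := R 0%N = 1 /\ fcomp g (fX * finv R) = finv R.

Section Relation.
Variables (g R : fps K).
Hypothesis gR : cumulants_of g R.

Let R0 : R 0%N = 1 := proj1 gR.
Let v := finv R.
Let V := fX * v.
Let gV : fcomp g V = v := proj2 gR.
Let v0 : v 0%N = 1. Proof. exact: finv0. Qed.
Let V0 : V 0%N = 0. Proof. by rewrite fcoefM0 mul0r. Qed.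
Let Rv : R * v = 1. Proof. exact: fmulV. Qed.
Let wE : finv v = R. Proof. exact: finvK. Qed.

Lemma cumulants_g0 : g 0%N = 1.
Proof. by rewrite -(fcomp0 g V) gV. Qed.

Let dV : v + theta v = v ^+ 2 * (R - theta R).
Proof. by rewrite /v thetaV // mulrBr -/v mulrA expr2 -[v * v * R]mulrA [v * R]mulrC Rv; ring. Qed.

(** Lagrange inversion: the free cumulants are explicit polynomials in the
    coefficients of g. *)
Lemma lagrange n : (0 < n)%N -> (g ^+ n.-1) n = (1 - n%:R) * R n.
Proof.
case: n => // n _; rewrite -[n.+1.-1]/n (transfer (g ^+ n) _ v0) -/V fcompX // gV wE dV.
rewrite mulrBl mul1r -thetaE -fcoefB; congr (fcoef _ _).
have -> : v ^+ n * (v ^+ 2 * (R - theta R)) * R ^+ n.+2 =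
   (R * v) ^+ n.+2 * (R - theta R) by rewrite exprMn !exprS; ring.
by rewrite Rv expr1n mul1r.
Qed.

(** The generating series of the polynomials C_m. *)
Definition Cser R := finv (R - theta R).

Let D0 : (R - theta R) 0%N = 1. Proof. by rewrite fcoefB thetaE mul0r subr0. Qed.
Let DC : (R - theta R) * Cser R = 1. Proof. exact: fmulV. Qed.

(** G'(x) = C(y): differentiate x = R(y) / y. *)
Lemma fcomp_g1 : fcomp (theta g - g) V = - Cser R.
Proof.
apply: (fmulI D0); rewrite mulrN DC; apply: (@fmulI _ (v ^+ 2)).
  by rewrite fcoefX0 v0 expr1n.
have := theta_fcomp g v; rewrite -/V gV dV => e.
rewrite fcompB gV; set Y := fcomp _ _ in e *.
transitivity (Y * (v ^+ 2 * (R - theta R)) - v * (v ^+ 2 * (R - theta R))).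
  by ring.
by rewrite -e -dV; ring.
Qed.

(** The left-hand side is x G''(x), again as a function of y: differentiate
    G'(x) = C(y) once more. *)
Lemma fcomp_theta_g1 : fcomp (theta (theta g - g)) V = - (R * Cser R * theta (Cser R)).
Proof.
have := theta_fcomp (theta g - g) v; rewrite -/V fcomp_g1 raddfN /= dV => e.
have -> : fcomp (theta (theta g - g)) V = (R * v) ^+ 2 * ((R - theta R) * Cser R) *
   fcomp (theta (theta g - g)) V by rewrite Rv DC expr1n !mul1r.
transitivity (R ^+ 2 * Cser R * (fcomp (theta (theta g - g)) V * (v ^+ 2 * (R - theta R)))).
  by rewrite exprMn; ring.
rewrite -e -[RHS]mulr1 -Rv; ring.
Qed.

(** The residue of G^(N - 1) G'^4, computed in the variable y. *)
Lemma transfer_C3 N :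
  (g ^+ N * finv g * (theta g - g) ^+ 4) N = (Cser R ^+ 3) N.
Proof.
have g0 := cumulants_g0.
rewrite [LHS](transfer _ _ v0) -/V !fcompM // !fcompX // fcompV // fcomp_g1 gV wE dV.
congr (fcoef _ _).
have -> : v ^+ N * R * (- Cser R) ^+ 4 * (v ^+ 2 * (R - theta R)) * R ^+ N.+1 =
   (R * v) ^+ N * (R * v) ^+ 2 * ((R - theta R) * Cser R) * Cser R ^+ 3.
  by rewrite !exprMn !exprS; ring.
by rewrite Rv DC !expr1n !mul1r.
Qed.

(** The residue of G^(N + 1) G''^2, computed in the variable y; here
    theta (theta g - g) is x G''(x). *)
Lemma transfer_CdC2 N :
  (g ^+ N.+1 * theta (theta g - g) ^+ 2) N = (Cser R * theta (Cser R) ^+ 2) N.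
Proof.
rewrite [LHS](transfer _ _ v0) -/V !fcompM // !fcompX // fcomp_theta_g1 gV wE dV.
congr (fcoef _ _).
have -> : v ^+ N.+1 * (- (R * Cser R * theta (Cser R))) ^+ 2 *
     (v ^+ 2 * (R - theta R)) * R ^+ N.+1 =
   (R * v) ^+ N.+1 * (R * v) ^+ 2 * ((R - theta R) * Cser R) *
     (Cser R * theta (Cser R) ^+ 2).
  by rewrite !exprMn !exprS; ring.
by rewrite Rv DC !expr1n !mul1r.
Qed.

End Relation.
End Transfer.

(** * The fourth-order term of a product of shifted series *)

Section Fourth.
Variable K : numFieldType.
Implicit Types (f g q v R : fps K).

(** With G(x) = x g(1/x), the series [taylor g n] is (-1)^n G^(n)(x) / n!, up
    to a power of x. *)
Fixpoint taylor g n : fps K :=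
  if n is n'.+1 then
    fC (n%:R^-1) * (theta (taylor g n') + (n'%:R - 1) * taylor g n')
  else g.

(** The expansion of G(x - j eps) in powers of eps, up to powers of x that
    depend only on the order in eps. *)
Definition shift_expansion g (j : nat) : fps (fps K) :=
  Fps (fun n => j%:R ^+ n * taylor g n).

(** The power sums and the monomial symmetric functions (indexed by partitions
    of size at most 4) of the numbers 0, 1, ..., x - 1, as polynomials in x. *)
Definition psum1 (x : K) := x * (x - 1) / 2%:R.
Definition psum2 (x : K) := x * (x - 1) * (2%:R * x - 1) / 6%:R.
Definition psum3 (x : K) := psum1 x ^+ 2.
Definition psum4 (x : K) :=
  x * (x - 1) * (2%:R * x - 1) * (3%:R * x ^+ 2 - 3%:R * x - 1) / 30%:R.
Definition mono11 (x : K) := (psum1 x ^+ 2 - psum2 x) / 2%:R.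
Definition mono21 (x : K) := psum1 x * psum2 x - psum3 x.
Definition mono111 (x : K) :=
  (psum1 x ^+ 3 - 3%:R * psum1 x * psum2 x + 2%:R * psum3 x) / 6%:R.
Definition mono31 (x : K) := psum1 x * psum3 x - psum4 x.
Definition mono22 (x : K) := (psum2 x ^+ 2 - psum4 x) / 2%:R.
Definition mono211 (x : K) := psum2 x * mono11 x - mono31 x.
Definition mono1111 (x : K) :=
  (psum1 x ^+ 4 - 6%:R * psum1 x ^+ 2 * psum2 x + 3%:R * psum2 x ^+ 2
   + 8%:R * psum1 x * psum3 x - 6%:R * psum4 x) / 24%:R.

Let char0 n : (n.+1%:R : K) != 0. Proof. by rewrite pnatr_eq0. Qed.

Ltac fld := rewrite /mono1111 /mono211 /mono22 /mono31 /mono111 /mono21 /mono11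
  /psum4 /psum3 /psum2 /psum1; field; rewrite ?char0 //.

Let psum1S x : psum1 (x + 1) = psum1 x + x. Proof. by fld. Qed.
Let psum2S x : psum2 (x + 1) = psum2 x + x ^+ 2. Proof. by fld. Qed.
Let psum3S x : psum3 (x + 1) = psum3 x + x ^+ 3. Proof. by fld. Qed.
Let psum4S x : psum4 (x + 1) = psum4 x + x ^+ 4. Proof. by fld. Qed.
Let mono11S x : mono11 (x + 1) = mono11 x + x * psum1 x. Proof. by fld. Qed.
Let mono21S x : mono21 (x + 1) = mono21 x + x ^+ 2 * psum1 x + x * psum2 x.
Proof. by fld. Qed.
Let mono111S x : mono111 (x + 1) = mono111 x + x * mono11 x. Proof. by fld. Qed.
Let mono31S x : mono31 (x + 1) = mono31 x + x ^+ 3 * psum1 x + x * psum3 x.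
Proof. by fld. Qed.
Let mono22S x : mono22 (x + 1) = mono22 x + x ^+ 2 * psum2 x. Proof. by fld. Qed.
Let mono211S x : mono211 (x + 1) = mono211 x + x ^+ 2 * mono11 x + x * mono21 x.
Proof. by fld. Qed.
Let mono1111S x : mono1111 (x + 1) = mono1111 x + x * mono111 x. Proof. by fld. Qed.

Variable g : fps K.
Hypothesis g0 : g 0%N = 1.
Let h := finv g.
Let gh : g * h = 1. Proof. exact: fmulV. Qed.
Let a n := taylor g n.
Let c (u : K) := fC u.

(** Multiplying out, a choice of orders n_j in the factors j contributes the
    product of the j^(n_j); the choices with the same orders up to permutation
    add up to a monomial symmetric function of 0, ..., k - 1. *)
Lemma shift_product_coefs k (P := \prod_(j < k) shift_expansion g j) :
  [/\ P 0%N = g ^+ k,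
      P 1%N = g ^+ k * (h * a 1%N * c (psum1 k%:R)),
      P 2%N = g ^+ k * (h * a 2%N * c (psum2 k%:R) + (h * a 1%N) ^+ 2 * c (mono11 k%:R)),
      P 3%N = g ^+ k * (h * a 3%N * c (psum3 k%:R)
                      + (h * a 1%N) * (h * a 2%N) * c (mono21 k%:R)
                      + (h * a 1%N) ^+ 3 * c (mono111 k%:R)) &
      P 4%N = g ^+ k * (h * a 4%N * c (psum4 k%:R)
                      + (h * a 1%N) * (h * a 3%N) * c (mono31 k%:R)
                      + (h * a 2%N) ^+ 2 * c (mono22 k%:R)
                      + (h * a 1%N) ^+ 2 * (h * a 2%N) * c (mono211 k%:R)
                      + (h * a 1%N) ^+ 4 * c (mono1111 k%:R))].
Proof.
have coefM4 (S : comNzRingType) (F G : fps S) :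
  [/\ (F * G) 0%N = F 0%N * G 0%N,
      (F * G) 1%N = F 0%N * G 1%N + F 1%N * G 0%N,
      (F * G) 2%N = F 0%N * G 2%N + F 1%N * G 1%N + F 2%N * G 0%N,
      (F * G) 3%N = F 0%N * G 3%N + F 1%N * G 2%N + F 2%N * G 1%N + F 3%N * G 0%N &
      (F * G) 4%N = F 0%N * G 4%N + F 1%N * G 3%N + F 2%N * G 2%N + F 3%N * G 1%N
                    + F 4%N * G 0%N].
  by split; rewrite fcoefM !big_ord_recr big_ord0 /= add0r.
rewrite {}/P /c; elim: k => [|k [IH0 IH1 IH2 IH3 IH4]].
  have psum1_0 : psum1 0 = 0 by fld.
  have psum2_0 : psum2 0 = 0 by fld.
  have psum3_0 : psum3 0 = 0 by fld.
  have psum4_0 : psum4 0 = 0 by fld.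
  have mono11_0 : mono11 0 = 0 by fld.
  have mono21_0 : mono21 0 = 0 by fld.
  have mono111_0 : mono111 0 = 0 by fld.
  have mono31_0 : mono31 0 = 0 by fld.
  have mono22_0 : mono22 0 = 0 by fld.
  have mono211_0 : mono211 0 = 0 by fld.
  have mono1111_0 : mono1111 0 = 0 by fld.
  have E n : (n.+1 == 0)%N%:R = 0 :> fps K by [].
  by rewrite big_ord0 !fcoef1 !E expr0; split=> //; symmetry;
    rewrite ?(psum1_0, psum2_0, psum3_0, psum4_0, mono11_0, mono21_0, mono111_0,
      mono31_0, mono22_0, mono211_0, mono1111_0) ?rmorph0; ring.
have aE n : a n = g * (h * a n) by rewrite mulrA gh mul1r.
have FE n : shift_expansion g k n = k%:R ^+ n * (g * (h * a n)) by rewrite -aE.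
have F0 : shift_expansion g k 0%N = g by rewrite /= mul1r.
rewrite big_ord_recr; case: (coefM4 _ (\prod_(j < k) shift_expansion g j) (shift_expansion g k)).
move=> -> -> -> -> ->; rewrite IH0 IH1 IH2 IH3 IH4 F0 !FE.
rewrite -[k.+1%:R]natr1 psum1S psum2S psum3S psum4S mono11S mono21S mono111S mono31S
  mono22S mono211S mono1111S [g ^+ k.+1]exprSr.
move: (psum1 _) (psum2 _) (psum3 _) (psum4 _) (mono11 _) (mono21 _) (mono111 _) (mono31 _) (mono22 _) (mono211 _) (mono1111 _).
move: (g ^+ k) (h * a 1%N) (h * a 2%N) (h * a 3%N) (h * a 4%N) => G b1 b2 b3 b4 *.
rewrite !rmorphD !(rmorphXn, rmorphM) !rmorph_nat.
by split; ring.
Qed.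

Lemma thetaTaylor n :
  theta (a n) = n.+1%:R * a n.+1 - (n%:R - 1) * a n.
Proof.
rewrite /a [taylor g n.+1]/= natr_fC mulrA -rmorphM mulfV ?pnatr_eq0 //.
by rewrite rmorph1 mul1r addrK.
Qed.

Lemma taylor1 : a 1%N = theta g - g.
Proof. by rewrite /a /= invr1 rmorph1 mul1r sub0r mulN1r. Qed.

(** Only two of the five terms of weight 4 in G, G', G'', G''', G'''' are
    independent modulo total derivatives: those with G'^4 and G''^2. *)
Lemma fourth_coef N (k := N.+3) :
  (\prod_(j < k) shift_expansion g j) 4%N N =
   (mono1111 k%:R - N%:R / 6%:R * mono211 k%:R
     + N.+1%:R * N%:R / 18%:R * mono31 k%:R
     - N.+2%:R * N.+1%:R * N%:R / 72%:R * psum4 k%:R) * (g ^+ N * h * a 1%N ^+ 4) N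
 + (mono22 k%:R - 2%:R / 3%:R * mono31 k%:R + N.+2%:R / 6%:R * psum4 k%:R)
   / 4%:R * (g ^+ N.+1 * theta (a 1%N) ^+ 2) N.
Proof.
case: (shift_product_coefs k) => _ _ _ _ ->.
pose T4 := g ^+ N.+2 * a 4%N; pose T31 := g ^+ N.+1 * a 1%N * a 3%N.
pose T22 := g ^+ N.+1 * a 2%N ^+ 2; pose T211 := g ^+ N * a 1%N ^+ 2 * a 2%N.
pose T1111 := g ^+ N * h * a 1%N ^+ 4.
have thg : theta g = a 1%N + g by rewrite taylor1 subrK.
have tha1 : theta (a 1%N) = 2%:R * a 2%N by rewrite thetaTaylor; ring.
have tha2 : theta (a 2%N) = 3%:R * a 3%N - a 2%N by rewrite thetaTaylor; ring.
have tha3 : theta (a 3%N) = 4%:R * a 4%N - 2%:R * a 3%N by rewrite thetaTaylor; ring.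
have thgX m : theta (g ^+ m.+1) = m.+1%:R * g ^+ m * (a 1%N + g).
  by rewrite thetaX thg.
(* The total derivatives of G^(k-1) D^3 G, of G^(k-2) DG D^2 G and of G^(k-3) (DG)^3,
   where D = d/dx, eliminate T4, T31 and T211. *)
have rel1 : N.+2%:R * T31 N + 4%:R * T4 N = 0.
  have := theta_coef (g ^+ N.+2 * a 3%N) N.
  rewrite thetaM thgX tha3 -!fcoef_natM -fcoefD => <-; congr (fcoef _ _).
  by rewrite /T31 /T4 -![_.+2%:R]natr1 -![_.+1%:R]natr1 !exprS; ring.
have rel2 : N.+1%:R * T211 N + 2%:R * T22 N + 3%:R * T31 N = 0.
  have := theta_coef (g ^+ N.+1 * a 1%N * a 2%N) N.
  rewrite thetaM [theta (_ * a 1%N)]thetaM thgX tha1 tha2 -!fcoef_natM -!fcoefD => <-; congr (fcoef _ _).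
  by rewrite /T211 /T22 /T31 -![_.+1%:R]natr1 !exprS; ring.
have rel3 : N%:R * T1111 N + 6%:R * T211 N = 0.
  have := theta_coef (g ^+ N * a 1%N ^+ 3) N.
  rewrite thetaM [theta (g ^+ N)]thetaX [theta (_ ^+ 3)]thetaX thg tha1 -!fcoef_natM -!fcoefD => <-; congr (fcoef _ _).
  rewrite /T1111 /T211; case: (N) => [|M]; first by rewrite expr0 /=; ring.
  have -> : g ^+ M.+1 * h * a 1%N ^+ 4 = g ^+ M * a 1%N ^+ 4.
    by rewrite exprSr -(mulrA _ g) gh mulr1.
  by rewrite -pred_Sn -![_.+1%:R]natr1 !exprS; ring.
have -> : g ^+ N.+1 * theta (a 1%N) ^+ 2 = 4%:R * T22 by rewrite tha1 /T22; ring.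
rewrite -/T1111 fcoef_natM.
transitivity (psum4 k%:R * T4 N + mono31 k%:R * T31 N + mono22 k%:R * T22 N +
   mono211 k%:R * T211 N + mono1111 k%:R * T1111 N).
  rewrite -!fcoefCM -!fcoefD; congr (fcoef _ _).
  have e3 : g ^+ k = g ^+ N * g ^+ 3 by rewrite -exprD addn3.
  have e2 : g ^+ N.+2 = g ^+ N * g ^+ 2 by rewrite -exprD addn2.
  have e1 : g ^+ N.+1 = g ^+ N * g by rewrite exprSr.
  have h3 : h = g ^+ 3 * h ^+ 4.
    by rewrite [h ^+ 4]exprSr mulrA -exprMn gh expr1n mul1r.
  transitivity (g ^+ N * (g * h) ^+ 1 * g ^+ 2 * a 4%N * c (psum4 k%:R)
    + g ^+ N * (g * h) ^+ 2 * g * a 1%N * a 3%N * c (mono31 k%:R)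
    + g ^+ N * (g * h) ^+ 2 * g * a 2%N ^+ 2 * c (mono22 k%:R)
    + g ^+ N * (g * h) ^+ 3 * a 1%N ^+ 2 * a 2%N * c (mono211 k%:R)
    + g ^+ N * (g ^+ 3 * h ^+ 4) * a 1%N ^+ 4 * c (mono1111 k%:R)).
    by rewrite e3; ring.
  by rewrite -h3 gh !expr1n /T4 /T31 /T22 /T211 /T1111 /c e2 e1; ring.
have {rel1} -> : T4 N = - (N.+2%:R * T31 N) / 4%:R.
  by apply: (mulIf (char0 3)); rewrite mulfVK ?char0 // mulrC; apply/eqP; rewrite -addr_eq0 addrC rel1.
have {rel2} -> : T31 N = - (N.+1%:R * T211 N + 2%:R * T22 N) / 3%:R.
  by apply: (mulIf (char0 2)); rewrite mulfVK ?char0 // mulrC; apply/eqP; rewrite -addr_eq0 addrC rel2.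
have {rel3} -> : T211 N = - (N%:R * T1111 N) / 6%:R.
  by apply: (mulIf (char0 5)); rewrite mulfVK ?char0 // mulrC; apply/eqP; rewrite -addr_eq0 addrC rel3.
move: (T1111 N) (T22 N) (psum4 _) (mono31 _) (mono22 _) (mono211 _) (mono1111 _) => x y p m1 m2 m3 m4.
by field; rewrite ?char0.
Qed.

End Fourth.

Section FourthC.
Variable K : numFieldType.
Implicit Types (g R : fps K).

(** [C^2 theta^2 C] and [C (theta C)^2] differ by a total derivative. *)
Lemma CdC2_coef (C : fps K) N :
  (C * theta C ^+ 2) N =
    (N%:R ^+ 2 / 3%:R * (C ^+ 3) N - (C ^+ 2 * theta (theta C)) N) / 2%:R.
Proof.
have char0 n : (n.+1%:R : K) != 0 by rewrite pnatr_eq0.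
have e1 : 3%:R * (C ^+ 2 * theta C) N = N%:R * (C ^+ 3) N.
  rewrite -!fcoef_natM; have := theta_coef (C ^+ 3) N; rewrite fcoefB => /eqP.
  rewrite subr_eq0 => /eqP <-; rewrite thetaX -[3.-1]/2%N.
  by congr (fcoef _ _); ring.
have e2 : 2%:R * (C * theta C ^+ 2) N + (C ^+ 2 * theta (theta C)) N =
    N%:R * (C ^+ 2 * theta C) N.
  rewrite -!fcoef_natM -fcoefD; have := theta_coef (C ^+ 2 * theta C) N.
  rewrite fcoefB => /eqP; rewrite subr_eq0 => /eqP <-; congr (fcoef _ _).
  by rewrite thetaM thetaX -[2.-1]/1%N; ring.
have {e1} e1 : (C ^+ 2 * theta C) N = N%:R * (C ^+ 3) N / 3%:R.
  by rewrite -e1; field; rewrite ?char0.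
set A := fcoef _ _ in e2 *; set Y := (_ * theta (theta C)) N in e2 *.
have -> : A = (2%:R * A + Y - Y) / 2%:R by field; rewrite ?char0.
by rewrite e2 e1; field; rewrite ?char0.
Qed.

(** [alpha] and [beta] as polynomials in a variable of an arbitrary field. *)
Definition alphaK (x : K) :=
  - (1 / 17280%:R) * (x - 3%:R) * (x - 1) ^+ 2 * x * (x + 1) * (x ^+ 2 - 4%:R * x - 6%:R).
Definition betaK (x : K) :=
  1 / 2880%:R * (x - 1) * x * (x + 1) * (2%:R * x ^+ 2 - 3%:R).

(** After the change of variable both sides are combinations of two coefficients,
    and comparing the factors is a polynomial identity in k. *)
Lemma sigma4_series g R N (k := N.+3) : cumulants_of g R ->
  - (k%:R^-1) * (\prod_(j < k) shift_expansion g j) 4%N N =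
    alphaK k%:R * (Cser R ^+ 3) N + betaK k%:R * (Cser R ^+ 2 * theta (theta (Cser R))) N.
Proof.
move=> gR; have char0 n : (n.+1%:R : K) != 0 by rewrite pnatr_eq0.
rewrite fourth_coef ?(cumulants_g0 gR) // taylor1 (transfer_C3 gR) (transfer_CdC2 gR).
rewrite CdC2_coef /k; move: (fcoef (Cser R ^+ 3) N) (fcoef (Cser R ^+ 2 * _) N) => x y.
(* Smaller numerals keep the normalization feasible. *)
have E1 : 17280%N = (128 * 135)%N by [].
have E2 : 2880%N = (64 * 45)%N by [].
rewrite /alphaK /betaK E1 E2 !natrM.
rewrite /mono1111 /mono211 /mono22 /mono31 /mono111 /mono21 /mono11
  /psum4 /psum3 /psum2 /psum1 -![_.+3%:R]natr1 -![_.+2%:R]natr1 -![_.+1%:R]natr1.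
have nz : (N%:R + 1 + 1 + 1 : K) != 0 by rewrite !natr1 char0.
by field; rewrite ?char0 ?nz.
Qed.

End FourthC.

(** * Shifting the variable at infinity *)

Section Shift.
Variable R : comNzRingType.
Implicit Types (f g : fps R).

(** With t = 1/x and G(x) = x g(1/x), this is G(x - j) / x. *)
Definition shift_series g (j : nat) : fps R :=
  (1 - j%:R * fX) * fcomp g (fX * finv (1 - j%:R * fX)).

Let d0 j : ((1 - j%:R * fX) : fps R) 0%N = 1.
Proof. by rewrite fcoefB fcoef1 fcoefM0 mulr0 subr0. Qed.
Let t0 j : (fX * finv (1 - j%:R * fX) : fps R) 0%N = 0.
Proof. by rewrite fcoefM0 mul0r. Qed.

Lemma shift_series_eqt L f g j : eqt L f g -> eqt L (shift_series f j) (shift_series g j).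
Proof. by move=> e; apply: eqtM => //; apply: fcomp_eqt. Qed.

Definition swap_vars (F : fps (fps R)) : fps (fps R) :=
  Fps (fun n => Fps (fun i => F i n)).

Lemma swap_varsM F G : swap_vars (F * G) = swap_vars F * swap_vars G.
Proof.
apply: fpsP => n; apply: fpsP => i.
have -> : swap_vars (F * G) n i = (F * G) i n by [].
rewrite !fcoefM !fcoef_sum.
under eq_bigr do rewrite fcoefM.
by rewrite exchange_big; apply: eq_bigr => a _; rewrite fcoefM.
Qed.

Lemma swap_vars1 : swap_vars 1 = 1.
Proof. by apply: fpsP => -[|n]; apply: fpsP => -[|i]. Qed.

Lemma swap_vars_prod I (r : seq I) (F : I -> fps (fps R)) :
  swap_vars (\prod_(i <- r) F i) = \prod_(i <- r) swap_vars (F i).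
Proof. exact: (big_morph swap_vars swap_varsM swap_vars1). Qed.

Lemma fev_prod I (r : seq I) (F : I -> fps (fps R)) (h : fps R) : h 0%N = 0 ->
  fev (\prod_(i <- r) F i) h = \prod_(i <- r) fev (F i) h.
Proof.
by move=> h0; apply: (big_morph (fun F => fev F h)) => [f g|];
  [exact: fevM | exact: fev1].
Qed.

(** [shift_series], expanded in the powers of the variable of g. *)
Definition shift_bivariate g (j : nat) : fps (fps R) :=
  Fps (fun i => fC (g i) * ((1 - j%:R * fX) * finv (1 - j%:R * fX) ^+ i)).

Lemma fev_shift_bivariate g u j :
  fev (shift_bivariate g j) (fC u * fX) = shift_series (fcomp g (fC u * fX)) j.
Proof.
have u0 : (fC u * fX) 0%N = 0 by rewrite fcoefM0 mulr0.
rewrite /shift_series fcompA // fcompM // fcompC // fcompfX //.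
set d := 1 - _; apply: fpsP => n; rewrite (fev_trunc _ u0 (ltnSn n)).
have e : eqt n.+1 (fcomp g (fC u * (fX * finv d)))
   (\sum_(m < n.+1) fC (g m) * (fC u * (fX * finv d)) ^+ m).
  by move=> i iL; apply: fcomp_trunc; rewrite ?fcoefM0 ?mul0r ?mulr0.
rewrite (eqtM (fun _ _ => erefl) e (ltnSn n)) mulr_sumr; congr (fcoef _ _).
by apply: eq_bigr => i _; rewrite /= -/d !exprMn; ring.
Qed.

End Shift.

Section ShiftTaylor.
Variable K : numFieldType.
Implicit Types (g : fps K).

(** The coefficient of t^n in (1 - j t)^(1 - i) is a generalized binomial
    coefficient times j^n, and so is the effect of [taylor] on the i-th power. *)
Lemma swap_shift_bivariate g j :
  swap_vars (shift_bivariate g j) = shift_expansion g j.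
Proof.
apply: fpsP => n; apply: fpsP => i.
have -> : swap_vars (shift_bivariate g j) n i = shift_bivariate g j i n by [].
set d : fps K := 1 - j%:R * fX; set E := d * finv d ^+ i.
rewrite -[shift_bivariate g j i]/(fC (g i) * E) fcoefCM.
rewrite -[shift_expansion g j n]/(j%:R ^+ n * taylor g n) -natrX fcoef_natM natrX.
have d0 : d 0%N = 1 by rewrite fcoefB fcoef1 fcoefM0 mulr0 subr0.
have thd : theta d = - (j%:R * fX).
  rewrite /d raddfB -[LHS]/(theta 1 - theta _) theta1 thetaM theta_nat theta_fX.
  by rewrite mul0r !add0r.
have dw : d * finv d = 1 := fmulV d0.
have thE : d * theta E = (i%:R - 1) * (j%:R * fX * E).
  rewrite /E thetaM thetaX thetaV // thd; case: (i) => [|i']; first by rewrite expr0; ring.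
  rewrite -pred_Sn; transitivity (j%:R * fX * (d * (i'.+1%:R * (d * finv d) - 1) * finv d ^+ i'.+1)).
    by rewrite !exprS; ring.
  by rewrite dw; ring.
have recE m : m.+1%:R * E m.+1 = j%:R * (m%:R + i%:R - 1) * E m.
  have : theta E = j%:R * (fX * theta E) + (i%:R * (j%:R * (fX * E)) - j%:R * (fX * E)).
    transitivity (d * theta E + j%:R * (fX * theta E)); first by rewrite /d; ring.
    by rewrite thE; ring.
  move=> /(congr1 (fun f : fps K => f m.+1)).
  by rewrite fcoefD fcoefB !fcoef_natM !fcoefXM !thetaE => ->; ring.
elim: n => [|n IH].
  by rewrite expr0 mul1r /E fcoefM0 d0 fcoefX0 finv0 // expr1n !mulr1.
apply: (@mulfI _ n.+1%:R); first by rewrite pnatr_eq0.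
rewrite mulrCA recE.
rewrite -[taylor g n.+1]/(fC (n.+1%:R^-1) * (theta (taylor g n) + (n%:R - 1) * taylor g n)).
rewrite fcoefCM fcoefD thetaE [(_ - 1) * taylor g n]mulrBl mul1r fcoefB fcoef_natM.
transitivity (j%:R * (n%:R + i%:R - 1) * (g i * E n)); first by ring.
by rewrite IH exprS; field; rewrite nat1r pnatr_eq0.
Qed.

(** Rescaling g by u, and hence each R_i by u^i, separates the orders of the
    expansion in the shifts. *)
Lemma shift_product_graded g u k n :
  (\prod_(j < k) shift_series (fcomp g (fC u * fX)) j) n =
  \sum_(a < n.+1) u ^+ a * (\prod_(j < k) shift_expansion g j) (n - a)%N a.
Proof.
have u0 : (fC u * fX) 0%N = 0 by rewrite fcoefM0 mulr0.
rewrite (eq_bigr (fun j : 'I_k => fev (shift_bivariate g j) (fC u * fX))) => [|j _]; last first.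
  by rewrite fev_shift_bivariate.
rewrite -fev_prod // fevE; apply: eq_bigr => a _.
rewrite exprMn -rmorphXn mulrC -mulrA fcoefCM fcoefXnM -ltnS ltn_ord; congr (_ * _).
rewrite (_ : \prod_(j < k) shift_expansion g j =
  swap_vars (\prod_(j < k) shift_bivariate g j)) //.
by rewrite swap_vars_prod; apply: eq_bigr => j _; rewrite swap_shift_bivariate.
Qed.

End ShiftTaylor.

(** * Characters of right ideals of a group algebra *)

Section GroupAlgebra.
Variable gT : finGroupType.
Let G : {group gT} := [set: gT]%G.
Let aG := regular_repr algC G.
Let N := gcard G.
Let A (x : gT) : 'M[algC]_N := aG x.

Lemma regM x y : aG x *m aG y = aG (x * y)%g.
Proof. by rewrite -repr_mxM ?inE. Qed.

Lemma reg1 : aG 1%g = 1%:M. Proof. exact: repr_mx1. Qed.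

Lemma regE x (i j : 'I_N) : aG x i j = (enum_val j == enum_val i * x)%g%:R.
Proof.
rewrite /aG /= /regular_mx mxE mxE eqxx /=; congr (nat_of_bool _)%:R.
by apply/eqP/eqP => [->|<-]; rewrite ?gring_indexK ?inE ?gring_valK.
Qed.

Lemma tr_reg x : \tr (aG x) = N%:R * (x == 1%g)%:R.
Proof.
rewrite /mxtrace; transitivity (\sum_(i < N) (x == 1%g)%:R : algC).
  apply: eq_bigr => i _; rewrite regE.
  by rewrite -{1}[enum_val i]mulg1 (inj_eq (mulgI _)) eq_sym.
by rewrite sumr_const card_ord mulr_natl.
Qed.

Lemma trmx_reg x : (aG x)^T = aG x^-1%g.
Proof.
apply/matrixP => i j; rewrite mxE !regE; congr (nat_of_bool _)%:R.
by rewrite -(inj_eq (mulIg x^-1%g)) mulgK eq_sym.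
Qed.

Lemma N_gt0 : (0 < N)%N. Proof. exact: cardG_gt0. Qed.

Lemma N_neq0 : (N%:R : algC) != 0.
Proof. by rewrite pnatr_eq0 -lt0n N_gt0. Qed.

Definition in_gring (M : 'M[algC]_N) := exists f : gT -> algC, M = \sum_x f x *: aG x.

Lemma in_gring_reg x : in_gring (aG x).
Proof.
exists (fun y => (y == x)%:R); rewrite (bigD1 x) //= eqxx scale1r big1 ?addr0 //.
by move=> y /negPf->; rewrite scale0r.
Qed.

Lemma in_gringZ a M : in_gring M -> in_gring (a *: M).
Proof.
case=> f ->; exists (fun x => a * f x); rewrite scaler_sumr.
by apply: eq_bigr => x _; rewrite scalerA.
Qed.

Lemma in_gringD M M' : in_gring M -> in_gring M' -> in_gring (M + M').
Proof.
case=> f -> [f' ->]; exists (fun x => f x + f' x); rewrite -big_split /=.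
by apply: eq_bigr => x _; rewrite scalerDl.
Qed.

Lemma in_gring0 : in_gring 0.
Proof. by exists (fun=> 0); rewrite big1 // => x _; rewrite scale0r. Qed.

Lemma in_gring_sum I (r : seq I) (P : pred I) (F : I -> 'M_N) :
  (forall i, P i -> in_gring (F i)) -> in_gring (\sum_(i <- r | P i) F i).
Proof.
move=> FP; elim/big_ind: _ => //; [exact: in_gring0 | exact: in_gringD].
Qed.

Lemma in_gringM M M' : in_gring M -> in_gring M' -> in_gring (M *m M').
Proof.
case=> f -> [f' ->]; rewrite mulmx_suml; apply: in_gring_sum => x _.
rewrite mulmx_sumr; apply: in_gring_sum => y _.
rewrite -scalemxAl -scalemxAr regM; do 2!apply: in_gringZ; exact: in_gring_reg.
Qed.

(** Fourier inversion: the coefficient of x in M is a trace. *)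
Lemma gring_expand M : in_gring M -> \sum_x \tr (M *m aG x^-1%g) *: aG x = N%:R *: M.
Proof.
case=> f ->; rewrite scaler_sumr; apply: eq_bigr => x _.
rewrite mulmx_suml raddf_sum (bigD1 x) //= big1 ?addr0 => [|y ne_yx].
  by rewrite -scalemxAl mxtraceZ regM mulgV tr_reg eqxx mulr1 scalerA mulrC.
rewrite -scalemxAl mxtraceZ regM tr_reg -eq_invg_mul.
by rewrite (inj_eq invg_inj) (negPf ne_yx) !mulr0.
Qed.

(** Averaging over conjugation yields central elements. *)
Definition conj_sum (M : 'M[algC]_N) := \sum_x (aG x *m M *m aG x^-1%g).

Lemma conj_sum_central M g : aG g *m conj_sum M = conj_sum M *m aG g.
Proof.
rewrite /conj_sum mulmx_sumr mulmx_suml (reindex_inj (mulgI g^-1%g)) /=.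
apply: eq_bigr => x _; rewrite invMg invgK !mulmxA regM mulKVg -!mulmxA.
by rewrite regM.
Qed.

Lemma conj_sum_centralM M M' : in_gring M' -> M' *m conj_sum M = conj_sum M *m M'.
Proof.
case=> f ->; rewrite mulmx_suml mulmx_sumr; apply: eq_bigr => x _.
by rewrite -scalemxAl -scalemxAr conj_sum_central.
Qed.

(** The bilinear form sum_x tr (M x M' x^-1), which computes characters and
    their inner products. *)
Definition conj_form (M M' : 'M[algC]_N) := \tr (M *m conj_sum M').

Lemma conj_formE M M' : conj_form M M' = \sum_x \tr (M *m aG x *m M' *m aG x^-1%g).
Proof.
by rewrite /conj_form /conj_sum mulmx_sumr raddf_sum; apply: eq_bigr => x _; rewrite !mulmxA.
Qed.

Lemma conj_formC M M' : conj_form M M' = conj_form M' M.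
Proof.
rewrite !conj_formE (reindex_inj invg_inj) /=; apply: eq_bigr => x _.
by rewrite invgK -!mulmxA mxtrace_mulC -!mulmxA mxtrace_mulC
  -!mulmxA mxtrace_mulC -!mulmxA mxtrace_mulC -!mulmxA mxtrace_mulC -!mulmxA mxtrace_mulC -!mulmxA.
Qed.

Lemma conj_form_cyc M1 M2 M' : in_gring M1 ->
  conj_form (M1 *m M2) M' = conj_form (M2 *m M1) M'.
Proof.
by move=> g1; rewrite /conj_form -!mulmxA mxtrace_mulC -!mulmxA conj_sum_centralM.
Qed.

Lemma conj_formZl a M M' : conj_form (a *: M) M' = a * conj_form M M'.
Proof. by rewrite /conj_form -scalemxAl mxtraceZ. Qed.

Lemma gring_row_reg x : gring_row (aG x) = delta_mx 0 (gring_index G x).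
Proof. by rewrite /gring_row rowK gring_indexK ?inE // mul1g. Qed.

Section CyclicModule.
Variables (c : 'M[algC]_N) (h : algC).
Hypotheses (c_gring : in_gring c) (cc : c *m c = h *: c).
Let y : 'rV_N := gring_row c.
Let U := cyclic_mx aG y.
Let Umod : mxmodule aG U := cyclic_mx_module aG y.

Let L : 'M[algC]_N := \matrix_i (y *m aG (enum_val i)).

Let rowL i : row i L = y *m aG (enum_val i). Proof. by rewrite rowK. Qed.

Let deltaL x : delta_mx 0 (gring_index G x) *m L = y *m aG x.
Proof. by rewrite -rowE rowL gring_indexK ?inE. Qed.

Let LA g : L *m aG g = aG g *m L.
Proof.
apply/row_matrixP => i; rewrite row_mul rowL -mulmxA regM.
by rewrite row_mul /aG /= rowK deltaL.
Qed.

Let yL : y *m L = h *: y.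
Proof.
have -> : h *: y = y *m c by rewrite /y -gring_row_mul cc linearZ.
case: c_gring => f cE.
have yE : y = \sum_x f x *: delta_mx 0 (gring_index G x).
  rewrite /y cE linear_sum; apply: eq_bigr => x _ /=; rewrite linearZ; congr (_ *: _).
  exact: gring_row_reg.
rewrite {1}yE cE mulmx_suml mulmx_sumr; apply: eq_bigr => x _.
by rewrite -scalemxAl -scalemxAr deltaL.
Qed.

Let LL : L *m L = h *: L.
Proof.
apply/row_matrixP => i; rewrite row_mul rowL -mulmxA -LA mulmxA yL.
by rewrite -scalemxAl linearZ /= rowL.
Qed.

Let LU : (L <= U)%MS.
Proof.
apply/row_subP => i; rewrite rowL.
by apply: (mxmodule_trans Umod); rewrite ?inE // cyclic_mx_id.
Qed.

Let UL : (U <= L)%MS.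
Proof.
apply: cyclic_mx_sub.
  by apply/mxmoduleP => g _; rewrite LA submxMl.
by have := deltaL 1%g; rewrite reg1 mulmx1 => <-; rewrite submxMl.
Qed.

Let tr_submod g : h * \tr (submod_repr Umod g) = \tr (L *m aG g).
Proof.
pose B := val_submod 1%:M : 'M_(\rank U, N); pose F := in_submod U L.
have LE : L = F *m B.
  by rewrite -[LHS](in_submodK LU) -/F /B /val_submod /= mul1mx.
have BL : B *m L = h *: B.
  have : (B <= L)%MS by rewrite (submx_trans (val_submodP _)) // UL.
  by case/submxP => D ->; rewrite -mulmxA LL scalemxAr.
have BF : B *m F = h%:M.
  apply: (can_inj (@val_submodK _ _ U _)).
  rewrite /F in_submodE mulmxA -in_submodE BL in_submodK; last first.
    by rewrite scalemx_sub // val_submodP.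
  by rewrite /B -linearZ scalemx1.
have rE : submod_repr Umod g *m B = B *m aG g.
  have := val_submodJ Umod 1%:M (in_setT g); rewrite mul1mx -/B => <-.
  by rewrite /B /val_submod /= mul1mx.
rewrite LE -mulmxA -rE [RHS]mxtrace_mulC -mulmxA BF.
by rewrite mul_mx_scalar [RHS]mxtraceZ.
Qed.

(** Left multiplication by c / h is a projection onto the right ideal cA, which
    commutes with right multiplication by g; hence the trace of g on cA is the
    trace of a -> c a g on the group algebra, divided by h. *)
Lemma cyclic_char g : N%:R * h * \tr (submod_repr Umod g) = conj_form c (aG g).
Proof.
rewrite -mulrA tr_submod conj_formE [\tr (L *m _)]/mxtrace mulr_sumr.
rewrite (reindex (gring_index G)) /=; last first.
  exists enum_val => i _; last by rewrite gring_valK.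
  by rewrite gring_indexK ?inE.
apply: eq_bigr => x _.
have -> : (L *m aG g) (gring_index G x) (gring_index G x) =
   (gring_row (c *m aG x *m aG g)) 0 (gring_index G x).
  by rewrite !gring_row_mul -/y -deltaL -mulmxA -rowE [RHS]mxE.
have : in_gring (c *m aG x *m aG g).
  by apply: in_gringM; [apply: in_gringM => // |]; exact: in_gring_reg.
case=> f ->; rewrite mulmx_suml [RHS]raddf_sum.
have -> : gring_row (\sum_z f z *: aG z) 0 (gring_index G x) =
    \sum_z f z * (x == z)%:R.
  rewrite linear_sum summxE; apply: eq_bigr => z _; rewrite linearZ mxE; congr (_ * _).
  rewrite -[fun_of_matrix _]/(fun_of_matrix (gring_row (aG z))) gring_row_reg mxE eqxx /=.
  by rewrite -(inj_eq (can_inj (@gring_valK _ G))) !gring_indexK ?inE.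
rewrite mulr_sumr; apply: eq_bigr => z _.
rewrite -scalemxAl [RHS]mxtraceZ mulrCA regM tr_reg -eq_invg_mul.
by rewrite (inj_eq invg_inj) eq_sym.
Qed.

End CyclicModule.

(** ** Positivity *)

Definition real_mx (M : 'M[algC]_N) := forall i j, M i j \is Num.real.

Lemma real_mxM M M' : real_mx M -> real_mx M' -> real_mx (M *m M').
Proof. by move=> r r' i j; rewrite mxE rpred_sum // => k _; rewrite rpredM. Qed.

Lemma real_mx_reg x : real_mx (aG x).
Proof. by move=> i j; rewrite regE realn. Qed.

Lemma tr_mulT_ge0 W : real_mx W -> 0 <= \tr (W *m W^T).
Proof.
move=> rW; rewrite /mxtrace sumr_ge0 // => i _; rewrite mxE sumr_ge0 // => j _.
by rewrite mxE -expr2 -realEsqr.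
Qed.

(** The group algebra over the reals carries a positive definite form, for which
    the transpose of g is g^-1; it replaces unitarity arguments. *)
Lemma tr_mulT_gt0 W : real_mx W -> W != 0 -> 0 < \tr (W *m W^T).
Proof.
move=> rW W0; rewrite lt_neqAle tr_mulT_ge0 // andbT eq_sym.
apply: contra W0; rewrite /mxtrace psumr_eq0 => [/allP W0|i _]; last first.
  by rewrite mxE sumr_ge0 // => j _; rewrite mxE -expr2 -realEsqr.
apply/eqP/matrixP => i j; rewrite [RHS]mxE; apply/eqP.
have := W0 i (mem_index_enum _); rewrite mxE psumr_eq0 => [/allP W0'|j' _]; last first.
  by rewrite mxE -expr2 -realEsqr.
by have := W0' j (mem_index_enum _); rewrite mxE mulf_eq0 orbb.
Qed.

End GroupAlgebra.

(** * Young symmetrizers *)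

(** For R the row (column) function of a tableau, its row (column) group. *)
Definition fiber_stab n (R : 'I_n -> nat) : {set 'S_n} :=
  [set p : 'S_n | [forall i, R (p i) == R i]].

Lemma fiber_stabP n (R : 'I_n -> nat) (p : 'S_n) :
  reflect (forall i, R (p i) = R i) (p \in fiber_stab R).
Proof. by rewrite inE; apply: (iffP forallP) => H i; apply/eqP. Qed.

Lemma fiber_stabM n (R : 'I_n -> nat) (p q : 'S_n) :
  p \in fiber_stab R -> q \in fiber_stab R -> (p * q)%g \in fiber_stab R.
Proof. by move=> /fiber_stabP Hp /fiber_stabP Hq; apply/fiber_stabP => i; rewrite permM Hq Hp. Qed.

Lemma fiber_stabV n (R : 'I_n -> nat) (p : 'S_n) :
  p \in fiber_stab R -> (p^-1)%g \in fiber_stab R.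
Proof. by move=> /fiber_stabP Hp; apply/fiber_stabP => i; rewrite -{2}[i](permKV p) Hp. Qed.

Lemma fiber_stab1 n (R : 'I_n -> nat) : 1%g \in fiber_stab R.
Proof. by apply/fiber_stabP => i; rewrite perm1. Qed.

Lemma fiber_stabMr n (R : 'I_n -> nat) (p q : 'S_n) :
  p \in fiber_stab R -> ((q * p)%g \in fiber_stab R) = (q \in fiber_stab R).
Proof.
move=> Pp; apply/idP/idP => [Pqp|Pq]; last exact: fiber_stabM.
by rewrite -(mulgK p q) fiber_stabM // fiber_stabV.
Qed.

Lemma fiber_stabMl n (R : 'I_n -> nat) (p q : 'S_n) :
  p \in fiber_stab R -> ((p * q)%g \in fiber_stab R) = (q \in fiber_stab R).
Proof.
move=> Pp; apply/idP/idP => [Ppq|Pq]; last exact: fiber_stabM.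
by rewrite -(mulKg p q) fiber_stabM // fiber_stabV.
Qed.

Definition sgn n (q : 'S_n) : algC := (-1) ^+ odd_perm q.

Lemma sgnM n (p q : 'S_n) : sgn (p * q)%g = sgn p * sgn q.
Proof. by rewrite /sgn odd_permM signr_addb. Qed.

Lemma sgnV n (q : 'S_n) : sgn q^-1%g = sgn q.
Proof. by rewrite /sgn odd_permV. Qed.

Lemma sgnK n (q : 'S_n) : sgn q * sgn q = 1.
Proof. by rewrite /sgn -expr2 sqrr_sign. Qed.

Lemma sgn_tperm n (i j : 'I_n) : i != j -> sgn (tperm i j) = -1.
Proof. by move=> ne_ij; rewrite /sgn odd_tperm ne_ij expr1. Qed.

(** Row and column (anti)symmetrizers; they are transported along a group
    morphism f in order to compare symmetrizers of different degrees. *)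
Section Symmetrizers.
Variables (m n : nat) (f : 'S_m -> 'S_n).
Hypothesis fM : forall p q, f (p * q)%g = (f p * f q)%g.
Hypothesis fsgn : forall q, sgn (f q) = sgn q.
Let aG := regular_repr algC [set: 'S_n]%G.
Variable R : 'I_m -> nat.

Definition rsum := \sum_(p in fiber_stab R) aG (f p).
Definition csum := \sum_(q in fiber_stab R) sgn q *: aG (f q).

Let fV p : f p^-1%g = (f p)^-1%g.
Proof.
have f1 : f 1%g = 1%g by apply: (mulgI (f 1%g)); rewrite -fM !mulg1.
by apply: (mulgI (f p)); rewrite -fM !mulgV.
Qed.

Lemma rsum_gring : in_gring rsum.
Proof. by apply: in_gring_sum => p _; exact: in_gring_reg. Qed.

Lemma csum_gring : in_gring csum.
Proof. by apply: in_gring_sum => p _; apply: in_gringZ; exact: in_gring_reg. Qed.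

Lemma rsum_real : real_mx rsum.
Proof. by move=> i j; rewrite summxE rpred_sum // => p _; exact: real_mx_reg. Qed.

Lemma csum_real : real_mx csum.
Proof.
move=> i j; rewrite summxE rpred_sum // => p _; rewrite mxE rpredM ?real_mx_reg //.
by rewrite /sgn rpredX // rpredN rpred1.
Qed.

Lemma rsumMl p : p \in fiber_stab R -> aG (f p) *m rsum = rsum.
Proof.
move=> Pp; rewrite /rsum mulmx_sumr [RHS](reindex_inj (mulgI p)) /=.
by apply: eq_big => q; rewrite ?fiber_stabMl // => _; rewrite regM fM.
Qed.

Lemma rsumMr p : p \in fiber_stab R -> rsum *m aG (f p) = rsum.
Proof.
move=> Pp; rewrite /rsum mulmx_suml [RHS](reindex_inj (mulIg p)) /=.
by apply: eq_big => q; rewrite ?fiber_stabMr // => _; rewrite regM fM.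
Qed.

Lemma csumMl p : p \in fiber_stab R -> aG (f p) *m csum = sgn p *: csum.
Proof.
move=> Pp; rewrite /csum mulmx_sumr [in RHS](reindex_inj (mulgI p)) /= scaler_sumr.
apply: eq_big => q; rewrite ?fiber_stabMl // => _.
by rewrite -scalemxAr regM fM scalerA sgnM mulrA sgnK mul1r.
Qed.

Lemma csumMr p : p \in fiber_stab R -> csum *m aG (f p) = sgn p *: csum.
Proof.
move=> Pp; rewrite /csum mulmx_suml [in RHS](reindex_inj (mulIg p)) /= scaler_sumr.
apply: eq_big => q; rewrite ?fiber_stabMr // => _.
by rewrite -scalemxAl regM fM scalerA sgnM mulrCA sgnK mulr1.
Qed.

Lemma rsumT : rsum^T = rsum.
Proof.
rewrite /rsum raddf_sum [RHS](reindex_inj invg_inj) /=; apply: eq_big => p.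
  by apply/idP/idP => /fiber_stabV; rewrite ?invgK.
by move=> _; rewrite trmx_reg fV.
Qed.

Lemma csumT : csum^T = csum.
Proof.
rewrite /csum raddf_sum [RHS](reindex_inj invg_inj) /=; apply: eq_big => p.
  by apply/idP/idP => /fiber_stabV; rewrite ?invgK.
by move=> _; rewrite sgnV linearZ /= trmx_reg fV.
Qed.

Lemma rsum_sq : rsum *m rsum = #|fiber_stab R|%:R *: rsum.
Proof.
rewrite {1}/rsum mulmx_suml (eq_bigr (fun=> rsum)) => [|p /rsumMl //].
by rewrite sumr_const scaler_nat.
Qed.

Lemma csum_sq : csum *m csum = #|fiber_stab R|%:R *: csum.
Proof.
rewrite {1}/csum mulmx_suml (eq_bigr (fun=> csum)) => [|p Pp].
  by rewrite sumr_const scaler_nat.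
by rewrite -scalemxAl csumMl // scalerA sgnK scale1r.
Qed.

End Symmetrizers.

Lemma card_fiber_stab_gt0 n (R : 'I_n -> nat) : (0 < #|fiber_stab R|)%N.
Proof. by apply/card_gt0P; exists 1%g; apply: fiber_stab1. Qed.

(** ** Tableaux and their combinatorics *)

(** A filling of the diagram with row lengths w 0, w 1, ... by 'I_n: entry i
    sits in row R i and column C i. *)
Record tableau n (w : nat -> nat) (R C : 'I_n -> nat) : Prop := Tableau {
  tab_lt : forall i, (C i < w (R i))%N;
  tab_inj : forall i j, R i = R j -> C i = C j -> i = j;
  tab_surj : forall r c, (c < w r)%N -> exists i, R i = r /\ C i = c }.

Lemma tab_row_card n w (R C : 'I_n -> nat) r s : tableau w R C ->
  #|[set i | (R i == r) && (C i < s)%N]| = minn (w r) s.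
Proof.
move=> T; set E := [set i | _].
have Ci : {in E &, injective C}.
  by move=> i j; rewrite !inE => /andP[/eqP ri _] /andP[/eqP rj _]; apply: (tab_inj T); rewrite ri rj.
rewrite cardE -(size_map C) -[RHS](size_iota 0); apply/perm_size/uniq_perm.
- by rewrite map_inj_in_uniq ?enum_uniq // => i j; rewrite !mem_enum; apply: Ci.
- exact: iota_uniq.
move=> c; rewrite mem_iota /= add0n leq_min; apply/mapP/idP => [[i]|/andP[cw cs]].
  by rewrite mem_enum inE => /andP[/eqP<- lt_s] ->; rewrite lt_s (tab_lt T).
by have [i [ri ci]] := tab_surj T cw; exists i; rewrite // mem_enum inE ri ci eqxx.
Qed.

Lemma sum_row_card n (R : 'I_n -> nat) (P : pred 'I_n) B : (forall i, R i < B)%N ->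
  #|[set i | P i]| = (\sum_(r < B) #|[set i | (R i == r) && P i]|)%N.
Proof.
move=> RB; rewrite -sum1_card (partition_big (fun i => Ordinal (RB i)) xpredT) //=.
apply: eq_bigr => r _; rewrite -sum1_card; apply: eq_bigl => i.
by rewrite !inE andbC -val_eqE.
Qed.

Section Clash.
Variables (n : nat) (w w' : nat -> nat) (R C R' C' : 'I_n -> nat).
Hypotheses (T : tableau w R C) (T' : tableau w' R' C').

Definition noclash (g : 'S_n) := forall i j, R i = R j -> C' (g i) = C' (g j) -> i = j.

Lemma noclash_card g r s : noclash g ->
  (#|[set i | (R i == r) && (C' (g i) < s)%N]| <= minn (w r) s)%N.
Proof.
move=> nc; rewrite leq_min; apply/andP; split.
  rewrite -[w r]minnn -(tab_row_card r (w r) T); apply/subset_leq_card/subsetP => i.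
  by rewrite !inE => /andP[/eqP<- _]; rewrite eqxx (tab_lt T).
rewrite cardE -(size_map (C' \o g)) -[leqRHS](size_iota 0); apply: uniq_leq_size.
  rewrite map_inj_in_uniq ?enum_uniq // => i j.
  by rewrite !mem_enum !inE => /andP[/eqP ri _] /andP[/eqP rj _]; apply: nc; rewrite ri rj.
by move=> c /mapP[i]; rewrite mem_enum inE => /andP[_ lt_s] ->; rewrite mem_iota.
Qed.

(** Both sides count the entries that g sends to the first s columns of the second
    tableau. *)
Lemma noclash_sum g s B : (forall i, R i < B)%N -> (forall i, R' i < B)%N -> noclash g ->
  (\sum_(r < B) minn (w' r) s =
   \sum_(r < B) #|[set i | (R i == r) && (C' (g i) < s)%N]|)%N.
Proof.
move=> RB R'B nc; rewrite -(sum_row_card (fun i => C' (g i) < s)%N RB).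
rewrite (eq_bigr (fun r : 'I_B => #|[set i | (R' i == r) && (C' i < s)%N]|)); last first.
  by move=> r _; rewrite (tab_row_card _ _ T').
rewrite -(sum_row_card (fun i => C' i < s)%N R'B).
have -> : [set i | (C' (g i) < s)%N] = g @^-1: [set i | (C' i < s)%N].
  by apply/setP => i; rewrite !inE.
by rewrite on_card_preimset //; apply: onW_bij; exists (g^-1)%g; [exact: permK | exact: permKV].
Qed.

(** At most min (w_r, s) entries of row r of w land in the first s columns, since no
    two of them share a column. *)
Lemma noclash_dominance g s B : (forall i, R i < B)%N -> (forall i, R' i < B)%N -> noclash g ->
  (\sum_(r < B) minn (w' r) s <= \sum_(r < B) minn (w r) s)%N.
Proof.
move=> RB R'B nc; rewrite (noclash_sum s RB R'B nc); apply: leq_sum => r _.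
exact: noclash_card.
Qed.

End Clash.

(** Von Neumann's lemma: a permutation without clash is a row permutation
    followed by a column permutation. *)
Lemma noclash_factor n w (R C : 'I_n -> nat) (g : 'S_n) : tableau w R C ->
  noclash R C g -> exists2 p, p \in fiber_stab R & exists2 q, q \in fiber_stab C & g = (p * q)%g.
Proof.
move=> T nc; pose B := (\max_i R i).+1.
have RB i : (R i < B)%N by rewrite ltnS; apply: leq_bigmax.
have cardE r s : #|[set i | (R i == r) && (C (g i) < s)%N]| = minn (w r) s.
  case: (ltnP r B) => [lt_rB|le_Br]; last first.
    apply/eqP; rewrite eqn_leq (noclash_card T) //= -(tab_row_card r s T).
    rewrite [X in (X <= _)%N](_ : _ = 0%N) //; apply/eqP; rewrite cards_eq0.
    apply/eqP/setP => i; rewrite !inE; apply/negbTE/nandP; left.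
    by apply/eqP => ri; have := RB i; rewrite ri ltnNge le_Br.
  have le (x : 'I_B) : xpredT x -> leqif #|[set i | (R i == x) && (C (g i) < s)%N]|
     (minn (w x) s) (#|[set i | (R i == x) && (C (g i) < s)%N]| == minn (w x) s).
    by move=> _; apply: leqif_eq; apply: noclash_card T _ _ _ nc.
  case: (leqif_sum le) => _; rewrite -(noclash_sum T s RB RB nc) eqxx.
  by move=> /esym/forallP/(_ (Ordinal lt_rB))/eqP.
have Cw i : (C (g i) < w (R i))%N.
  have := cardE (R i) (w (R i)); rewrite minnn => e.
  have : [set j | (R j == R i) && (C (g j) < w (R i))%N] == [set j | R j == R i].
    rewrite eqEcard; apply/andP; split; first by apply/subsetP => j; rewrite !inE => /andP[].
    rewrite e -[w (R i)]minnn -(tab_row_card (R i) (w (R i)) T).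
    apply/subset_leq_card/subsetP => j; rewrite !inE => /eqP rj.
    by rewrite rj eqxx -rj (tab_lt T).
  by move=> /eqP/setP/(_ i); rewrite !inE eqxx.
have ex i : exists j, (R j == R i) && (C j == C (g i)).
  by have [j [rj cj]] := tab_surj T (Cw i); exists j; rewrite rj cj !eqxx.
pose p0 i := xchoose (ex i).
have p0R i : R (p0 i) = R i by have /andP[/eqP] := xchooseP (ex i).
have p0C i : C (p0 i) = C (g i) by have /andP[_ /eqP] := xchooseP (ex i).
have p0_inj : injective p0.
  by move=> i j e; apply: nc; [rewrite -p0R e p0R | rewrite -p0C e p0C].
exists (perm p0_inj); first by apply/fiber_stabP => i; rewrite permE.
exists ((perm p0_inj)^-1 * g)%g; last by rewrite mulKVg.
apply/fiber_stabP => i; rewrite permM -{2}[i](permKV (perm p0_inj)).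
by rewrite [perm p0_inj _]permE p0C.
Qed.

Section Sandwich.
Variable n : nat.
Let aG := regular_repr algC [set: 'S_n]%G.
Let id_perm : 'S_n -> 'S_n := id.

(** A clash produces a transposition that is absorbed with opposite signs. *)
Lemma clash_vanish (R C : 'I_n -> nat) (g : 'S_n) (i j : 'I_n) :
  i != j -> R i = R j -> C (g i) = C (g j) ->
  rsum id_perm R *m aG g *m csum id_perm C = 0.
Proof.
move=> ne_ij Rij Cij.
have tR : tperm i j \in fiber_stab R.
  by apply/fiber_stabP => k; case: tpermP => // ->.
have tC : tperm (g i) (g j) \in fiber_stab C.
  by apply/fiber_stabP => k; case: tpermP => // ->.
set X := _ *m _.
have : X = - X.
  rewrite {1}/X -(rsumMr (f := id_perm) _ tR) // -(mulmxA _ _ (aG g)) regM /id_perm.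
  have -> : (tperm i j * g = g * tperm (g i) (g j))%g by rewrite -tpermJ conjgE mulKVg ?mulgA ?mulgKV.
  rewrite -regM !mulmxA -(mulmxA _ _ (csum _ _)) (csumMl (f := id_perm) _ tC) //.
  by rewrite sgn_tperm ?(inj_eq perm_inj) // scaleN1r mulmxN.
by move/eqP; rewrite -addr_eq0 -mulr2n -scaler_nat scaler_eq0 pnatr_eq0 /= => /eqP.
Qed.

Lemma noclash_of_neq0 (R C : 'I_n -> nat) (g : 'S_n) :
  rsum id_perm R *m aG g *m csum id_perm C != 0 -> noclash R C g.
Proof.
move=> nz i j Rij Cij; apply: contraNeq nz => ne_ij.
by apply/eqP; apply: clash_vanish Cij.
Qed.

Variables (w : nat -> nat) (R C : 'I_n -> nat).
Hypothesis T : tableau w R C.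
Let a := rsum id_perm R.
Let b := csum id_perm C.
Let c := a *m b.
Let N : algC := (gcard [set: 'S_n]%G)%:R.

(** Only the permutations p q contribute, and they contribute multiples of c. *)
Lemma sandwich M : in_gring M -> exists k, a *m M *m b = k *: c.
Proof.
have sw g : exists k, a *m aG g *m b = k *: c.
  have [/eqP-> | nz] := boolP (a *m aG g *m b == 0); first by exists 0; rewrite scale0r.
  have [p Pp [q Pq ->]] := noclash_factor T (noclash_of_neq0 nz).
  exists (sgn q); rewrite -regM mulmxA (rsumMr (f := id_perm)) // -mulmxA.
  by rewrite (csumMl (f := id_perm)) // -scalemxAr.
move: a b c sw => a' b' c' sw; case=> f ->.
rewrite mulmx_sumr mulmx_suml; elim/big_rec: _ => [|g M' _ [k' ->]].
  by exists 0; rewrite scale0r.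
have [k e] := sw g; exists (f g * k + k'); rewrite scalerDl -scalerA -e.
by rewrite -scalemxAr -scalemxAl.
Qed.

(** The row and column groups intersect trivially, so the coefficient of the
    identity in the Young symmetrizer is 1. *)
Lemma tr_young : \tr c = N.
Proof.
rewrite /c /a /b mulmx_suml raddf_sum (bigD1 1%g) ?fiber_stab1 //=.
rewrite [X in _ + X]big1 ?addr0 => [|p /andP[Pp p1]].
  rewrite reg1 mul1mx raddf_sum (bigD1 1%g) ?fiber_stab1 //= big1 ?addr0 => [|q /andP[_ q1]].
    by rewrite linearZ /= tr_reg eqxx mulr1 /sgn odd_perm1 expr0 mul1r.
  by rewrite linearZ /= tr_reg (negPf q1) !mulr0.
rewrite mulmx_sumr raddf_sum big1 // => q Pq; rewrite -scalemxAr [LHS]mxtraceZ regM tr_reg.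
case: eqP => [pq|]; rewrite ?mulr0 //; case/negP: p1.
have pE : p = (q^-1)%g by rewrite /id_perm in pq; apply: (mulIg q); rewrite pq mulVg.
have /fiber_stabP PC : p \in fiber_stab C by rewrite pE fiber_stabV.
move/fiber_stabP in Pp; apply/eqP/permP => i; rewrite perm1.
exact: (tab_inj T).
Qed.

(** The symmetrizer is a multiple of an idempotent by the sandwich property; the
    scalar is positive because W = a b a is a nonzero symmetric real matrix. *)
Lemma young_sq_ex : exists2 h : algC, 0 < h & c *m c = h *: c.
Proof.
have [h e] : exists h, a *m (b *m a) *m b = h *: c.
  by apply: sandwich; apply: in_gringM; [exact: csum_gring | exact: rsum_gring].
have cc : c *m c = h *: c by rewrite -e /c !mulmxA.
exists h => //.
have N0 : 0 < N by rewrite ltr0n N_gt0.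
have aa := @rsum_sq n n id_perm (fun _ _ => erefl) R; rewrite -/a in aa.
have aT := @rsumT n n id_perm (fun _ _ => erefl) R; rewrite -/a in aT.
have bT := @csumT n n id_perm (fun _ _ => erefl) C; rewrite -/b in bT.
set P : algC := #|fiber_stab R|%:R in aa.
have P0 : 0 < P by rewrite ltr0n card_fiber_stab_gt0.
pose W := a *m b *m a.
have WT : W^T = W by rewrite /W !trmx_mul aT bT mulmxA.
have trW : \tr W = P * N.
  by rewrite /W mxtrace_mulC mulmxA aa -scalemxAl mxtraceZ tr_young.
have W0 : W != 0.
  by apply/eqP => W0; have /eqP := trW; rewrite W0 raddf0 eq_sym mulf_eq0 !gt_eqF.
have rW : real_mx W.
  by do 2?[apply: real_mxM]; [exact: rsum_real | exact: csum_real | exact: rsum_real].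
have := tr_mulT_gt0 rW W0; rewrite WT.
have -> : \tr (W *m W) = P * P * (h * N).
  have -> : W *m W = P *: (c *m c *m a).
    by rewrite /W /c -!mulmxA [a *m (a *m _)]mulmxA aa -!scalemxAl -!scalemxAr !mulmxA.
  rewrite mxtraceZ mxtrace_mulC cc -scalemxAr mxtraceZ /c mulmxA aa -scalemxAl mxtraceZ.
  by rewrite tr_young; ring.
by rewrite (pmulr_rgt0 _ (mulr_gt0 P0 P0)) pmulr_lgt0.
Qed.

End Sandwich.

(** * Specht characters *)

Notation rowf w := (fun i => reshape_index w (nat_of_ord i)).
Notation colf w := (fun i => reshape_offset w (nat_of_ord i)).

Lemma reshape_tableau n w : sumn w = n ->
  tableau (nth 0%N w) (rowf w : 'I_n -> nat) (colf w : 'I_n -> nat).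
Proof.
move=> wn; split=> [i|i j ri ci|r c lt_c].
- by apply: reshape_offsetP; rewrite wn.
- by apply: val_inj; rewrite /= -(reshape_indexK w i) -(reshape_indexK w j) /flatten_index ri ci.
have lt_r : (r < size w)%N.
  by rewrite ltnNge; apply: contraTN lt_c => le; rewrite nth_default.
have lt_n : (flatten_index w r c < n)%N by rewrite -wn; apply: flatten_indexP.
by exists (Ordinal lt_n); rewrite /= flatten_indexKl // flatten_indexKr.
Qed.

Definition young n (w : seq nat) : 'M[algC]_(gcard [set: 'S_n]%G) :=
  rsum (id : 'S_n -> 'S_n) (rowf w) *m csum (id : 'S_n -> 'S_n) (colf w).

Lemma young_gring n w : in_gring (young n w).
Proof. by apply: in_gringM; [exact: rsum_gring | exact: csum_gring]. Qed.

Section ConjFormLinear.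
Variable gT : finGroupType.
Let aG := regular_repr algC [set: gT]%G.
Let N := gcard [set: gT]%G.
Implicit Types M : 'M[algC]_N.

Lemma conj_formZr a M M' : conj_form M (a *: M') = a * conj_form M M'.
Proof.
rewrite !conj_formE mulr_sumr; apply: eq_bigr => x _.
by rewrite -scalemxAr -scalemxAl mxtraceZ.
Qed.

Lemma conj_form_sumr M I (r : seq I) (P : pred I) (F : I -> 'M_N) :
  conj_form M (\sum_(i <- r | P i) F i) = \sum_(i <- r | P i) conj_form M (F i).
Proof.
rewrite conj_formE; under [RHS]eq_bigr do rewrite conj_formE.
rewrite [RHS]exchange_big /=; apply: eq_bigr => x _.
by rewrite mulmx_sumr mulmx_suml raddf_sum.
Qed.

Lemma conj_form_class M (g x : gT) :
  conj_form M (aG (x * g * x^-1)%g) = conj_form M (aG g).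
Proof.
rewrite !conj_formE (reindex_inj (mulIg x^-1%g)) /=; apply: eq_bigr => y _.
by rewrite -!mulmxA !regM invMg invgK !mulgA !mulgKV.
Qed.

End ConjFormLinear.

(** The Specht character as a trace in the group algebra, up to the factor h,
    which is n! divided by the dimension. *)
Lemma specht_charE n w : sumn w = n -> exists h : algC,
  [/\ 0 < h, young n w *m young n w = h *: young n w &
   forall g, (gcard [set: 'S_n]%G)%:R * h * specht_char n w g =
      conj_form (young n w) (regular_repr algC [set: 'S_n]%G g)].
Proof.
move=> wn; have T := reshape_tableau wn.
have [h h0 cc] := young_sq_ex T; exists h; split=> // g.
have yE : young_symmetrizer n w = gring_row (young n w).
  rewrite /young /rsum /csum mulmx_suml linear_sum; apply: eq_bigr => p _ /=.
  rewrite mulmx_sumr linear_sum; apply: eq_bigr => q _ /=.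
  rewrite -scalemxAr linearZ /= regM /sgn; congr (_ *: _).
  by rewrite [RHS]gring_row_reg.
rewrite -(cyclic_char (young_gring n w) cc) /specht_char.
rewrite cfunE inE mulr1n; congr (_ * _).
by rewrite /specht_repr yE.
Qed.

Lemma specht_char_character n w : specht_char n w \is a character.
Proof. exact: cfRepr_char. Qed.

Section InnerProduct.
Variables (m n : nat) (f : 'S_m -> 'S_n).
Hypothesis fM : forall p q, f (p * q)%g = (f p * f q)%g.
Variables (w : seq nat).

Definition young_image := rsum f (rowf w) *m csum f (colf w).

Let Nm : algC := (gcard [set: 'S_m]%G)%:R.
Let aGm := regular_repr algC [set: 'S_m]%G.
Let aGn := regular_repr algC [set: 'S_n]%G.

Let image_expand :
  \sum_g \tr (young m w *m aGm g^-1%g) *: aGn (f g) = Nm *: young_image.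
Proof.
pose F (M : 'M_(gcard [set: 'S_m]%G)) := \sum_g \tr (M *m aGm g^-1%g) *: aGn (f g).
have Fsum I (r : seq I) (P : pred I) M : F (\sum_(i <- r | P i) M i) = \sum_(i <- r | P i) F (M i).
  rewrite /F exchange_big; apply: eq_bigr => g _ /=.
  by rewrite mulmx_suml raddf_sum scaler_suml.
have Freg x : F (aGm x) = Nm *: aGn (f x).
  rewrite /F (bigD1 x) //= regM mulgV tr_reg eqxx mulr1 big1 ?addr0 // => g ne.
  rewrite regM tr_reg -eq_invg_mul (inj_eq invg_inj) eq_sym (negPf ne) mulr0.
  by rewrite scale0r.
rewrite -[LHS]/(F (young m w)) /young /rsum /csum mulmx_suml Fsum.
rewrite /young_image /rsum mulmx_suml scaler_sumr; apply: eq_bigr => p _.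
rewrite mulmx_sumr Fsum /csum mulmx_sumr scaler_sumr; apply: eq_bigr => q _.
rewrite -scalemxAr regM -scalemxAr regM -fM scalerA mulrC -scalerA -Freg.
by rewrite /F scaler_sumr; apply: eq_bigr => g _; rewrite -scalemxAl mxtraceZ scalerA.
Qed.

(** Inner products with a Specht character become traces against its Young
    symmetrizer, by Fourier inversion in the group algebra. The morphism f allows
    for restrictions of characters of the larger symmetric group. *)
Lemma specht_inner (phi : 'CF([set: 'S_m])) (c : 'M_(gcard [set: 'S_n]%G)) (K h : algC) :
  (forall g, phi g = K * conj_form c (aGn (f g))) -> 0 < h ->
  (forall g, Nm * h * specht_char m w g = conj_form (young m w) (aGm g)) ->
  '[phi, specht_char m w] = K / h * conj_form c young_image.
Proof.
move=> phiE h0 chiE.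
have Nm0 : Nm != 0 by rewrite N_neq0.
have hn0 : h != 0 by rewrite gt_eqF.
have chiE' g : specht_char m w g = conj_form (young m w) (aGm g) / (Nm * h).
  by rewrite -chiE mulrC mulKf // mulf_neq0.
have cardN : (#|[set: 'S_m]|%:R : algC) = Nm by [].
rewrite cfdotE cardN.
have -> : \sum_(g in [set: 'S_m]) phi g * (specht_char m w g)^* =
   \sum_g \sum_x phi g * \tr (young m w *m aGm x *m aGm g^-1%g *m aGm x^-1%g) / (Nm * h).
  apply: eq_big => [g|g _]; first by rewrite inE.
  rewrite -char_inv ?specht_char_character // chiE' conj_formE mulr_suml mulr_sumr.
  by apply: eq_bigr => x _; rewrite mulrA.
rewrite exchange_big /=.
have step x : \sum_g phi g * \tr (young m w *m aGm x *m aGm g^-1%g *m aGm x^-1%g) / (Nm * h)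
   = K * conj_form c young_image / h.
  have -> : K * conj_form c young_image / h = K * conj_form c (Nm *: young_image) / (Nm * h).
    by rewrite conj_formZr; field; rewrite ?Nm0 ?hn0.
  rewrite -image_expand conj_form_sumr mulr_sumr mulr_suml.
  rewrite (reindex_inj (conjg_inj x)) /=; apply: eq_bigr => g _.
  have fV p : f p^-1%g = (f p)^-1%g.
    have f1 : f 1%g = 1%g by apply: (mulgI (f 1%g)); rewrite -fM !mulg1.
    by apply: (mulgI (f p)); rewrite -fM !mulgV.
  congr (_ / _); rewrite conj_formZr phiE -mulrA [X in _ * X]mulrC; congr (_ * (_ * _)).
    rewrite -[in LHS]mulmxA regM -mulmxA regM; congr (\tr (_ *m aGm _)).
    by rewrite -conjVg conjgE !mulgA mulgV mul1g mulgK.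
  by have := conj_form_class c (f g) (f x)^-1; rewrite invgK conjgE !fM fV mulgA.
rewrite (eq_bigr _ (fun x _ => step x)) sumr_const.
have -> : #|(xpredT : pred 'S_m)| = gcard [set: 'S_m]%G by rewrite /gcard cardsT.
by rewrite -[X in _ * X = _]mulr_natl -/Nm mulKf // mulrAC.
Qed.

End InnerProduct.

(** ** Irreducibility and restriction *)

Section SpechtIrr.
Variables (n : nat) (w : seq nat).
Hypothesis wn : sumn w = n.
Let T := reshape_tableau wn.
Let N : algC := (gcard [set: 'S_n]%G)%:R.
Let aG := regular_repr algC [set: 'S_n]%G.
Let N0 : N != 0. Proof. exact: N_neq0. Qed.

Lemma specht_charE' : exists2 h : algC, 0 < h & [/\ young n w *m young n w = h *: young n w,
   forall g, N * h * specht_char n w g = conj_form (young n w) (aG g) &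
   forall g, specht_char n w g = (N * h)^-1 * conj_form (young n w) (aG g)].
Proof.
have [h [h0 cc chiE]] := specht_charE wn; exists h => //; split=> // g.
by rewrite -chiE mulKf // mulf_neq0 // gt_eqF.
Qed.

Lemma young_sandwich x : exists k, young n w *m aG x *m young n w = k *: young n w.
Proof.
have [|k e] := sandwich T (M := csum id (colf w) *m aG x *m rsum id (rowf w)).
  by do 2?[apply: in_gringM]; [exact: csum_gring | exact: in_gring_reg | exact: rsum_gring].
by exists k; rewrite -e /young !mulmxA.
Qed.

Lemma conj_form_young h : young n w *m young n w = h *: young n w ->
  conj_form (young n w) (young n w) = N * h ^+ 2.
Proof.
set c := young n w => cc.
have trc : \tr c = N := tr_young T.
have key x : N * \tr (c *m aG x *m c *m aG x^-1%g) = h * \tr (c *m aG x^-1%g) * \tr (c *m aG x).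
  have [k e] := young_sandwich x; rewrite -/c in e.
  have kN : k * N = h * \tr (c *m aG x).
    by rewrite -trc -[k * _]mxtraceZ -e mxtrace_mulC mulmxA cc -scalemxAl mxtraceZ.
  by rewrite e -scalemxAl mxtraceZ mulrA [N * k]mulrC kN; ring.
apply: (mulfI N0); rewrite conj_formE mulr_sumr (eq_bigr _ (fun x _ => key x)).
transitivity (h * \tr (c *m \sum_x \tr (c *m aG x^-1%g) *: aG x)).
  rewrite mulmx_sumr raddf_sum mulr_sumr; apply: eq_bigr => x _ /=.
  by rewrite -scalemxAr mxtraceZ mulrA.
rewrite (gring_expand (young_gring n w)) -scalemxAr mxtraceZ cc mxtraceZ trc.
by rewrite -/N; ring.
Qed.

(** The norm of the character is 1: by the sandwich property, c x c is the multiple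
    of c that is determined by its trace. *)
Lemma specht_irr : specht_char n w \in irr [set: 'S_n].
Proof.
rewrite irrEchar specht_char_character /=.
have [h h0 [cc chiE chiE']] := specht_charE'.
rewrite (@specht_inner n n id (fun _ _ => erefl) w _ (young n w) (N * h)^-1 h) //.
rewrite -[young_image _ _]/(young n w) (conj_form_young cc).
have hn0 : h != 0 by rewrite gt_eqF.
by apply/eqP; field; rewrite N0 hn0.
Qed.

Lemma specht_char1_neq0 : specht_char n w 1%g != 0.
Proof. by have /irrP[i ->] := specht_irr; exact: irr1_neq0. Qed.

(** Up to positive factors the inner product is the sum over x of tr (W W^T),
    where W = b a x a' b'. Its terms are nonnegative, and the one for x = 1 is
    positive: a absorbs a' and b absorbs b', so W is a multiple of b a b', which
    does not vanish. *)
Lemma specht_restrict_gt0 m (f : 'S_m -> 'S_n) (w' : seq nat) (wm : sumn w' = m)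
  (phi : 'CF([set: 'S_m])) :
  (forall p q, f (p * q)%g = (f p * f q)%g) -> (forall q, sgn (f q) = sgn q) ->
  (forall p, p \in fiber_stab (rowf w' : 'I_m -> nat) -> f p \in fiber_stab (rowf w : 'I_n -> nat)) ->
  (forall p, p \in fiber_stab (colf w' : 'I_m -> nat) -> f p \in fiber_stab (colf w : 'I_n -> nat)) ->
  (forall g, phi g = specht_char n w (f g)) ->
  0 < '[phi, specht_char m w'].
Proof.
move=> fM fsgn fR fC phiE.
have [h h0 [cc chiE chiE']] := specht_charE'.
have [h' [h'0 cc' chiE0]] := specht_charE wm.
have Npos : 0 < N by rewrite ltr0n N_gt0.
rewrite (specht_inner fM (w := w') (c := young n w) (K := (N * h)^-1) (h := h')) //; last first.
  by move=> g; rewrite phiE chiE'.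
rewrite pmulr_rgt0 ?divr_gt0 ?invr_gt0 ?mulr_gt0 //.
rewrite /young /young_image.
set a := rsum id _; set b := csum id _; set a' := rsum f _; set b' := csum f _.
have id_sgn (q : 'S_n) : sgn (id q) = sgn q by [].
have ga : in_gring a := rsum_gring _ _. have gb : in_gring b := csum_gring _ _.
have ga' : in_gring a' := rsum_gring _ _. have gb' : in_gring b' := csum_gring _ _.
pose P : algC := #|fiber_stab (rowf w : 'I_n -> nat)|%:R.
pose Q : algC := #|fiber_stab (colf w : 'I_n -> nat)|%:R.
pose P' : algC := #|fiber_stab (rowf w' : 'I_m -> nat)|%:R.
pose Q' : algC := #|fiber_stab (colf w' : 'I_m -> nat)|%:R.
have aa : a *m a = P *: a := @rsum_sq n n id (fun _ _ => erefl) _.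
have bb : b *m b = Q *: b := @csum_sq n n id (fun _ _ => erefl) _.
have aa' : a' *m a' = P' *: a' := rsum_sq fM _.
have bb' : b' *m b' = Q' *: b' := csum_sq fM _.
have aT : a^T = a := @rsumT n n id (fun _ _ => erefl) _.
have bT : b^T = b := @csumT n n id (fun _ _ => erefl) _.
have aT' : a'^T = a' := rsumT fM _. have bT' : b'^T = b' := csumT fM _.
have ra : real_mx a := rsum_real _ _. have rb : real_mx b := csum_real _ _.
have ra' : real_mx a' := rsum_real _ _. have rb' : real_mx b' := csum_real _ _.
have aa2 : a *m a' = P' *: a.
  rewrite /a' /rsum mulmx_sumr (eq_bigr (fun=> a)) => [|p /fR Pp].
    by rewrite sumr_const scaler_nat.
  exact: (rsumMr (f := id)).
have bb2 : b *m b' = Q' *: b.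
  rewrite /b' /csum mulmx_sumr (eq_bigr (fun=> b)) => [|p Qp].
    by rewrite sumr_const scaler_nat.
  rewrite -scalemxAr (csumMr (f := id)) ?fC // scalerA fsgn.
  by rewrite sgnK scale1r.
have P0 : 0 < P by rewrite ltr0n card_fiber_stab_gt0.
have Q0 : 0 < Q by rewrite ltr0n card_fiber_stab_gt0.
have P'0 : 0 < P' by rewrite ltr0n card_fiber_stab_gt0.
have Q'0 : 0 < Q' by rewrite ltr0n card_fiber_stab_gt0.
pose W x := b *m a *m aG x *m a' *m b'.
have WE : P * P' * (Q * Q') * conj_form (a *m b) (a' *m b') = \sum_x \tr (W x *m (W x)^T).
  have -> : P * P' * (Q * Q') * conj_form (a *m b) (a' *m b') =
      conj_form (a *m b *m (b *m a)) (a' *m b' *m (b' *m a')).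
    have -> : a *m b *m (b *m a) = Q *: (a *m b *m a).
      by rewrite -!mulmxA [b *m (b *m _)]mulmxA bb -scalemxAl -scalemxAr.
    have -> : a' *m b' *m (b' *m a') = Q' *: (a' *m b' *m a').
      by rewrite -!mulmxA [b' *m (b' *m _)]mulmxA bb' -scalemxAl -scalemxAr.
    have s1 M' : conj_form (a *m b *m a) M' = P * conj_form (a *m b) M'.
      by rewrite (conj_form_cyc _ _ (in_gringM ga gb)) mulmxA aa -scalemxAl conj_formZl.
    have s2 M' : conj_form (a' *m b' *m a') M' = P' * conj_form (a' *m b') M'.
      by rewrite (conj_form_cyc _ _ (in_gringM ga' gb')) mulmxA aa' -scalemxAl conj_formZl.
    rewrite conj_formZl conj_formZr s1 [conj_form _ (_ *m a')]conj_formC s2 [in RHS]conj_formC.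
    by ring.
  rewrite conj_formE; apply: eq_bigr => x _; rewrite /W !trmx_mul aT bT aT' bT' trmx_reg.
  clear; set y := aG x; set z := aG _; move: a b a' b' y z => a b a' b' y z.
  have -> : a *m b *m (b *m a) *m y *m (a' *m b' *m (b' *m a')) *m z =
    (a *m b) *m (b *m a *m y *m a' *m b' *m b' *m a' *m z) by rewrite !mulmxA.
  rewrite [LHS]mxtrace_mulC.
  by congr (\tr _); rewrite !mulmxA.
have PQ0 : 0 < P * P' * (Q * Q') by rewrite !mulr_gt0.
rewrite -(pmulr_rgt0 _ PQ0) WE.
have rW x : real_mx (W x) by do 4?[apply: real_mxM] => //; exact: real_mx_reg.
rewrite (bigD1 1%g) //= ltr_wpDr //.
  by apply: sumr_ge0 => x _; apply: tr_mulT_ge0.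
apply: tr_mulT_gt0 => //; rewrite /W [aG _]reg1 mulmx1 -(mulmxA b) aa2.
rewrite -scalemxAr -scalemxAl scaler_eq0 gt_eqF //=.
apply/eqP => e; have : \tr (b *m a *m b') = 0 by rewrite e raddf0.
rewrite mxtrace_mulC mulmxA -[b' *m b]trmxK trmx_mul bT bT' bb2 linearZ /= bT.
rewrite -scalemxAl mxtraceZ mxtrace_mulC (tr_young T) => /eqP.
by rewrite mulf_eq0 !gt_eqF.
Qed.

End SpechtIrr.

(** The differences in s of these sums are the column lengths. *)
Lemma min_sum_inj (w w' : seq nat) M : size w = M -> size w' = M ->
  sorted geq w -> sorted geq w' ->
  (forall s, (\sum_(r < M) minn (nth 0 w r) s = \sum_(r < M) minn (nth 0 w' r) s)%N) -> w = w'.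
Proof.
move=> sw sw' dw dw' e.
have ge_nth (u : seq nat) i j : sorted geq u -> (i <= j)%N -> (nth 0%N u j <= nth 0%N u i)%N.
  move=> du le_ij; case: (ltnP j (size u)) => [lt_j|le_j]; last by rewrite nth_default.
  have tr : transitive geq by move=> x y z /= ? ?; lia.
  have rf : reflexive geq by move=> x /=.
  by apply: (sorted_leq_nth tr rf 0%N du) => //; rewrite inE; lia.
have cnt s : (\sum_(r < M) (s < nth 0 w r) = \sum_(r < M) (s < nth 0 w' r))%N.
  have aux (u : seq nat) : (\sum_(r < M) minn (nth 0 u r) s.+1 =
      \sum_(r < M) minn (nth 0 u r) s + \sum_(r < M) (s < nth 0 u r))%N.
    by rewrite -big_split; apply: eq_bigr => r _ /=; lia.
  by have := e s.+1; rewrite !aux e => /addnI.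
have cntE (u : seq nat) s i : sorted geq u -> (i < M)%N ->
    (s < nth 0 u i)%N = (i < \sum_(r < M) (s < nth 0 u r))%N.
  move=> du lt_iM; have sE : (\sum_(r < M) (s < nth 0 u r) =
     \sum_(r < i) (s < nth 0 u r) + \sum_(i <= r < M) (s < nth 0 u r))%N.
    by rewrite -!(big_mkord xpredT (fun r => (s < nth 0 u r) : nat)) (big_cat_nat _ (n := i)) //= ltnW.
  rewrite sE; apply/idP/idP => [lt_s|].
    have -> : (\sum_(r < i) (s < nth 0 u r) = i)%N.
      rewrite -[RHS]card_ord -sum1_card; apply: eq_bigr => r _.
      suff -> : (s < nth 0 u r)%N by []; apply: leq_trans lt_s _.
      exact: ge_nth _ _ _ du (ltnW (ltn_ord r)).
    by rewrite big_ltn // lt_s; lia.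
  apply: contraTT; rewrite -!leqNgt => le_s.
  have -> : (\sum_(i <= r < M) (s < nth 0 u r) = 0)%N.
    rewrite big_nat_cond big1 // => r; rewrite andbT => /andP[le_ir _].
    by apply/eqP; rewrite eqb0 -leqNgt; apply: leq_trans le_s; exact: ge_nth _ _ _ du le_ir.
  rewrite addn0.
  rewrite -[X in (_ <= X)%N]card_ord -sum1_card; apply: leq_sum => r _; exact: leq_b1.
apply: (@eq_from_nth _ 0%N) => [|i]; rewrite sw // => lt_i.
apply/eqP; rewrite eqn_leq; apply/andP; split; rewrite leqNgt; apply/negP => lt;
  have := cntE w (minn (nth 0%N w i) (nth 0%N w' i)) i dw lt_i;
  have := cntE w' (minn (nth 0%N w i) (nth 0%N w' i)) i dw' lt_i; rewrite cnt; lia.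
Qed.

(** If the inner product does not vanish, there is a permutation without clash
    from each of the shapes to the other, so they dominate each other. *)
Lemma specht_char_inj n (w w' : seq nat) M : size w = M -> size w' = M ->
  sorted geq w -> sorted geq w' -> sumn w = n -> sumn w' = n ->
  specht_char n w = specht_char n w' -> w = w'.
Proof.
move=> sw sw' dw dw' wn w'n e.
have [h h0 [cc chiE chiE']] := specht_charE' wn.
have [h' [h'0 cc' chiE0]] := specht_charE w'n.
have : '[specht_char n w, specht_char n w'] = 1.
  by rewrite -e; move: (specht_irr wn); rewrite irrEchar => /andP[_ /eqP].
rewrite (@specht_inner n n id (fun _ _ => erefl) w' _ (young n w) _ h' chiE') //.
rewrite -[young_image _ _]/(young n w') => e1.
have nz : conj_form (young n w) (young n w') != 0.
  by apply: contra_eq_neq e1 => ->; rewrite mulr0 eq_sym oner_eq0.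
have dom u u' : sumn u = n -> sumn u' = n -> size u = M -> size u' = M ->
  conj_form (young n u) (young n u') != 0 -> forall s,
  (\sum_(r < M) minn (nth 0 u r) s <= \sum_(r < M) minn (nth 0 u' r) s)%N.
  move=> un u'n su su' nzu s.
  have [x nzx] : exists x, young n u *m regular_repr algC [set: 'S_n]%G x *m young n u' != 0.
    apply/existsP; apply: contraR nzu => /existsPn H; rewrite conj_formE big1 // => x _.
    by have /negPn/eqP-> := H x; rewrite mul0mx raddf0.
  have nzx' : csum id (colf u) *m regular_repr algC [set: 'S_n]%G x *m rsum id (rowf u' : 'I_n -> nat) != 0.
    apply: contraNneq nzx => z.
    have -> : young n u *m regular_repr algC [set: 'S_n]%G x *m young n u' =
      rsum id (rowf u) *m (csum id (colf u) *m regular_repr algC [set: 'S_n]%G x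
        *m rsum id (rowf u')) *m csum id (colf u') by rewrite /young !mulmxA.
    by rewrite z mulmx0 mul0mx.
  have nzx2 : rsum id (rowf u' : 'I_n -> nat) *m regular_repr algC [set: 'S_n]%G x^-1%g *m csum id (colf u) != 0.
    apply: contraNneq nzx' => z; apply/eqP/trmx_inj; rewrite trmx0 -[RHS]z !trmx_mul trmx_reg.
    by rewrite (@rsumT n n id) // (@csumT n n id) // mulmxA.
  have nc := noclash_of_neq0 nzx2.
  have rowB (v : seq nat) (i : 'I_n) : sumn v = n -> size v = M -> (reshape_index v i < M)%N.
    by move=> vn <-; apply: reshape_indexP; rewrite vn.
  exact: (noclash_dominance (reshape_tableau u'n) (reshape_tableau un) s
           (fun i => rowB u' i u'n su') (fun i => rowB u i un su) nc).
apply: (min_sum_inj sw sw' dw dw') => s; apply/eqP; rewrite eqn_leq !dom //.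
by rewrite conj_formC.
Qed.

Local Open Scope nat_scope.

(** * Adding and removing boxes *)

(** Partitions are padded by empty rows to a fixed number M of rows, so that
    adding and removing boxes does not change the length of the sequence. *)
Record wpart (M n : nat) (w : seq nat) : Prop := WPart {
  wpart_size : size w = M;
  wpart_dec : forall i, nth 0 w i.+1 <= nth 0 w i;
  wpart_sum : sumn w = n }.

Definition removable (w : seq nat) r := nth 0 w r.+1 < nth 0 w r.
Definition addable (w : seq nat) r := (r == 0) || (nth 0 w r < nth 0 w r.-1).
Definition rem_box (w : seq nat) r := set_nth 0 w r (nth 0 w r).-1.
Definition add_box (w : seq nat) r := set_nth 0 w r (nth 0 w r).+1.

Lemma wpart_le M n w i j : wpart M n w -> i <= j -> nth 0 w j <= nth 0 w i.
Proof.
move=> [_ dec _]; elim: j => [|j IH]; first by rewrite leqn0 => /eqP->.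
by rewrite leq_eqVlt => /orP[/eqP->//|/IH]; apply: leq_trans.
Qed.

Lemma wpart_sorted M n w : wpart M n w -> sorted geq w.
Proof. by case=> _ dec _; apply/(sortedP 0) => i _; exact: dec. Qed.

Lemma sorted_wpart n w : sorted geq w -> sumn w = n -> wpart (size w) n w.
Proof.
move=> dw wn; split=> // i; case: (ltnP i.+1 (size w)) => [lt_i|le_i].
  by move/(sortedP 0): dw => /(_ i lt_i).
by rewrite nth_default.
Qed.

Lemma sumn_ord M w : size w = M -> sumn w = \sum_(r < M) nth 0 w r.
Proof. by move=> <-; rewrite sumnE (big_nth 0) big_mkord. Qed.

Lemma nth_rem_box w r i : nth 0 (rem_box w r) i = nth 0 w i - (i == r).
Proof. by rewrite nth_set_nth /=; case: eqP => [->|_]; lia. Qed.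

Lemma nth_add_box w r i : nth 0 (add_box w r) i = nth 0 w i + (i == r).
Proof. by rewrite nth_set_nth /=; case: eqP => [->|_]; lia. Qed.

Section Boxes.
Variable M : nat.

Lemma size_rem_box w r : size w = M -> r < M -> size (rem_box w r) = M.
Proof. by rewrite size_set_nth => ->; lia. Qed.

Lemma size_add_box w r : size w = M -> r < M -> size (add_box w r) = M.
Proof. by rewrite size_set_nth => ->; lia. Qed.

Lemma wpart_rem n w r : wpart M n.+1 w -> r < M -> removable w r -> wpart M n (rem_box w r).
Proof.
move=> [sw dec sn] lt_r rem; split; first exact: size_rem_box.
  move=> i; rewrite !nth_rem_box; have := dec i; rewrite /removable in rem.
  by case: (i =P r) => [e|]; [rewrite -e in rem *; lia | case: (i.+1 =P r); lia].
by rewrite sumn_set_nth0 sn; rewrite /removable in rem; lia.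
Qed.

Lemma wpart_add n w r : wpart M n w -> r < M -> addable w r -> wpart M n.+1 (add_box w r).
Proof.
move=> [sw dec sn] lt_r ad; split; first exact: size_add_box.
  move=> i; rewrite !nth_add_box; have := dec i; rewrite /addable in ad.
  case: (i.+1 =P r) => [e|]; last by case: (i =P r); lia.
  by rewrite -e /= in ad; case: (i =P r) => ei; lia.
have := sumn_set_nth0 w r (nth 0 w r).+1; rewrite -/(add_box w r) sn => ->.
have le : nth 0 w r <= n.
  by rewrite -sn (sumn_ord sw) (bigD1 (Ordinal lt_r)) //= leq_addr.
lia.
Qed.

Lemma eq_boxes w w' : size w = M -> size w' = M ->
  (forall i, nth 0 w i = nth 0 w' i) -> w = w'.
Proof. by move=> sw sw' e; apply: (@eq_from_nth _ 0) => [|i _]; rewrite ?sw ?sw'. Qed.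

Lemma add_boxK n w r : wpart M n w -> r < M -> rem_box (add_box w r) r = w.
Proof.
move=> [sw _ _] lt_r; apply: eq_boxes => //.
  by rewrite size_rem_box ?size_add_box.
by move=> i; rewrite nth_rem_box nth_add_box addnK.
Qed.

Lemma rem_boxK n w r : wpart M n w -> r < M -> removable w r -> add_box (rem_box w r) r = w.
Proof.
move=> [sw _ _] lt_r rem; apply: eq_boxes => //.
  by rewrite size_add_box ?size_rem_box.
move=> i; rewrite nth_add_box nth_rem_box; case: eqP => [->|_]; rewrite /removable in rem; lia.
Qed.

Lemma add_removable n w r : wpart M n w -> removable (add_box w r) r.
Proof. by move=> [_ dec _]; rewrite /removable !nth_add_box; have := dec r; lia. Qed.

Lemma rem_addable n w r : wpart M n w -> removable w r -> addable (rem_box w r) r.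
Proof.
move=> [_ dec _]; rewrite /removable /addable !nth_rem_box; case: r => //= r.
by have := dec r; lia.
Qed.

Lemma rem_add_comm n w r s : wpart M n w -> r < M -> s < M -> r != s ->
  addable w r && removable (add_box w r) s = removable w s && addable (rem_box w s) r.
Proof.
move=> [_ dec _] _ _ ne; rewrite /addable /removable !nth_add_box !nth_rem_box.
case: r ne => [|r] ne /=; have := dec s; first lia.
have := dec r; rewrite (eq_sym s.+1).
case: (r =P s) => [->|ne1]; first lia.
case: (r.+1 =P s.+1) => [|ne2]; first lia.
by case: (s =P r.+1) => [e|]; [rewrite e eqxx in ne | lia].
Qed.

Lemma rem_add_swap n w r s : wpart M n w -> r < M -> s < M -> r != s ->
  rem_box (add_box w r) s = add_box (rem_box w s) r.
Proof.
move=> [sw _ _] lt_r lt_s ne; apply: eq_boxes.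
- by rewrite size_rem_box ?size_add_box.
- by rewrite size_add_box ?size_rem_box.
move=> i; rewrite nth_rem_box !nth_add_box nth_rem_box.
by case: (i =P r) => [->|]; case: (_ =P s); lia.
Qed.

Lemma rem_box_inj n w r s : wpart M n w -> r < M -> s < M ->
  removable w r -> removable w s -> rem_box w r = rem_box w s -> r = s.
Proof.
move=> _ _ _ rr rs e; have := congr1 (fun u => nth 0 u r) e.
rewrite !nth_rem_box eqxx; case: eqP => // _; rewrite /removable in rr; lia.
Qed.

Lemma add_box_inj n w r s : wpart M n w -> add_box w r = add_box w s -> r = s.
Proof.
move=> _ e; have := congr1 (fun u => nth 0 u r) e.
by rewrite !nth_add_box eqxx; case: eqP => // _; lia.
Qed.

Lemma wpart_last n w : wpart M n w -> n < M -> nth 0 w M.-1 = 0.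
Proof.
move=> pw lt_n; have [sw dec sn] := pw; apply/eqP; rewrite -leqn0 leqNgt; apply/negP => pos.
have : \sum_(r < M) 1 <= \sum_(r < M) nth 0 w r.
  by apply: leq_sum => r _; apply: leq_trans pos (wpart_le pw _); have := ltn_ord r; lia.
by rewrite -(sumn_ord sw) sn sum1_card card_ord; lia.
Qed.

Lemma count_addable n w : wpart M n w -> n < M ->
  \sum_(r < M) addable w r = (\sum_(r < M) removable w r).+1.
Proof.
move=> pw lt_n; have z := wpart_last pw lt_n; have [sw dec sn] := pw.
case: M lt_n z sw {pw} => // m _ /= z sw.
rewrite big_ord_recl [in RHS]big_ord_recr /= {1}/addable /= [removable w m](_ : _ = false); last first.
  by rewrite /removable z ltn0.
by rewrite addn0 add1n; congr _.+1; apply: eq_bigr => r _; rewrite /addable /removable.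
Qed.

Lemma ex_removable n w : wpart M n.+1 w -> exists2 r, r < M & removable w r.
Proof.
move=> pw; have [sw dec sn] := pw.
have [/existsP[r rem]|none] := boolP [exists r : 'I_M, removable w r]; first by exists r.
have z i : i <= M -> nth 0 w (M - i) = 0.
  elim: i => [|i IH] le_i; first by rewrite subn0 nth_default ?sw.
  have lt : M - i.+1 < M by lia.
  have := existsPn none (Ordinal lt); rewrite /removable -leqNgt /= -subSn // subSS.
  by rewrite (IH (ltnW le_i)) leqn0 => /eqP.
have : sumn w = 0.
  rewrite (sumn_ord sw) big1 // => r _; have := z (M - r) (leq_subr _ _).
  by rewrite subKn // ltnW.
by rewrite sn.
Qed.

End Boxes.

(** The commutation relation of Young's lattice: the two ways of moving a box
    from one row to a different one agree, and there is one more addable row than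
    there are removable ones. *)
Lemma up_down (V : zmodType) M n w (F : seq nat -> V) : wpart M n w -> n < M ->
  (\sum_(r < M | addable w r) \sum_(s < M | removable (add_box w r) s)
      F (rem_box (add_box w r) s) =
   F w + \sum_(s < M | removable w s) \sum_(r < M | addable (rem_box w s) r)
      F (add_box (rem_box w s) r))%R.
Proof.
move=> pw lt_n.
have diag1 (r : 'I_M) : addable w r ->
    (\sum_(s < M | removable (add_box w r) s) F (rem_box (add_box w r) s) =
     F w + \sum_(s < M | (r != s) && removable (add_box w r) s) F (rem_box (add_box w r) s))%R.
  move=> ad; rewrite (bigD1 r) ?(add_removable r pw) //= (add_boxK pw) //; congr (_ + _)%R.
  by apply: eq_bigl => s; rewrite andbC eq_sym.
have diag2 (s : 'I_M) : removable w s ->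
    (\sum_(r < M | addable (rem_box w s) r) F (add_box (rem_box w s) r) =
     F w + \sum_(r < M | (r != s) && addable (rem_box w s) r) F (add_box (rem_box w s) r))%R.
  move=> re; rewrite (bigD1 s) ?(rem_addable pw) //= (rem_boxK pw) //; congr (_ + _)%R.
  by apply: eq_bigl => r; rewrite andbC.
rewrite (eq_bigr _ diag1) (eq_bigr _ diag2) !big_split /=.
have offdiag : (\sum_(r < M | addable w r) \sum_(s < M | (r != s) && removable (add_box w r) s)
      F (rem_box (add_box w r) s) =
    \sum_(s < M | removable w s) \sum_(r < M | (r != s) && addable (rem_box w s) r)
      F (add_box (rem_box w s) r))%R.
  rewrite !pair_big_dep /= (reindex (fun p : 'I_M * 'I_M => (p.2, p.1))) /=; last first.
    by exists (fun p => (p.2, p.1)) => -[].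
  apply: eq_big => [[s r]|[s r]] /=.
    have [->|ne] := eqVneq r s; first by rewrite !andbF.
    by rewrite (rem_add_comm pw).
  by case/and3P=> _ ne _; rewrite (rem_add_swap pw).
rewrite offdiag addrA; congr (_ + _)%R; rewrite !sumr_const.
have cE (P : pred 'I_M) : #|P| = \sum_(r < M) P r.
  by rewrite -sum1_card big_mkcond; apply: eq_bigr => r _; rewrite -[r \in P]/(P r); case: (P r).
by rewrite !cE (count_addable pw lt_n) mulrS.
Qed.

Local Open Scope ring_scope.

(** The tableau of a partition minus a corner is obtained by skipping the
    corner box in the reading order. *)
Section RemTableau.
Variables (M n : nat) (w : seq nat) (r : nat).
Hypotheses (pw : wpart M n.+1 w) (lt_r : (r < M)%N) (rem : removable w r).

Let pos_lt : (flatten_index w r (nth 0 w r).-1 < n.+1)%N.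
Proof.
rewrite -(wpart_sum pw); apply: flatten_indexP; move: rem; rewrite /removable; lia.
Qed.

Definition corner : 'I_n.+1 := Ordinal pos_lt.

Let take_rem R : sumn (take R (rem_box w r)) = (sumn (take R w) - (r < R))%N.
Proof.
have aux (u : seq nat) k : sumn (take k u) = (\sum_(i < k) nth 0 u i)%N.
  elim: k => [|k IH]; first by rewrite take0 big_ord0.
  rewrite big_ord_recr /= -IH; case: (ltnP k (size u)) => [lt|le].
    by rewrite (take_nth 0%N) // -cats1 sumn_cat /= addn0.
  by rewrite nth_default // addn0 !take_oversize // ltnW.
rewrite !aux; case: (ltnP r R) => [lt_rR|le_Rr]; last first.
  rewrite subn0; apply: eq_bigr => i _; rewrite nth_rem_box.
  by have := ltn_ord i; case: eqP; lia.
rewrite (bigD1 (Ordinal lt_rR)) //= [in RHS](bigD1 (Ordinal lt_rR)) //= nth_rem_box eqxx.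
rewrite (eq_bigr (fun i : 'I_R => nth 0%N w i)) => [|i ne].
  by move: rem; rewrite /removable; lia.
by rewrite nth_rem_box (negPf (ne : (i : nat) != r)) subn0.
Qed.

Let rem_sum : sumn (rem_box w r) = n.
Proof. exact: wpart_sum (wpart_rem pw lt_r rem). Qed.

(** Removing the corner renumbers the boxes in the order of [lift corner]. *)
Lemma lift_corner (i : 'I_n) :
  flatten_index w (reshape_index (rem_box w r) i) (reshape_offset (rem_box w r) i)
    = lift corner i :> nat /\
  (reshape_offset (rem_box w r) i < nth 0 w (reshape_index (rem_box w r) i))%N.
Proof.
have lt_i : (i < sumn (rem_box w r))%N by rewrite rem_sum.
have iE := reshape_indexK (rem_box w r) i.
have lt_c := reshape_offsetP lt_i.
set R := reshape_index _ i in iE lt_c *; set C := reshape_offset _ i in iE lt_c *.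
rewrite /flatten_index take_rem in iE; rewrite nth_rem_box in lt_c.
have rem' : (nth 0 w r.+1 < nth 0 w r)%N := rem.
split; last by lia.
rewrite /lift /= /bump /= /flatten_index.
have mono a b : (a <= b)%N -> (sumn (take a w) <= sumn (take b w))%N.
  by move=> le; rewrite -(take_takel w le) -{2}[take b w](cat_take_drop a) sumn_cat leq_addr.
have step : (sumn (take r.+1 w) = sumn (take r w) + nth 0 w r)%N.
  by rewrite (take_nth 0%N) ?(wpart_size pw) // -cats1 sumn_cat /= addn0.
have stepR : (R < r)%N -> (sumn (take R w) + nth 0 w R <= sumn (take r w))%N.
  move=> lt; have <- : sumn (take R.+1 w) = (sumn (take R w) + nth 0 w R)%N.
    by rewrite (take_nth 0%N) ?(wpart_size pw) ?(ltn_trans lt) // -cats1 sumn_cat /= addn0.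
  exact: mono.
case: (ltngtP R r) => [lt_Rr|lt_rR|eR].
- have := stepR lt_Rr; move: iE lt_c; rewrite ltnNge (ltnW lt_Rr) /=; case: (R == r); lia.
- have := mono _ _ lt_rR; rewrite step; move: iE; rewrite lt_rR; lia.
- move: iE lt_c; rewrite eR ltnn eqxx; lia.
Qed.

Lemma reshape_index_corner (i : 'I_n) :
  reshape_index w (lift corner i) = reshape_index (rem_box w r) i.
Proof. by have [<- lt_c] := lift_corner i; rewrite flatten_indexKl. Qed.

Lemma reshape_offset_corner (i : 'I_n) :
  reshape_offset w (lift corner i) = reshape_offset (rem_box w r) i.
Proof. by have [<- lt_c] := lift_corner i; rewrite flatten_indexKr. Qed.

Lemma corner_row : reshape_index w corner = r.
Proof. by rewrite flatten_indexKl //; move: rem; rewrite /removable; lia. Qed.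

Lemma corner_col : reshape_offset w corner = (nth 0 w r).-1.
Proof. by rewrite flatten_indexKr //; move: rem; rewrite /removable; lia. Qed.

End RemTableau.

(** * The branching rule *)

(** The embedding of S_n in S_(n+1) as the stabilizer of the last point. *)
Definition emb n (g : 'S_n) : 'S_n.+1 := lift_perm ord_max ord_max g.

Lemma embM n (g h : 'S_n) : emb (g * h)%g = (emb g * emb h)%g.
Proof. by rewrite /emb lift_permM. Qed.

Fact emb_morphism n : {in [set: 'S_n] &, {morph @emb n : g h / (g * h)%g}}.
Proof. by move=> g h _ _; exact: embM. Qed.
Canonical emb_mor n := Morphism (@emb_morphism n).

Definition cfLift n (chi : 'CF([set: 'S_n.+1])) : 'CF([set: 'S_n]) :=
  cfMorph ('Res[emb_mor n @* [set: 'S_n]] chi).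

Lemma cfLiftE n (chi : 'CF([set: 'S_n.+1])) g : cfLift chi g = chi (emb g).
Proof.
rewrite cfMorphE ?inE // cfResE ?subsetT //.
by rewrite mem_morphim ?inE.
Qed.

Lemma cfLift_char n (chi : 'CF([set: 'S_n.+1])) :
  chi \is a character -> cfLift chi \is a character.
Proof. by move=> chiC; apply/cfMorph_char/cfRes_char. Qed.

Lemma lift_perm_conj n (i : 'I_n.+1) (g : 'S_n) :
  lift_perm i i g = (lift_perm i ord_max 1 * emb g * (lift_perm i ord_max 1)^-1)%g.
Proof. by rewrite lift_permV invg1 /emb !lift_permM mul1g mulg1. Qed.

(** The stabilizers of any two points are conjugate, so the corner box may play
    the role of the last point. *)
Lemma cfun_lift n (chi : 'CF([set: 'S_n.+1])) (i : 'I_n.+1) g :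
  chi (lift_perm i i g) = chi (emb g).
Proof.
have := cfunJ chi (emb g) (in_setT (lift_perm i ord_max 1 : 'S_n.+1)^-1%g).
by rewrite conjgE invgK lift_perm_conj !mulgA.
Qed.

Section Branching.
Variable M : nat.

Definition deg n w : algC := specht_char n w 1%g.

Lemma deg_gt0 n w : wpart M n w -> 0 < deg n w.
Proof.
by case=> _ _ wn; rewrite lt_def specht_char1_neq0 //= char1_ge0 ?specht_char_character.
Qed.

Lemma wpart_specht_inj n w w' : wpart M n w -> wpart M n w' ->
  specht_char n w = specht_char n w' -> w = w'.
Proof.
by move=> pw pw'; apply: (@specht_char_inj n w w' M); rewrite ?(wpart_size pw) ?(wpart_size pw')
  ?(wpart_sum pw) ?(wpart_sum pw') ?(wpart_sorted pw) ?(wpart_sorted pw').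
Qed.

Lemma lift_specht_inner n w r : wpart M n.+1 w -> (r < M)%N -> removable w r ->
  0 < '[cfLift (specht_char n.+1 w), specht_char n (rem_box w r)].
Proof.
move=> pw lt_r rem; set j := corner pw lt_r rem.
have fM (p q : 'S_n) : lift_perm j j (p * q)%g = (lift_perm j j p * lift_perm j j q)%g.
  by rewrite lift_permM.
apply: (specht_restrict_gt0 (wpart_sum pw) (wpart_sum (wpart_rem pw lt_r rem)) fM).
- by move=> q; rewrite /sgn odd_lift_perm addbb.
- move=> p /fiber_stabP Hp; apply/fiber_stabP => i.
  case: (unliftP j i) => [i' ->|->]; last by rewrite lift_perm_id.
  by rewrite lift_perm_lift !reshape_index_corner Hp.
- move=> p /fiber_stabP Hp; apply/fiber_stabP => i.
  case: (unliftP j i) => [i' ->|->]; last by rewrite lift_perm_id.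
  by rewrite lift_perm_lift !reshape_offset_corner Hp.
- by move=> g; rewrite cfLiftE cfun_lift.
Qed.

Lemma natr_gt0_ge1 (x : algC) : x \is a Num.nat -> 0 < x -> 1 <= x.
Proof. by case/natrP => m ->; rewrite ltr0n ler1n. Qed.

Definition rem_sum n w : 'CF([set: 'S_n]) :=
  \sum_(r < M | removable w r) specht_char n (rem_box w r).

(** The summands of [rem_sum] are distinct irreducible constituents of the
    restriction. *)
Lemma lift_sub_char n w : wpart M n.+1 w ->
  cfLift (specht_char n.+1 w) - rem_sum n w \is a character.
Proof.
move=> pw; have liftC := cfLift_char (specht_char_character n.+1 w).
have irrR (r : 'I_M) : removable w r -> specht_char n (rem_box w r) \in irr [set: 'S_n].
  by move=> rem; apply: specht_irr; apply: wpart_sum (wpart_rem pw (ltn_ord r) rem).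
apply/forallP => i; rewrite coord_cfdot cfdotBl.
have [/existsP[r /andP[rem /eqP er]]|/existsPn none] :=
  boolP [exists r : 'I_M, removable w r && (specht_char n (rem_box w r) == 'chi_i)].
- have -> : '[rem_sum n w, 'chi_i] = 1.
    rewrite /rem_sum cfdot_suml (bigD1 r) //= er cfdot_irr eqxx big1 ?addr0 // => s /andP[rems ne].
    have /irrP[k ek] := irrR _ rems; rewrite ek cfdot_irr; case: eqP => // eki.
    case/eqP: ne; apply/val_inj.
    apply: (rem_box_inj pw (ltn_ord s) (ltn_ord r) rems rem).
    apply: (wpart_specht_inj (wpart_rem pw (ltn_ord s) rems) (wpart_rem pw (ltn_ord r) rem)).
    by rewrite ek er eki.
  have := natr_gt0_ge1 (Cnat_cfdot_char_irr i liftC).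
  rewrite -{1}er => /(_ (lift_specht_inner pw (ltn_ord r) rem)) ge1.
  have /natrP[m em] := Cnat_cfdot_char_irr i liftC.
  by rewrite em ler1n in ge1; rewrite em -[1]/(1%:R) -natrB // natr_nat.
have -> : '[rem_sum n w, 'chi_i] = 0.
  rewrite /rem_sum cfdot_suml big1 // => s rems; have /irrP[k ek] := irrR _ rems.
  rewrite ek cfdot_irr; case: eqP => // eki; have := none s.
  by rewrite rems ek eki eqxx.
by rewrite subr0 Cnat_cfdot_char_irr.
Qed.

Lemma deg_rem_le n w : wpart M n.+1 w ->
  \sum_(r < M | removable w r) deg n (rem_box w r) <= deg n.+1 w.
Proof.
move=> pw; have := char1_ge0 (lift_sub_char pw).
rewrite !cfunE cfLiftE sum_cfunE /emb lift_perm1 subr_ge0.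
by apply: le_trans; rewrite le_eqVlt eqxx.
Qed.

(** By restricting the regular character: the right-hand side is the sum, over the
    irreducible characters of the larger group, of the dimension times the
    multiplicity of the character of w in the restriction. *)
Lemma deg_add_le n w : wpart M n w ->
  \sum_(r < M | addable w r) deg n.+1 (add_box w r) <= n.+1%:R * deg n w.
Proof.
move=> pw; have wn := wpart_sum pw.
have -> : n.+1%:R * deg n w = \sum_i 'chi[[set: 'S_n.+1]]_i 1%g * '[cfLift 'chi_i, specht_char n w].
  transitivity ('[cfLift (cfReg [set: 'S_n.+1]), specht_char n w]).
    rewrite cfdotE (bigD1 1%g) ?inE //= big1 ?addr0 => [|g /andP[_ ne]]; last first.
      rewrite cfLiftE cfRegE [emb g == _](_ : _ = false) ?mulr0n ?mul0r //.
      apply/eqP => e; case/eqP: ne; apply/permP => i; apply: (@lift_inj _ ord_max).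
      by rewrite -(lift_perm_lift ord_max ord_max) -/(emb g) e !perm1.
    rewrite cfLiftE /emb lift_perm1 cfRegE eqxx mulr1n !cardsT !card_Sn factS natrM.
    rewrite conj_natr ?Cnat_char1 ?specht_char_character // -/(deg n w).
    by rewrite mulrCA !mulrA mulfK ?mulrA //; rewrite pnatr_eq0 -lt0n fact_gt0.
  rewrite cfReg_sum; transitivity ('[\sum_i 'chi[[set: 'S_n.+1]]_i 1%g *: cfLift 'chi_i, specht_char n w]).
    congr '[_, _]; apply/cfunP => g; rewrite cfLiftE !sum_cfunE; apply: eq_bigr => i _.
    by rewrite !cfunE cfLiftE.
  by rewrite cfdot_suml; apply: eq_bigr => i _; rewrite cfdotZl.
have irrA (r : 'I_M) : addable w r -> specht_char n.+1 (add_box w r) \in irr [set: 'S_n.+1].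
  by move=> ad; apply: specht_irr; apply: wpart_sum (wpart_add pw (ltn_ord r) ad).
pose ind (r : 'I_M) i : algC := (specht_char n.+1 (add_box w r) == 'chi_i)%:R.
apply: (@le_trans _ _ (\sum_(i : Iirr [set: 'S_n.+1]) \sum_(r < M | addable w r) ind r i * 'chi_i 1%g)).
  rewrite exchange_big /=; apply: ler_sum => r ad; have /irrP[k ek] := irrA r ad.
  rewrite (bigD1 k) //= big1 ?addr0 => [|i ne]; rewrite /ind ek.
    by rewrite eqxx mul1r /deg ek.
  by rewrite (inj_eq irr_inj) eq_sym (negPf ne) mul0r.
apply: ler_sum => i _; have chi1 := char1_ge0 (irr_char i).
have liftC := cfLift_char (irr_char i).
have [/existsP[r /andP[ad /eqP er]]|/existsPn none] :=
  boolP [exists r : 'I_M, addable w r && (specht_char n.+1 (add_box w r) == 'chi_i)].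
  rewrite (bigD1 r) //= big1 ?addr0 => [|s /andP[ads ne]].
    rewrite /ind er eqxx mul1r ler_peMr //.
    apply: natr_gt0_ge1; first by rewrite Cnat_cfdot_char ?specht_char_character.
    have := lift_specht_inner (wpart_add pw (ltn_ord r) ad) (ltn_ord r) (add_removable r pw).
    by rewrite (add_boxK pw (ltn_ord r)) er.
  rewrite /ind; case: eqP => [es|]; rewrite ?mul0r //; case/eqP: ne; apply/val_inj.
  apply: (add_box_inj pw); apply: (wpart_specht_inj (wpart_add pw (ltn_ord s) ads) (wpart_add pw (ltn_ord r) ad)).
  by rewrite es er.
rewrite big1 => [|s ads]; first by rewrite mulr_ge0 // natr_ge0 // Cnat_cfdot_char ?specht_char_character.
by have := none s; rewrite /ind ads /= => /negPf->; rewrite mul0r.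
Qed.

(** Both inequalities are equalities, by induction on n: going up with the
    second one and down with the first one yields, by the commutation relation
    [up_down] and the induction hypothesis, a sum of the same value. *)
Lemma deg_rem_add n : (n < M)%N ->
  (forall w, wpart M n.+1 w -> \sum_(r < M | removable w r) deg n (rem_box w r) = deg n.+1 w) /\
  (forall w, wpart M n w -> \sum_(r < M | addable w r) deg n.+1 (add_box w r) = n.+1%:R * deg n w).
Proof.
elim: n => [|n IH] lt_n.
  have base w : wpart M 0 w -> forall r, removable w r = false.
    move=> pw r; have := sumn_ord (wpart_size pw); rewrite (wpart_sum pw) => /esym/eqP.
    rewrite sum_nat_eq0 => /forallP z; rewrite /removable; case: (ltnP r M) => [lt|le].
      by have /eqP/= -> := z (Ordinal lt); rewrite ltn0.
    by rewrite [nth _ w r]nth_default ?(wpart_size pw).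
  have step w : wpart M 0 w ->
     \sum_(r < M | addable w r) (deg 1 (add_box w r) -
        \sum_(s < M | removable (add_box w r) s) deg 0 (rem_box (add_box w r) s)) <= 0.
    move=> pw; rewrite sumrB (up_down _ pw lt_n) [\sum_(s < M | removable w s) _]big1; last first.
      by move=> s; rewrite (base w pw).
    by rewrite addr0 subr_le0; have := deg_add_le pw; rewrite mul1r.
  have eq0 w : wpart M 0 w -> forall r : 'I_M, addable w r -> deg 1 (add_box w r) =
        \sum_(s < M | removable (add_box w r) s) deg 0 (rem_box (add_box w r) s).
    move=> pw; have ge0 (r : 'I_M) : addable w r -> 0 <= deg 1 (add_box w r) -
        \sum_(s < M | removable (add_box w r) s) deg 0 (rem_box (add_box w r) s).
      by move=> ad; rewrite subr_ge0 deg_rem_le //; apply: wpart_add.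
    have : \sum_(r < M | addable w r) (deg 1 (add_box w r) -
        \sum_(s < M | removable (add_box w r) s) deg 0 (rem_box (add_box w r) s)) == 0.
      by rewrite eq_le step //= sumr_ge0.
    by rewrite psumr_eq0 // => /allP z r ad; have := z r (mem_index_enum _); rewrite ad /= subr_eq0 => /eqP.
  split=> w pw.
    have [r lt_r rem] := ex_removable pw.
    have := eq0 _ (wpart_rem pw lt_r rem) (Ordinal lt_r) (rem_addable pw rem).
    by rewrite /= (rem_boxK pw).
  rewrite (eq_bigr _ (eq0 w pw)) (up_down _ pw lt_n) [\sum_(s < M | removable w s) _]big1 ?addr0 ?mul1r //.
  by move=> s; rewrite (base w pw).
have [IHrem IHadd] := IH (ltnW lt_n).
have ud w : wpart M n.+1 w ->
    \sum_(r < M | addable w r) \sum_(s < M | removable (add_box w r) s) deg n.+1 (rem_box (add_box w r) s)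
    = n.+2%:R * deg n.+1 w.
  move=> pw; rewrite (up_down _ pw lt_n) (eq_bigr (fun s : 'I_M => n.+1%:R * deg n (rem_box w s))).
    by rewrite -mulr_sumr IHrem // -[n.+2%:R]nat1r mulrDl mul1r.
  by move=> s rem; rewrite IHadd //; apply: wpart_rem.
have eq0 w : wpart M n.+1 w -> forall r : 'I_M, addable w r -> deg n.+2 (add_box w r) =
      \sum_(s < M | removable (add_box w r) s) deg n.+1 (rem_box (add_box w r) s).
  move=> pw; have ge0 (r : 'I_M) : addable w r -> 0 <= deg n.+2 (add_box w r) -
      \sum_(s < M | removable (add_box w r) s) deg n.+1 (rem_box (add_box w r) s).
    by move=> ad; rewrite subr_ge0 deg_rem_le //; apply: wpart_add.
  have : \sum_(r < M | addable w r) (deg n.+2 (add_box w r) -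
      \sum_(s < M | removable (add_box w r) s) deg n.+1 (rem_box (add_box w r) s)) == 0.
    rewrite eq_le [0 <= _]sumr_ge0 // andbT sumrB (ud w pw) subr_le0.
    exact: deg_add_le.
  by rewrite psumr_eq0 // => /allP z r ad; have := z r (mem_index_enum _); rewrite ad /= subr_eq0 => /eqP.
split=> w pw.
  have [r lt_r rem] := ex_removable pw.
  have := eq0 _ (wpart_rem pw lt_r rem) (Ordinal lt_r) (rem_addable pw rem).
  by rewrite /= (rem_boxK pw).
by rewrite (eq_bigr _ (eq0 w pw)) ud.
Qed.

(** The difference is a character by [lift_sub_char], of dimension 0. *)
Theorem branching n w : (n < M)%N -> wpart M n.+1 w ->
  cfLift (specht_char n.+1 w) = rem_sum n w.
Proof.
move=> lt_n pw; apply/eqP; rewrite -subr_eq0 -char1_eq0 ?lift_sub_char //.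
rewrite !cfunE cfLiftE sum_cfunE /emb lift_perm1 subr_eq0.
by have [-> //] := deg_rem_add lt_n.
Qed.

End Branching.

(** * Transpositions, contents and cycles *)

Section Transpositions.
Variables (n : nat) (w : seq nat).
Hypothesis wn : sumn w = n.
Let T := reshape_tableau wn.
Let N : algC := (gcard [set: 'S_n]%G)%:R.
Let aG := regular_repr algC [set: 'S_n]%G.

(** This is n plus twice the sum of the contents: a box (r, c) has c boxes before
    it in its row and r in its column. *)
Definition pair_content : algC :=
  \sum_(i < n) \sum_(j < n) ((reshape_index w i == reshape_index w j)%:R
     - (reshape_offset w i == reshape_offset w j)%:R + (i == j)%:R).

Let Z : 'M[algC]_(gcard [set: 'S_n]%G) := \sum_(i < n) \sum_(j < n) aG (tperm i j).

Let Z_gring : in_gring Z.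
Proof. by do 2?[apply: in_gring_sum => ? _]; exact: in_gring_reg. Qed.

Let Z_central g : Z *m aG g = aG g *m Z.
Proof.
rewrite /Z mulmx_suml mulmx_sumr [RHS](reindex_inj (@perm_inj _ g)) /=.
apply: eq_bigr => i _; rewrite mulmx_suml mulmx_sumr [RHS](reindex_inj (@perm_inj _ g)) /=.
apply: eq_bigr => j _; rewrite -tpermJ conjgE.
by rewrite [LHS]regM [RHS]regM mulKVg.
Qed.

(** A transposition is absorbed by the row group or, with a sign, by the column
    group; one that exchanges boxes in different rows and columns is not a
    product p q. *)
Let tr_young_tperm (i j : 'I_n) : \tr (young n w *m aG (tperm i j)) =
  N * ((reshape_index w i == reshape_index w j)%:R
     - (reshape_offset w i == reshape_offset w j)%:R + (i == j)%:R).
Proof.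
have [<-|ne_ij] := eqVneq i j.
  by rewrite tperm1 reg1 mulmx1 [LHS](tr_young T) !eqxx subrr add0r mulr1.
rewrite addr0.
have [eR|neR] := eqVneq (reshape_index w i) (reshape_index w j).
  have neC : reshape_offset w i != reshape_offset w j.
    by apply: contraNneq ne_ij => eC; apply/eqP/(tab_inj T).
  rewrite (negPf neC) subr0 mulr1 mxtrace_mulC mulmxA.
  rewrite (rsumMl (f := id)) //; first exact: (tr_young T).
  by apply/fiber_stabP => k; case: tpermP => // ->.
have [eC|neC] := eqVneq (reshape_offset w i) (reshape_offset w j).
  rewrite -mulmxA (csumMr (f := id)) //; last by apply/fiber_stabP => k; case: tpermP => // ->.
  by rewrite sgn_tperm // scaleN1r mulmxN [LHS]raddfN [X in - X](tr_young T) sub0r mulrN1.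
rewrite subrr mulr0 /young /rsum !mulmx_suml raddf_sum big1 // => p /fiber_stabP Pp.
rewrite /csum mulmx_sumr mulmx_suml raddf_sum big1 // => q /fiber_stabP Qq.
rewrite -scalemxAr -scalemxAl [LHS]mxtraceZ !regM tr_reg.
case: eqP => [e|]; rewrite ?mulr0 //; exfalso.
have tE : (p * q = tperm i j)%g by rewrite -[RHS]mul1g -e -!mulgA tperm2 mulg1.
have tk k : q (p k) = tperm i j k by rewrite -tE permM.
have pfix k : k != i -> k != j -> p k = k.
  move=> ki kj; apply: (tab_inj T); rewrite ?Pp //.
  by rewrite -(Qq (p k)) tk tpermD // eq_sym.
have pi : p i = i \/ p i = j.
  case: (eqVneq (p i) i) => [|nei]; first by left.
  case: (eqVneq (p i) j) => [|nej]; first by right.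
  by have := pfix _ nei nej => /perm_inj e'; rewrite e' eqxx in nei.
case: pi => [pi|pi]; last by have := Pp i; rewrite pi => e'; rewrite e' eqxx in neR.
by have := Qq i; rewrite -{1}pi tk tpermL => e'; rewrite e' eqxx in neC.
Qed.

(** The sum of all transpositions is central, hence acts by a scalar, which is
    found by taking the trace against the Young symmetrizer. *)
Lemma specht_transpositions g :
  \sum_(i < n) \sum_(j < n) specht_char n w (tperm i j * g)%g =
  pair_content * specht_char n w g.
Proof.
have [h h0 [cc chiE chiE']] := specht_charE' wn; set c := young n w in cc chiE chiE'.
have hn0 : h != 0 by rewrite gt_eqF.
have N0 : N != 0 := N_neq0 _.
have [k kE] : exists k, c *m Z *m c = k *: c.
  have [|k e] := sandwich T (M := csum id (colf w) *m Z *m rsum id (rowf w)).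
    by do 2?[apply: in_gringM => //]; [exact: csum_gring | exact: rsum_gring].
  by exists k; rewrite -e /c /young !mulmxA.
have Zc : Z *m c = c *m Z.
  case: (young_gring n w) => f cE; rewrite /c cE mulmx_sumr mulmx_suml; apply: eq_bigr => x _.
  by rewrite -scalemxAr -scalemxAl Z_central.
have cZ : c *m Z = (k / h) *: c.
  apply: (scalerI hn0); rewrite scalerA mulrCA mulfV // mulr1 -kE -mulmxA Zc mulmxA cc.
  by rewrite scalemxAl.
have kh : k / h = pair_content.
  apply: (mulfI N0); transitivity (\tr (c *m Z)).
    by rewrite cZ mxtraceZ [\tr c](tr_young T) mulrC.
  rewrite /Z mulmx_sumr raddf_sum /pair_content mulr_sumr; apply: eq_bigr => i _ /=.
  rewrite mulmx_sumr raddf_sum mulr_sumr; apply: eq_bigr => j _ /=.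
  exact: tr_young_tperm.
rewrite chiE' mulrCA -kh -conj_formZl -cZ.
transitivity ((N * h)^-1 * conj_form c (Z *m aG g)).
  rewrite /Z mulmx_suml conj_form_sumr mulr_sumr; apply: eq_bigr => i _.
  rewrite mulmx_suml conj_form_sumr mulr_sumr; apply: eq_bigr => j _.
  by rewrite chiE' regM.
congr (_ * _); rewrite !conj_formE; apply: eq_bigr => x _.
by rewrite -!mulmxA (mulmxA (aG x) Z) -Z_central -!mulmxA.
Qed.

End Transpositions.

Section ContentStep.
Variables (M n : nat) (w : seq nat).
Hypotheses (lt_n : (n < M)%N) (pw : wpart M n.+1 w).
Let wn := wpart_sum pw.

Lemma big_ord_lift (V : nmodType) m (j : 'I_m.+1) (F : 'I_m.+1 -> V) :
  \sum_i F i = F j + \sum_(i < m) F (lift j i).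
Proof. by rewrite (bigD1_ord j). Qed.

Lemma pair_content_corner r : (r < M)%N -> removable w r ->
  pair_content n.+1 w = pair_content n (rem_box w r) + 1
    + 2%:R * ((nth 0%N w r)%:R - 1 - r%:R).
Proof.
move=> lt_r rem; set j := corner pw lt_r rem.
have T := reshape_tableau wn.
have [F FE] : exists F : 'I_n.+1 -> 'I_n.+1 -> algC, forall a b,
    F a b = (reshape_index w a == reshape_index w b)%:R
     - (reshape_offset w a == reshape_offset w b)%:R + (a == b)%:R.
  by eexists => a b; reflexivity.
have Fsym a b : F a b = F b a.
  by rewrite !FE ![_ == reshape_index w b]eq_sym ![_ == reshape_offset w b]eq_sym [b == a]eq_sym.
have -> : pair_content n.+1 w = F j j + \sum_(a < n) F j (lift j a)
    + \sum_(a < n) (F j (lift j a) + \sum_(b < n) F (lift j a) (lift j b)).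
  transitivity (\sum_a \sum_b F a b).
    by apply: eq_bigr => a _; apply: eq_bigr => b _; rewrite FE.
  rewrite (big_ord_lift j); congr (_ + _); first by rewrite (big_ord_lift j).
  by apply: eq_bigr => a _; rewrite (big_ord_lift j) [F (lift j a) j]Fsym.
rewrite big_split /=.
have -> : \sum_(a < n) \sum_(b < n) F (lift j a) (lift j b) = pair_content n (rem_box w r).
  apply: eq_bigr => a _; apply: eq_bigr => b _.
  by rewrite FE !reshape_index_corner !reshape_offset_corner (inj_eq lift_inj).
suff -> : \sum_(a < n) F j (lift j a) = (nth 0%N w r)%:R - 1 - r%:R.
  by rewrite FE !eqxx /=; ring.
have e := big_ord_lift j (F j).
have {}e : \sum_(a < n) F j (lift j a) = \sum_a F j a - F j j by rewrite e addrC addrK.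
rewrite e (eq_bigr _ (fun a _ => FE j a)) !big_split /= sumrN.
have R1 : \sum_(a < n.+1) ((reshape_index w j == reshape_index w a)%:R : algC) = (nth 0%N w r)%:R.
  rewrite corner_row -natr_sum; congr _%:R; rewrite -[RHS]minnn -(tab_row_card r _ T) -sum1_card.
  rewrite [RHS]big_mkcond; apply: eq_bigr => a _; rewrite inE eq_sym.
  by case: eqP => //= <-; rewrite (tab_lt T).
have C1 : \sum_(a < n.+1) ((reshape_offset w j == reshape_offset w a)%:R : algC) = r.+1%:R.
  rewrite corner_col -natr_sum; congr _%:R; set c := (nth 0%N w r).-1.
  have rowB (i : 'I_n.+1) : (reshape_index w i < M)%N.
    by rewrite -(wpart_size pw); apply: reshape_indexP; rewrite wn.
  have le_c s : #|[set i : 'I_n.+1 | (reshape_offset w i < s)%N]| = (\sum_(q < M) minn (nth 0%N w q) s)%N.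
    by rewrite (sum_row_card _ rowB); apply: eq_bigr => q _; rewrite (tab_row_card _ _ T).
  have : #|[set i : 'I_n.+1 | (reshape_offset w i < c.+1)%N]| =
     (#|[set i : 'I_n.+1 | (reshape_offset w i < c)%N]| + \sum_(a < n.+1) (c == reshape_offset w a))%N.
    rewrite -!sum1_card [LHS]big_mkcond [in RHS]big_mkcond -big_split /=.
    by apply: eq_bigr => a _; rewrite !inE ltnS leq_eqVlt; case: ltngtP.
  have -> : #|[set i : 'I_n.+1 | (reshape_offset w i < c.+1)%N]| =
     (#|[set i : 'I_n.+1 | (reshape_offset w i < c)%N]| + r.+1)%N.
    rewrite !le_c; have -> : (r.+1 = \sum_(q < M) (q <= r))%N.
      rewrite -(big_mkord xpredT (fun q => (q <= r)%N : nat)) (big_cat_nat _ (n := r.+1)) //=.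
      rewrite [X in (_ + X)%N]big_nat_cond [X in (_ + X)%N]big1 ?addn0; last first.
        by move=> q /andP[/andP[lt _] _]; rewrite leqNgt lt.
      rewrite big_nat_cond (eq_bigr (fun=> 1%N)) => [|q /andP[/andP[_ lt] _]]; last first.
        by rewrite -ltnS lt.
      by rewrite -big_nat_cond sum_nat_const_nat subn0 muln1.
    rewrite -big_split /=; apply: eq_bigr => q _.
    have rem' : (nth 0 w r.+1 < nth 0 w r)%N := rem.
    case: (leqP q r) => [le|lt].
      by have := wpart_le pw le; rewrite /c; lia.
    by have := wpart_le pw lt; rewrite /c; lia.
  by move/addnI => <-.
have E1 : \sum_(a < n.+1) ((j == a)%:R : algC) = 1.
  by rewrite (bigD1 j) //= eqxx big1 ?addr0 // => a ne; rewrite eq_sym (negPf ne).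
by rewrite R1 C1 E1 FE !eqxx -natr1 /=; ring.
Qed.

(** The Jucys-Murphy element of the last point is, up to an additive constant, half
    of the difference of the sums of all transpositions of degrees n + 1 and n; it
    acts on the component of
    shape w minus a corner by the content of that corner. *)
Lemma content_step g :
  \sum_(i < n) specht_char n.+1 w (tperm (lift ord_max i) ord_max * emb g)%g =
  \sum_(r < M | removable w r) ((nth 0%N w r)%:R - 1 - r%:R) * specht_char n (rem_box w r) g.
Proof.
have br h : specht_char n.+1 w (emb h) = \sum_(r < M | removable w r) specht_char n (rem_box w r) h.
  by rewrite -cfLiftE (branching lt_n pw) sum_cfunE.
set S := LHS; set X := RHS.
have := specht_transpositions wn (emb g).
rewrite (big_ord_lift ord_max) (big_ord_lift ord_max) tperm1 mul1g.
under [X in _ + X = _]eq_bigr do rewrite (big_ord_lift ord_max).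
rewrite big_split /= -/S.
have -> : \sum_(i < n) specht_char n.+1 w (tperm ord_max (lift ord_max i) * emb g)%g = S.
  by apply: eq_bigr => i _; rewrite tpermC.
have -> : \sum_(i < n) \sum_(j < n) specht_char n.+1 w
     (tperm (lift ord_max i) (lift ord_max j) * emb g)%g =
   \sum_(r < M | removable w r) pair_content n (rem_box w r) * specht_char n (rem_box w r) g.
  transitivity (\sum_(i < n) \sum_(j < n) \sum_(r < M | removable w r)
      specht_char n (rem_box w r) (tperm i j * g)%g).
    apply: eq_bigr => i _; apply: eq_bigr => j _; rewrite -br embM; congr (specht_char _ _ (_ * _)%g).
    apply/permP => k; case: (unliftP ord_max k) => [k' ->|->].
      rewrite lift_perm_lift; case: (tpermP i j k') => [->|->|/eqP ni /eqP nj].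
      - by rewrite tpermL.
      - by rewrite tpermR.
      by rewrite tpermD // (inj_eq lift_inj) eq_sym.
    by rewrite lift_perm_id tpermD // eq_sym neq_lift.
  rewrite (eq_bigr _ (fun i _ => exchange_big _ _ _ _ _ _)) /= exchange_big /=.
  apply: eq_bigr => r rem; apply: specht_transpositions.
  exact: wpart_sum (wpart_rem pw (ltn_ord r) rem).
rewrite !br mulr_sumr => e.
have : 2%:R * S = 2%:R * X.
  transitivity (\sum_(r < M | removable w r) (pair_content n.+1 w - pair_content n (rem_box w r) - 1)
     * specht_char n (rem_box w r) g).
    under eq_bigr do rewrite !mulrBl mul1r; rewrite !sumrB -e; ring.
  rewrite /X mulr_sumr; apply: eq_bigr => r rem.
  by rewrite (pair_content_corner (ltn_ord r) rem); ring.
by apply: mulfI; rewrite pnatr_eq0.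
Qed.

End ContentStep.

(** ** Cycles *)

Fixpoint full_cycle n : 'S_n.+1 :=
  if n is n'.+1 then (tperm (lift ord_max ord0) ord_max * emb (full_cycle n'))%g else 1%g.

Lemma emb_lift n (g : 'S_n) i : emb g (lift ord_max i) = lift ord_max (g i).
Proof. exact: lift_perm_lift. Qed.

Lemma emb_max n (g : 'S_n) : emb g ord_max = ord_max.
Proof. exact: lift_perm_id. Qed.

Lemma full_cycle_trans n (i : 'I_n.+1) : exists e, i = (full_cycle n ^+ e)%g ord0.
Proof.
elim: n i => [|n IH] i; first by exists 0%N; rewrite expg0 perm1 [i]ord1.
have l0 : lift ord_max ord0 = ord0 :> 'I_n.+2 by apply: val_inj.
set f := full_cycle n.+1; set c := full_cycle n in IH.
have fl y : y != ord0 -> f (lift ord_max y) = lift ord_max (c y).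
  by move=> y0; rewrite permM tpermD ?emb_lift ?neq_lift // (inj_eq lift_inj) eq_sym.
have f0 : f ord0 = ord_max by rewrite permM -l0 tpermL emb_max.
have fmax : f ord_max = lift ord_max (c ord0) by rewrite permM tpermR emb_lift.
have orb e : exists e', lift ord_max ((c ^+ e)%g ord0) = (f ^+ e')%g ord0.
  elim: e => [|e [e' IHe]]; first by exists 0%N; rewrite !perm1.
  have [z|nz] := eqVneq ((c ^+ e)%g ord0) ord0.
    by exists 2%N; rewrite [in LHS]expgSr [in LHS]permM z -fmax expgS expg1 [RHS]permM f0.
  exists e'.+1; rewrite [in LHS]expgSr [in LHS]permM -fl // IHe.
  by rewrite [in RHS]expgSr [RHS]permM.
case: (unliftP ord_max i) => [i' ->|->].
  by have [e ->] := IH i'; exact: orb.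
by exists 1%N; rewrite expg1 f0.
Qed.

(** A cycle of length k + 1 with d fixed points. *)
Fixpoint kcycle k d : 'S_(d + k.+1) :=
  if d is d'.+1 then emb (kcycle k d') else full_cycle k.

(** All the products of a transposition (i, n + 1) with an n-cycle on the other
    points are conjugate (n + 1)-cycles. *)
Lemma full_cycle_step M n w : (n.+1 < M)%N -> wpart M n.+2 w ->
  n.+1%:R * specht_char n.+2 w (full_cycle n.+1) =
  \sum_(r < M | removable w r) ((nth 0%N w r)%:R - 1 - r%:R) * specht_char n.+1 (rem_box w r) (full_cycle n).
Proof.
move=> lt_n pw; rewrite -(content_step lt_n pw).
rewrite (eq_bigr (fun=> specht_char n.+2 w (full_cycle n.+1))) => [|i _].
  by rewrite sumr_const card_ord mulr_natl.
have [e ->] := full_cycle_trans i; set c := full_cycle n.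
have ce : (emb c ^+ e)%g = emb (c ^+ e).
  by elim: (e) => [|e' IH]; rewrite ?expg0 /emb ?lift_perm1 // !expgSr IH -embM.
rewrite -[RHS](cfunJ _ _ (in_setT (emb c ^+ e)%g)) /= conjMg tpermJ -/c.
congr (specht_char _ _ (tperm _ _ * _)%g).
- by rewrite ce emb_lift.
- by rewrite ce emb_max.
by rewrite conjgE -expgS expgSr mulKg.
Qed.

Lemma porbit_kcycle k d : exists x, #|porbit (kcycle k d) x| = k.+1 /\
  forall y, y \notin porbit (kcycle k d) x -> kcycle k d y = y.
Proof.
elim: d => [|d [x [cx fx]]].
  have full x : x \in porbit (full_cycle k) ord0.
    by have [e ->] := full_cycle_trans x; apply/porbitP; exists e.
  exists ord0; split=> [|y]; last by rewrite full.
  by rewrite -[RHS]card_ord -cardsT; congr #|pred_of_set _|; apply/setP => x; rewrite inE full.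
have ce e : (emb (kcycle k d) ^+ e)%g = emb (kcycle k d ^+ e).
  by elim: e => [|e' IH]; rewrite ?expg0 /emb ?lift_perm1 // !expgSr IH -embM.
have orb : porbit (kcycle k d.+1) (lift ord_max x) = [set lift ord_max y | y in porbit (kcycle k d) x].
  apply/setP => z; apply/porbitP/imsetP => [[e ->]|[y /porbitP[e ->] ->]].
    by exists ((kcycle k d ^+ e)%g x); [apply/porbitP; exists e | rewrite /= ce emb_lift].
  by exists e; rewrite /= ce emb_lift.
exists (lift ord_max x); split; first by rewrite orb card_imset //; exact: lift_inj.
move=> y; rewrite orb /=; case: (unliftP ord_max y) => [y' ->|->]; last by rewrite emb_max.
by rewrite (mem_imset _ _ lift_inj) emb_lift => /fx ->.
Qed.

Lemma kcycle_type k d : has_cycle_type (kcycle k d) (k.+1 :: nseq d 1%N).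
Proof.
have [x [cx fx]] := porbit_kcycle k d; set g := kcycle k d in cx fx *.
rewrite /has_cycle_type.
have memx : porbit g x \in enum (porbits g) by rewrite mem_enum imset_f.
have := perm_to_rem memx => /(perm_map (fun C : {set 'I_(d + k.+1)} => #|C|)) /= pe.
apply: (perm_trans pe); rewrite cx perm_cons.
have all1 : all (pred1 1%N) [seq #|C| | C : {set 'I_(d + k.+1)} <- rem (porbit g x) (enum (porbits g))].
  apply/allP => m /mapP[C Cin ->]; move: Cin.
  rewrite mem_rem_uniq ?enum_uniq // inE mem_enum => /andP[neC /imsetP[y _ eC]] /=.
  have ny : y \notin porbit g x.
    by apply: contra neC => yx; rewrite eC eq_porbit_mem.
  rewrite eC; apply/eqP; rewrite -[RHS](cards1 y); congr #|pred_of_set _|.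
  apply/setP => z; rewrite inE; apply/porbitP/eqP => [[e ->]|->]; last by exists 0%N; rewrite perm1.
  by elim: e => [|e IH]; rewrite ?perm1 // expgSr permM IH fx.
have /eqP sumC : (\sum_(C in porbits g) #|C| == d + k.+1)%N.
  have -> : porbits g = preim_partition (porbit g) [set: 'I_(d + k.+1)].
    apply/setP => C; apply/imsetP/imsetP => -[y _ ->]; exists y; rewrite ?inE //;
      by apply/setP => z; rewrite !inE eq_sym eq_porbit_mem.
  by rewrite -(card_partition (preim_partitionP _ _)) cardsT card_ord.
have /all_pred1P sE := all1.
suff ss : size [seq #|C| | C : {set 'I_(d + k.+1)} <- rem (porbit g x) (enum (porbits g))] = d.
  by rewrite sE ss perm_refl.
move: sumC; rewrite -big_enum /= (perm_big _ (perm_to_rem memx)) big_cons /= cx.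
rewrite -(big_map (fun C : {set _} => #|C|) xpredT id) -sumnE sE.
by rewrite sumn_nseq mul1n size_nseq; lia.
Qed.

(** * Frobenius' formula for the values on a cycle *)

Section FrobeniusDet.
Variable M : nat.
Implicit Types (l : 'I_M -> int).

(** With the value 0 at negative integers, 1 / (z - 1)! = z / z! holds for all z. *)
Definition inv_fact (z : int) : algC := if z is Posz m then (m`!%:R)^-1 else 0.

Lemma inv_fact_pred (z : int) : inv_fact (z - 1) = z%:~R * inv_fact z.
Proof.
case: z => [[|m]|m]; first by rewrite mul0r.
  rewrite (_ : m.+1%:Z - 1 = m%:Z); last by lia.
  rewrite /= factS natrM invfM mulrA mulfV ?mul1r //.
  by rewrite -[m.+1%:~R]/(m.+1%:R) pnatr_eq0.
by rewrite mulr0.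
Qed.

(** Up to a sign, n! [fdet l] is the dimension of the representation with
    beta-numbers l; it is extended to arbitrary integers. *)
Definition fdet l : algC := \det (\matrix_(i, j < M) inv_fact (l i - (j : nat)%:Z)).

Definition lower (k : nat) (i : 'I_M) l : 'I_M -> int :=
  fun j => l j - (if j == i then k%:Z else 0).

(** The number of boxes, when l are beta-numbers. *)
Definition excess l : int := \sum_i l i - \sum_(i < M) (i : nat)%:Z.

Lemma excess_lower k i l : excess (lower k i l) = excess l - k%:Z.
Proof.
rewrite /excess /lower sumrB.
have -> : \sum_(j < M) (if j == i then k%:Z else 0) = k%:Z by rewrite -big_mkcond big_pred1_eq.
by ring.
Qed.

Lemma sum_perm_ord (s : 'S_M) : \sum_i (s i : nat)%:Z = \sum_(i < M) (i : nat)%:Z.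
Proof. by rewrite [RHS](reindex_inj (@perm_inj _ s)). Qed.

(** On determinants this is the rule n f = sum of f over the smaller partitions. *)
Lemma fdet_lower1 l : \sum_i fdet (lower 1 i l) = (excess l)%:~R * fdet l.
Proof.
rewrite /fdet /determinant exchange_big mulr_sumr; apply: eq_bigr => s _ /=.
have term i : (-1) ^+ s * \prod_j (\matrix_(a, b < M) inv_fact (lower 1 i l a - (b : nat)%:Z)) j (s j) =
   (l i - (s i : nat)%:Z)%:~R * ((-1) ^+ s * \prod_j inv_fact (l j - (s j : nat)%:Z)).
  rewrite (bigD1 i) //= [in RHS](bigD1 i) //= mxE /lower eqxx.
  rewrite (eq_bigr (fun j => inv_fact (l j - (s j : nat)%:Z))) => [|j /negPf ne]; last first.
    by rewrite mxE ne subr0.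
  have -> : l i - 1%:Z - (s i : nat)%:Z = (l i - (s i : nat)%:Z) - 1 by ring.
  by rewrite inv_fact_pred -[X in _ * X = _]mulrA [LHS]mulrCA.
rewrite (eq_bigr _ (fun i _ => term i)) -mulr_suml; congr (_ * _).
  rewrite -rmorph_sum /=; congr _%:~R; rewrite sumrB; congr (_ - _).
  exact: sum_perm_ord.
by congr (_ * _); apply: eq_bigr => j _; rewrite mxE.
Qed.

Lemma eq_fdet l l' : l =1 l' -> fdet l = fdet l'.
Proof. by move=> e; rewrite /fdet; congr determinant; apply/matrixP => i j; rewrite !mxE e. Qed.

Lemma fdet_alt l i j : i != j -> l i = l j -> fdet l = 0.
Proof.
by move=> ne e; apply: (determinant_alternate ne) => k; rewrite !mxE e.
Qed.

Lemma fdet_neg l i : l i < 0 -> fdet l = 0.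
Proof.
move=> neg; rewrite /fdet (expand_det_row _ i) big1 // => j _; rewrite mxE.
have : l i - (j : nat)%:Z < 0 by lia.
by case: (l i - _) => // m _; rewrite mul0r.
Qed.

Lemma fdet_swap l a b : a != b -> fdet (l \o tperm a b) = - fdet l.
Proof.
move=> ne; rewrite /fdet.
have -> : \matrix_(i, j < M) inv_fact ((l \o tperm a b) i - (j : nat)%:Z) =
   row_perm (tperm a b) (\matrix_(i, j < M) inv_fact (l i - (j : nat)%:Z)).
  by apply/matrixP => i j; rewrite !mxE.
by rewrite row_permE det_mulmx det_perm odd_tperm ne expr1 mulN1r.
Qed.

Lemma lower_swap k l a b : l a = l b -> lower k b l =1 lower k a l \o tperm a b.
Proof.
move=> e j; rewrite /lower /=; case: tpermP => [->|->|/eqP na /eqP nb].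
- by rewrite e [a == b]eq_sym.
- by rewrite !eqxx e.
- by rewrite (negPf na) (negPf nb).
Qed.

Lemma lowerC k k' i i' l : lower k i (lower k' i' l) =1 lower k' i' (lower k i l).
Proof. by move=> j; rewrite /lower addrAC. Qed.

(** Up to a sign, d! times this sum is the value on a k-cycle with d fixed points. *)
Definition fcyc k l : algC := \sum_i fdet (lower k i l).

Lemma fcyc_alt k l a b : a != b -> l a = l b -> fcyc k l = 0.
Proof.
move=> ne e; rewrite /fcyc (bigD1 a) //= (bigD1 b) /=; last by rewrite eq_sym.
rewrite big1 => [|i /andP[na nb]].
  by rewrite (eq_fdet (lower_swap k e)) fdet_swap // addr0 subrr.
by apply: (fdet_alt ne); rewrite /lower [a == i]eq_sym [b == i]eq_sym (negPf na) (negPf nb) e.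
Qed.

Lemma fcyc_neg k l a : l a < 0 -> fcyc k l = 0.
Proof.
move=> neg; rewrite /fcyc big1 // => i _; apply: (@fdet_neg _ a); rewrite /lower.
by case: ifP; lia.
Qed.

Lemma fcyc_lower1 k l : \sum_j fcyc k (lower 1 j l) = (excess l - k%:Z)%:~R * fcyc k l.
Proof.
rewrite /fcyc exchange_big mulr_sumr; apply: eq_bigr => i _ /=.
rewrite -(excess_lower k i) -fdet_lower1; apply: eq_bigr => j _.
exact/eq_fdet/lowerC.
Qed.

(** If two entries of l coincide, the terms cancel in pairs. Otherwise, a nonzero
    term has its lowered sequence equal to a permutation of 0, ..., M - 1, and l_j
    can only be M, where the weight vanishes. *)
Lemma fdet_weighted l : excess l = 1 ->
  \sum_j (l j - M%:Z)%:~R * fdet (lower 1 j l) = 0.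
Proof.
move=> e1.
have [/injectiveP inj|/injectivePn[a [b ne e]]] := boolP (injectiveb l); last first.
  rewrite (bigD1 a) //= (bigD1 b) /=; last by rewrite eq_sym.
  rewrite big1 => [|i /andP[na nb]].
    by rewrite (eq_fdet (lower_swap 1 e)) fdet_swap // e mulrN addr0 subrr.
  rewrite (@fdet_alt _ a b) ?mulr0 // /lower.
  by rewrite [a == i]eq_sym [b == i]eq_sym (negPf na) (negPf nb) e.
apply: big1 => j _; have [->|nz] := eqVneq (fdet (lower 1 j l)) 0; first by rewrite mulr0.
have [s nzs] : exists s : 'S_M, \prod_i inv_fact (lower 1 j l i - (s i : nat)%:Z) != 0.
  apply/existsP; apply: contraR nz => /existsPn z; rewrite /fdet /determinant big1 // => s _.
  rewrite (eq_bigr (fun i => inv_fact (lower 1 j l i - (s i : nat)%:Z))) => [|i _]; last by rewrite mxE.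
  by have /negPn/eqP-> := z s; rewrite mulr0.
have ge0 i : 0 <= lower 1 j l i - (s i : nat)%:Z.
  rewrite leNgt; apply: contra nzs => neg; rewrite (bigD1 i) //= mulf_eq0.
  by case: (_ - _) neg => // m _; rewrite eqxx.
have eq0 i : lower 1 j l i = (s i : nat)%:Z.
  have : \sum_i (lower 1 j l i - (s i : nat)%:Z) == 0.
    have := excess_lower 1 j l; rewrite e1 subrr /excess => e0.
    by rewrite sumrB sum_perm_ord e0.
  rewrite psumr_eq0 // => /allP/(_ i (mem_index_enum _)) /=.
  by rewrite subr_eq0 => /eqP.
have lj : l j = (s j).+1%:Z by have := eq0 j; rewrite /lower eqxx; lia.
case: (ltnP (s j).+1 M) => [lt|le]; last first.
  have : (s j).+1 = M by apply/eqP; rewrite eqn_leq le ltn_ord.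
  by rewrite lj => ->; rewrite subrr mul0r.
pose i := (s^-1)%g (Ordinal lt).
have si : s i = Ordinal lt by rewrite permKV.
have ne : i != j.
  by apply/eqP => e; have := congr1 val si; rewrite /= e; lia.
case/eqP: ne; apply: inj; rewrite lj; have := eq0 i.
rewrite /lower si; case: eqP => [e|_]; last by rewrite subr0.
by have := congr1 val si; rewrite /= e; lia.
Qed.

(** The counterpart of [full_cycle_step] for the determinants: l_j - M is the
    content of the last box of row j. *)
Lemma fcyc_full k l : excess l = k.+1%:Z ->
  k%:R * fcyc k.+1 l = \sum_j (l j - M%:Z)%:~R * fcyc k (lower 1 j l).
Proof.
move=> el; have -> : \sum_j (l j - M%:Z)%:~R * fcyc k (lower 1 j l) =
   \sum_i \sum_j ((lower k i l j - M%:Z)%:~R + (if j == i then k%:R else 0))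
     * fdet (lower 1 j (lower k i l)).
  rewrite exchange_big; apply: eq_bigr => j _; rewrite /fcyc mulr_sumr; apply: eq_bigr => i _ /=.
  rewrite (eq_fdet (lowerC k 1 i j l)); congr (_ * _); rewrite /lower.
  by case: eqP => _; rewrite ?subr0 ?addr0 // !rmorphB /=; ring.
rewrite /fcyc mulr_sumr; apply: eq_bigr => i _.
under eq_bigr do rewrite mulrDl.
rewrite big_split /= fdet_weighted ?add0r; last first.
  by rewrite excess_lower el; lia.
rewrite (bigD1 i) //= eqxx big1 ?addr0 => [|j /negPf->]; last by rewrite mul0r.
congr (_ * _); apply: eq_fdet => j; rewrite /lower; case: eqP => _; rewrite ?subr0 //; lia.
Qed.

End FrobeniusDet.

(** ** Characters in terms of determinants *)

Section CycleCharacter.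
Variable M : nat.

(** Beta-numbers of a partition with M rows. *)
Definition beta_num (w : seq nat) : 'I_M -> int := fun i => (nth 0%N w i + (M - i.+1))%:Z.

Lemma excess_beta n w : wpart M n w -> excess (beta_num w) = n%:Z.
Proof.
move=> pw; rewrite /excess /beta_num.
under eq_bigr do rewrite PoszD.
rewrite big_split /= -addrA (reindex_inj rev_ord_inj) [X in _ + (X + _)](reindex_inj rev_ord_inj) /=.
rewrite [X in _ + (X - _)](eq_bigr (fun i : 'I_M => (i : nat)%:Z)) => [|i _]; last by congr Posz; have := ltn_ord i; lia.
rewrite subrr addr0 -(wpart_sum pw) (sumn_ord (wpart_size pw)) [in RHS](reindex_inj rev_ord_inj) /=.
by rewrite -[RHS]/(_%:Z) (big_morph Posz PoszD erefl).
Qed.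

Lemma beta_rem w r (lt_r : (r < M)%N) : removable w r ->
  beta_num (rem_box w r) =1 lower 1 (Ordinal lt_r) (beta_num w).
Proof.
move=> rem j; rewrite /beta_num /lower nth_rem_box -val_eqE /=.
by case: eqP => [->|_]; rewrite /removable in rem; lia.
Qed.

(** Lowering a row that has no corner kills the functions [fdet] and [fcyc]: it
    makes two beta-numbers equal or the last one negative. *)
Lemma beta_not_removable n w (r : 'I_M) : wpart M n w -> ~~ removable w r ->
  (exists a b, [/\ a != b & lower 1 r (beta_num w) a = lower 1 r (beta_num w) b]) \/
  (exists a, lower 1 r (beta_num w) a < 0).
Proof.
move=> pw; rewrite /removable -leqNgt => le.
case: (ltnP r.+1 M) => [lt|ge].
  left; exists r, (Ordinal lt); split; first by rewrite -val_eqE /=; lia.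
  rewrite /lower eqxx -val_eqE /= [_.+1 == _](_ : _ = false); last by lia.
  by rewrite /beta_num /=; have := wpart_dec pw r; lia.
right; exists r; rewrite /lower eqxx /beta_num.
have : nth 0%N w r = 0%N by apply/eqP; rewrite -leqn0 (leq_trans le) // nth_default ?(wpart_size pw).
by lia.
Qed.

Definition fdet0 : algC := fdet (fun i : 'I_M => (M - i.+1)%:Z).

Lemma sum_removable n w (F : ('I_M -> int) -> algC) (c : nat -> algC) : wpart M n w ->
  (forall l l', l =1 l' -> F l = F l') ->
  (forall l a b, a != b -> l a = l b -> F l = 0) -> (forall l a, l a < 0 -> F l = 0) ->
  \sum_(r < M) c r * F (lower 1 r (beta_num w)) =
  \sum_(r < M | removable w r) c r * F (beta_num (rem_box w r)).
Proof.
move=> pw Fe Falt Fneg; rewrite [RHS]big_mkcond; apply: eq_bigr => r _.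
have [rem|nrem] := boolP (removable w r).
  congr (_ * _); symmetry; apply: Fe => j; rewrite (beta_rem (ltn_ord r) rem).
  by congr (lower _ _ _ _); apply: val_inj.
have [[a [b [ne e]]]|[a neg]] := beta_not_removable pw nrem.
  by rewrite (Falt _ a b) ?mulr0.
by rewrite (Fneg _ a) ?mulr0.
Qed.

(** Both sides satisfy the same recursion over the smaller partitions. *)
Lemma deg_fdet n w : (n <= M)%N -> wpart M n w ->
  fdet0 * deg n w = n`!%:R * fdet (beta_num w).
Proof.
elim: n w => [|n IH] w le_n pw.
  have -> : deg 0 w = 1.
    have := specht_irr (wpart_sum pw); rewrite irrEchar cfdotE => /andP[chiC /eqP].
    have c1 : #|[set: 'S_0]| = 1%N by rewrite cardsT card_Sn.
    rewrite c1 invr1 mul1r (big_pred1 1%g) => [|g]; last first.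
      by rewrite inE; apply/esym/eqP/permP => -[].
    rewrite conj_natr ?Cnat_char1 // -/(deg 0 w) => e.
    have d0 := deg_gt0 pw; apply/eqP; rewrite -(eqrXn2 (n := 2)) ?ler01 ?ltW //.
    by rewrite expr2 e expr1n.
  rewrite mulr1 mul1r; apply: eq_fdet => i; rewrite /beta_num.
  suff -> : nth 0%N w i = 0%N by [].
  have := sumn_ord (wpart_size pw); rewrite (wpart_sum pw) => /esym/eqP.
  by rewrite sum_nat_eq0 => /forallP/(_ i)/eqP.
have [remE _] := deg_rem_add le_n.
rewrite -remE // mulr_sumr.
rewrite (eq_bigr (fun r : 'I_M => n`!%:R * fdet (beta_num (rem_box w r)))); last first.
  by move=> r rem; rewrite (IH _ (ltnW le_n) (wpart_rem pw (ltn_ord r) rem)).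
rewrite -mulr_sumr factS mulnC natrM -mulrA; congr (_ * _).
have := sum_removable (F := @fdet M) (fun=> 1) pw (@eq_fdet M) (@fdet_alt M) (@fdet_neg M).
under eq_bigr do rewrite mul1r; under [RHS]eq_bigr do rewrite mul1r.
by move=> <-; rewrite fdet_lower1 (excess_beta pw).
Qed.

(** The branching rule reduces to a full cycle and [full_cycle_step] to a shorter
    one; the determinants satisfy the same recursions. *)
Lemma kcycle_fcyc k d w : (d + k.+1 <= M)%N -> wpart M (d + k.+1) w ->
  fdet0 * specht_char (d + k.+1) w (kcycle k d) = d`!%:R * fcyc k.+1 (beta_num w).
Proof.
have eq_fcyc j l l' : l =1 l' -> @fcyc M j l = fcyc j l'.
  by move=> e; apply: eq_bigr => i _; apply: eq_fdet => a; rewrite /lower e.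
elim: d w => [|d IHd] w.
  rewrite mul1r /=; elim: k w => [|k IHk] w le_n pw.
    rewrite [LHS](deg_fdet le_n pw) mul1r /fcyc fdet_lower1 (excess_beta pw).
    by rewrite mul1r.
  apply: (@mulfI _ k.+1%:R); first by rewrite pnatr_eq0.
  rewrite mulrCA (full_cycle_step le_n pw) mulr_sumr.
  rewrite (eq_bigr (fun r : 'I_M => ((nth 0%N w r)%:R - 1 - r%:R) * fcyc k.+1 (beta_num (rem_box w r)))); last first.
    by move=> r rem; rewrite mulrCA IHk ?(ltnW le_n) //; apply: wpart_rem.
  rewrite -(sum_removable (F := fcyc k.+1) (fun r => (nth 0%N w r)%:R - 1 - r%:R) pw
     (@eq_fcyc _) (@fcyc_alt M _) (@fcyc_neg M _)).
  rewrite (fcyc_full (excess_beta pw)); apply: eq_bigr => r _; congr (_ * _).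
  rewrite /beta_num.
  have -> : (nth 0%N w r + (M - r.+1))%:Z - M%:Z = (nth 0%N w r)%:Z - 1 - (r : nat)%:Z.
    by have := ltn_ord r; lia.
  by rewrite !intrB.
move=> le_n pw.
have -> : specht_char (d.+1 + k.+1) w (kcycle k d.+1) =
   \sum_(r < M | removable w r) specht_char (d + k.+1) (rem_box w r) (kcycle k d).
  by rewrite -[LHS]/(specht_char (d + k.+1).+1 w (emb _)) -cfLiftE (branching le_n pw) sum_cfunE.
rewrite mulr_sumr (eq_bigr (fun r : 'I_M => d`!%:R * fcyc k.+1 (beta_num (rem_box w r)))); last first.
  by move=> r rem; rewrite IHd ?(ltnW le_n) //; apply: wpart_rem.
rewrite -mulr_sumr factS mulnC natrM -mulrA; congr (_ * _).
have := sum_removable (F := fcyc k.+1) (fun=> 1) pw (@eq_fcyc _) (@fcyc_alt M _) (@fcyc_neg M _).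
under eq_bigr do rewrite mul1r; under [RHS]eq_bigr do rewrite mul1r.
move=> <-; rewrite fcyc_lower1 (excess_beta pw); congr (_ * _).
by have -> : (d.+1 + k.+1)%:Z - k.+1%:Z = d.+1%:Z by lia.
Qed.

End CycleCharacter.

(** ** Product formulas *)

Section Vandermonde.
Variables (F : fieldType) (M : nat).
Implicit Types (x y : 'I_M -> F).

Definition vdm x : F := \prod_(i < M) \prod_(j < M | (i < j)%N) (x j - x i).

Lemma vdm_split x i : vdm x =
  (\prod_(a < M | a != i) \prod_(b < M | (a < b)%N && (b != i)) (x b - x a)) *
  (\prod_(a < M | a != i) (if (a < i)%N then 1 else -1)) * \prod_(a < M | a != i) (x i - x a).
Proof.
rewrite /vdm (bigD1 i) //=.
have -> : \prod_(j < M | (i < j)%N) (x j - x i) =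
   \prod_(a < M | a != i) (if (i < a)%N then x a - x i else 1).
  rewrite -big_mkcondr /=; apply: eq_bigl => a; rewrite -val_eqE /=.
  by case: ltngtP.
have -> : \prod_(a < M | a != i) \prod_(b < M | (a < b)%N) (x b - x a) =
   \prod_(a < M | a != i) ((if (a < i)%N then x i - x a else 1) *
     \prod_(b < M | (a < b)%N && (b != i)) (x b - x a)).
  apply: eq_bigr => a ne; case: ifP => lt; first by rewrite (bigD1 i) //= .
  rewrite mul1r; apply: eq_bigl => b; case: eqP => [->|_]; rewrite ?andbT // lt.
  by [].
rewrite big_split /= mulrA mulrC -mulrA; congr (_ * _).
rewrite -!big_split /=; apply: eq_bigr => a ne.
have : (a : nat) != i by [].
by case: ltngtP => // _ _; rewrite ?mul1r ?mulr1 ?mulN1r ?opprB.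
Qed.

Lemma vdm_change x y i : (forall j, j != i -> x j = y j) ->
  vdm y * \prod_(a < M | a != i) (x i - x a) = vdm x * \prod_(a < M | a != i) (y i - y a).
Proof.
move=> e; rewrite (vdm_split x i) (vdm_split y i).
rewrite [X in X * _ * _ * _](eq_bigr (fun a : 'I_M => \prod_(b < M | (a < b)%N && (b != i)) (x b - x a))) => [|a na].
  by rewrite -!mulrA; congr (_ * (_ * _)); rewrite mulrC.
by apply: eq_bigr => b /andP[_ nb]; rewrite !e.
Qed.

Lemma vdm_neq0 x : injective x -> vdm x != 0.
Proof.
move=> inj; apply/prodf_neq0 => i _; apply/prodf_neq0 => j lt.
by rewrite subr_eq0 (inj_eq inj) -val_eqE /= gtn_eqF.
Qed.

(** The determinant of a family of falling factorials is a Vandermonde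
    determinant: the falling factorials are monic of increasing degrees. *)
Lemma det_ffact (u : 'I_M -> nat) :
  \det (\matrix_(i, j < M) ((u i ^_ j)%:R : F)) = vdm (fun i => (u i)%:R).
Proof.
pose p j : {poly F} := \prod_(e < j) ('X - (e : nat)%:R%:P).
have pE j n : (p j).[n%:R] = (n ^_ j)%:R.
  elim: j => [|j IH]; first by rewrite /p big_ord0 hornerC.
  rewrite /p big_ord_recr /= hornerM -/(p j) IH !hornerE ffactnSr natrM.
  case: (leqP j n) => [le|lt]; first by rewrite natrB.
  by rewrite ffact_small // !mul0r.
have pM j : p j \is monic by apply: monic_prod => e _; apply: monicXsubC.
have pS j : size (p j) = j.+1 by rewrite /p -big_enum /= size_prod_XsubC size_enum_ord.
pose a : 'rV[F]_M := \row_i (u i)%:R.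
have -> : (\matrix_(i, j < M) ((u i ^_ j)%:R : F)) =
   (Vandermonde M a)^T *m (\matrix_(e, j < M) (p j)`_e).
  apply/matrixP => i j; rewrite !mxE -pE horner_coef pS.
  rewrite (big_ord_widen M (fun e => (p j)`_e * (u i)%:R ^+ e)) // big_mkcond.
  apply: eq_bigr => e _; rewrite !mxE; case: ifP => [_|ge]; first by rewrite mulrC.
  by rewrite nth_default ?mulr0 // pS leqNgt ge.
rewrite det_mulmx det_tr det_Vandermonde -[X in _ * X]det_tr det_trig; last first.
  by apply/is_trig_mxP => i j lt; rewrite !mxE nth_default // pS.
rewrite [X in _ * X]big1 ?mulr1 => [|i _]; last first.
  by rewrite !mxE; have := monicP (pM i); rewrite /lead_coef pS.
by apply: eq_bigr => i _; apply: eq_bigr => j _; rewrite !mxE.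
Qed.

End Vandermonde.

Section CycleValue.
Variable M : nat.

Lemma fdet_nat (u : 'I_M -> nat) :
  fdet (fun i => (u i)%:Z) = (\prod_i (u i)`!%:R)^-1 * vdm (fun i => (u i)%:R : algC).
Proof.
rewrite -det_ffact /fdet /determinant mulr_sumr; apply: eq_bigr => s _.
rewrite mulrCA; congr (_ * _); rewrite -prodfV -big_split /=; apply: eq_bigr => i _.
rewrite !mxE; case: (leqP (s i) (u i)) => [le|lt].
  have -> : (u i)%:Z - (s i : nat)%:Z = (u i - s i)%:Z by lia.
  rewrite /inv_fact -(ffact_fact le) natrM invfM mulrAC mulVf ?mul1r //.
  by rewrite pnatr_eq0 -lt0n ffact_gt0.
rewrite ffact_small // mulr0.
have : (u i)%:Z - (s i : nat)%:Z < 0 by lia.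
by case: (_ - _).
Qed.

Lemma fdet_ratio (u : 'I_M -> nat) k i : injective u ->
  fdet (lower k i (fun i => (u i)%:Z)) / fdet (fun i => (u i)%:Z) =
  (u i ^_ k)%:R * \prod_(j < M | j != i) (((u i)%:R - k%:R - (u j)%:R) / ((u i)%:R - (u j)%:R)).
Proof.
move=> inj; case: (ltnP (u i) k) => [lt|le].
  rewrite ffact_small // mul0r (@fdet_neg _ _ i) ?mul0r // /lower eqxx; lia.
pose u' j := if j == i then (u i - k)%N else u j.
have -> : fdet (lower k i (fun i => (u i)%:Z)) = fdet (fun i => (u' i)%:Z).
  by apply: eq_fdet => j; rewrite /lower /u'; case: eqP => [->|_]; lia.
have injR : injective (fun i => (u i)%:R : algC).
  by move=> a b /eqP; rewrite eqr_nat => /eqP/inj.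
rewrite !fdet_nat.
have V0 := vdm_neq0 injR.
have D0 : \prod_(a < M | a != i) ((u i)%:R - (u a)%:R : algC) != 0.
  by apply/prodf_neq0 => a ne; rewrite subr_eq0 eqr_nat (inj_eq inj) eq_sym.
have e : vdm (fun j => (u' j)%:R : algC) = vdm (fun j => (u j)%:R) *
    \prod_(j < M | j != i) (((u i)%:R - k%:R - (u j)%:R) / ((u i)%:R - (u j)%:R)).
  apply: (mulIf D0); rewrite (@vdm_change _ _ (fun j => (u j)%:R) (fun j => (u' j)%:R) i); last first.
    by move=> j /negPf ne; rewrite /u' ne.
  rewrite -mulrA; congr (_ * _); rewrite -big_split /=; apply: eq_bigr => j ne.
  rewrite /u' eqxx (negPf ne) natrB // mulfVK //.
  by rewrite subr_eq0 eqr_nat (inj_eq inj) eq_sym.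
rewrite e (bigD1 i) //= [X in _ / (X^-1 * _)](bigD1 i) //= {1}/u' eqxx.
rewrite (eq_bigr (fun j => (u j)`!%:R)) => [|j /negPf ne]; last by rewrite /u' ne.
set P := \prod_(j < M | _) (u j)`!%:R; set Q := \prod_(j < M | _) _.
have P0 : P != 0 by apply/prodf_neq0 => j _; rewrite pnatr_eq0 -lt0n fact_gt0.
have f0 m : (m`!%:R : algC) != 0 by rewrite pnatr_eq0 -lt0n fact_gt0.
rewrite -(ffact_fact le) natrM.
have k0 : ((u i ^_ k)%:R : algC) != 0 by rewrite pnatr_eq0 -lt0n ffact_gt0.
by move: (vdm _) V0 => V V0; field; rewrite V0 P0 k0 f0.
Qed.

(** Frobenius' formula: a quotient of two Vandermonde determinants whose arguments
    differ in one place is a product over the other rows. *)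
Theorem frobenius_cycle k d w (u := fun i : 'I_M => (nth 0%N w i + (M - i.+1))%N) :
  (d + k.+1 <= M)%N -> wpart M (d + k.+1) w ->
  ((d + k.+1) ^_ k.+1)%:R * specht_char (d + k.+1) w (kcycle k d) / specht_char (d + k.+1) w 1%g =
  \sum_i (u i ^_ k.+1)%:R *
     \prod_(j < M | j != i) (((u i)%:R - k.+1%:R - (u j)%:R) / ((u i)%:R - (u j)%:R)).
Proof.
move=> le pw; have d0 := deg_gt0 pw.
have u_inj : injective u.
  move=> i j e; apply/val_inj; move: e; rewrite /u /=.
  have := ltn_ord i; have := ltn_ord j.
  case: (ltngtP i j) => // lt; have := wpart_le pw (ltnW lt); lia.
have eX := kcycle_fcyc le pw; have eD := deg_fdet le pw.
have f0 m : (m`!%:R : algC) != 0 by rewrite pnatr_eq0 -lt0n fact_gt0.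
have D0 : fdet (beta_num w : 'I_M -> int) != 0.
  rewrite [fdet _](fdet_nat u) mulf_neq0 ?invr_eq0 //.
    by apply/prodf_neq0 => j _; rewrite f0.
  by apply: vdm_neq0 => a b /eqP; rewrite eqr_nat => /eqP/u_inj.
have F0 : fdet0 M != 0.
  by apply: contraNneq D0 => z; move/eqP: eD; rewrite z mul0r eq_sym mulf_eq0 (negPf (f0 _)).
transitivity (fcyc k.+1 (beta_num w : 'I_M -> int) / fdet (beta_num w : 'I_M -> int)); last first.
  by rewrite /fcyc mulr_suml; apply: eq_bigr => i _; rewrite (@fdet_ratio u).
have eX' : specht_char (d + k.+1) w (kcycle k d) = d`!%:R * fcyc k.+1 (beta_num w : 'I_M -> int) / fdet0 M.
  by rewrite -eX mulrC mulKf.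
have eD' : specht_char (d + k.+1) w 1%g = (d + k.+1)`!%:R * fdet (beta_num w : 'I_M -> int) / fdet0 M.
  by rewrite -eD mulrC mulKf.
rewrite eX' eD' -(ffact_fact (leq_addl d k.+1)) natrM addnK.
have n0 : (((d + k.+1) ^_ k.+1)%:R : algC) != 0 by rewrite pnatr_eq0 -lt0n ffact_gt0 leq_addl.
by field; rewrite D0 F0 n0 f0.
Qed.

End CycleValue.

(** * The function G of a diagram *)

Section Diagram.
Variable R : comNzRingType.

(** This is (z - x) / z in the variable t = 1 / z. *)
Definition lin (x : R) : fps R := 1 - fC x * fX.

Lemma lin0 x : lin x 0%N = 1.
Proof. by rewrite fcoefB fcoef1 fcoefM0 mulr0 subr0. Qed.

(** G(z) / z for G = 1 / H, where every row contributes the content of its last box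
    and the one of the position next to it; these cancel against the adjacent rows
    wherever there is no corner. In this form the row lengths l_r may be
    indeterminates. *)
Definition gseries m (l : 'I_m -> R) : fps R :=
  lin (- m%:R) * \prod_(r < m) (lin (l r - (r : nat)%:R) * finv (lin (l r - (r : nat).+1%:R))).

Lemma prod0 I (r : seq I) (F : I -> fps R) : (forall i, F i 0%N = 1) ->
  (\prod_(i <- r) F i) 0%N = 1.
Proof.
move=> F0; elim: r => [|i r IH]; first by rewrite big_nil.
by rewrite big_cons fcoefM0 F0 IH mul1r.
Qed.

Lemma gseries0 m (l : 'I_m -> R) : gseries l 0%N = 1.
Proof.
by rewrite fcoefM0 lin0 mul1r prod0 // => r; rewrite fcoefM0 finv0 ?lin0 ?mul1r.
Qed.

(** The shift x -> x - j acts on these products by translating the roots. *)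
Lemma lin_shift x j : fcomp (lin x) (fX * finv (1 - j%:R * fX)) =
  lin (x + j%:R) * finv (lin j%:R).
Proof.
have t0 : (fX * finv (1 - j%:R * fX)) 0%N = 0 :> R by rewrite fcoefM0 mul0r.
have e : 1 - j%:R * fX = lin j%:R by rewrite /lin rmorph_nat.
rewrite e in t0 *; have linE y : lin y = 1 - fC y * fX by [].
rewrite (linE x) fcompB fcomp1 // fcompM // fcompC // fcompfX //.
have dV : lin j%:R * finv (lin j%:R) = 1 by rewrite fmulV ?lin0.
apply: (fmulI (lin0 j%:R)).
transitivity (lin j%:R - fC x * fX * (lin j%:R * finv (lin j%:R))); first by ring.
by rewrite [RHS]mulrCA !dV !mulr1 !linE rmorphD /=; ring.
Qed.

Lemma shift_gseries m (l : 'I_m -> R) j : shift_series (gseries l) j =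
  lin (j%:R - m%:R) * \prod_(r < m) (lin (l r - (r : nat)%:R + j%:R)
    * finv (lin (l r - (r : nat).+1%:R + j%:R))).
Proof.
have t0 : (fX * finv (1 - j%:R * fX)) 0%N = 0 :> R by rewrite fcoefM0 mul0r.
have e : 1 - j%:R * fX = lin j%:R by rewrite /lin rmorph_nat.
rewrite /shift_series fcompM // fcomp_prod // lin_shift {1}e.
have -> : lin j%:R * (lin (- m%:R + j%:R) * finv (lin j%:R) *
    \prod_(r < m) fcomp (lin (l r - (r : nat)%:R) * finv (lin (l r - (r : nat).+1%:R)))
        (fX * finv (1 - j%:R * fX))) = (lin j%:R * finv (lin j%:R)) * (lin (- m%:R + j%:R) *
    \prod_(r < m) fcomp (lin (l r - (r : nat)%:R) * finv (lin (l r - (r : nat).+1%:R)))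
        (fX * finv (1 - j%:R * fX))) by ring.
rewrite fmulV ?lin0 // mul1r addrC; congr (_ * _); apply: eq_bigr => r _.
rewrite fcompM // fcompV ?lin0 // !lin_shift finvM ?lin0 ?finv0 ?lin0 // finvK ?lin0 //.
transitivity (lin (l r - (r : nat)%:R + j%:R) * finv (lin (l r - (r : nat).+1%:R + j%:R))
   * (lin j%:R * finv (lin j%:R))); first by ring.
by rewrite fmulV ?lin0 // mulr1.
Qed.

(** The factors of the rows telescope over the consecutive shifts. *)
Lemma shift_gseries_prod m (l : 'I_m -> R) k : \prod_(j < k) shift_series (gseries l) j =
  \prod_(j < k) lin ((j : nat)%:R - m%:R) *
  \prod_(r < m) (lin (l r - (r : nat).+1%:R + k%:R) * finv (lin (l r - (r : nat).+1%:R))).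
Proof.
elim: k => [|k IH].
  by rewrite !big_ord0 mul1r big1 // => r _; rewrite addr0 fmulV ?lin0.
rewrite [LHS]big_ord_recr [in RHS]big_ord_recr /= IH shift_gseries.
set A := \prod_(j < k) _; set B := \prod_(r < m) _; set B' := \prod_(r < m) _; set B2 := \prod_(r < m) _.
have e : B * B' = B2.
  rewrite /B /B' -big_split /=; apply: eq_bigr => r _.
  have -> : l r - (r : nat)%:R + k%:R = l r - (r : nat).+1%:R + k.+1%:R.
    by rewrite -!natr1; ring.
  move: (l r - (r : nat).+1%:R) => x.
  transitivity (lin (x + k%:R) * finv (lin (x + k%:R)) * (lin (x + k.+1%:R) * finv (lin x))).
    by ring.
  by rewrite fmulV ?lin0 // mul1r.
by rewrite -e; ring.
Qed.

Lemma finv_lin x n : finv (lin x) n = x ^+ n.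
Proof.
suff -> : finv (lin x) = Fps (fun n => x ^+ n) by [].
apply: finv_uniq; last exact: lin0.
apply: fpsP => -[|m]; first by rewrite fcoefM0 lin0 mulr1.
rewrite /lin mulrBl mul1r -mulrA fcoefB fcoefCM fcoefXM /=.
by rewrite exprS subrr.
Qed.

Lemma lin_mul_coef x f n :
  (lin x * f) n = f n - x * (if n is n'.+1 then f n' else 0).
Proof. by rewrite /lin mulrBl mul1r -mulrA fcoefB fcoefCM fcoefXM. Qed.

Lemma lin_prod_coef_gt (s : seq R) e : (size s < e)%N -> (\prod_(b <- s) lin b) e = 0.
Proof.
elim: s e => [|b s IH] [|e] //; first by rewrite big_nil.
rewrite ltnS big_cons lin_mul_coef => lt.
by rewrite !IH ?mulr0 ?subr0 // (leq_trans lt) // ltnW.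
Qed.

(** [\prod_b (1 - b t)] is the reversed polynomial of [\prod_b (z - b)]. *)
Lemma lin_prod_coef (s : seq R) e : (e <= size s)%N ->
  (\prod_(b <- s) lin b) e = (\prod_(b <- s) ('X - b%:P))`_(size s - e).
Proof.
elim: s e => [|b s IH] e; first by rewrite leqn0 => /eqP ->; rewrite !big_nil coef1.
rewrite !big_cons lin_mul_coef mulrBl coefB coefXM coefCM /=.
case: e => [|e] le.
  have z : (\prod_(c <- s) ('X - c%:P))`_(size s).+1 = 0.
    by rewrite nth_default // size_prod_XsubC.
  by rewrite subn0 mulr0 subr0 IH // subn0 z mulr0 subr0.
rewrite subSS [in X in _ - _ * X]IH // ; case: (ltnP e (size s)) => [lt|ge].
  by rewrite IH // subn_eq0 leqNgt lt /= -subnS.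
have -> : e = size s by apply/eqP; rewrite eqn_leq ge andbT; rewrite -ltnS.
by rewrite subnn /= lin_prod_coef_gt.
Qed.

End Diagram.

Section Residue.
Variable F : fieldType.

(** The residue at infinity of the rational function
    prod_b (z - b) / prod_i (z - a_i) is the sum of its residues at the a_i, which
    is read off the expansion into partial fractions. *)
Lemma residue_sum m (a : 'I_m.+1 -> F) (s : seq F) n : injective a ->
  size s = (n + m)%N ->
  (\prod_(b <- s) lin b * \prod_(i < m.+1) finv (lin (a i))) n =
  \sum_i (\prod_(b <- s) (a i - b)) / \prod_(j < m.+1 | j != i) (a i - a j).
Proof.
move=> inj ss; pose c i := (\prod_(j < m.+1 | j != i) (a i - a j))^-1.
have c0 i : \prod_(j < m.+1 | j != i) (a i - a j) != 0.
  by apply/prodf_neq0 => j ne; rewrite subr_eq0 (inj_eq inj) eq_sym.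
pose si (i : 'I_m.+1) := [seq a j | j <- index_enum 'I_m.+1 & j != i].
have prodE (T : comNzRingType) (f : F -> T) i :
    \prod_(j < m.+1 | j != i) f (a j) = \prod_(b <- si i) f b.
  by rewrite big_map big_filter.
have size_si i : size (si i) = m.
  by rewrite size_map -sum1_size big_filter sum1_card cardC1 card_ord.
pose L : {poly F} := \sum_i (c i)%:P * \prod_(j < m.+1 | j != i) ('X - (a j)%:P).
have L1 : L = 1.
  apply/eqP; rewrite -subr_eq0; apply/eqP.
  apply: (@roots_geq_poly_eq0 _ _ [seq a i | i <- enum 'I_m.+1]).
  - apply/allP => _ /mapP[k _ ->]; rewrite rootE hornerD hornerN (hornerC 1) horner_sum (bigD1 k) //=.
    rewrite [X in _ + X - 1]big1 ?addr0 => [|i ne]; rewrite hornerM hornerC horner_prod.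
      rewrite (eq_bigr (fun j => a k - a j)) => [|j _]; last by rewrite !hornerE.
      by rewrite /c mulVf // subrr.
    by rewrite (bigD1 k) 1?eq_sym //= hornerXsubC subrr mul0r mulr0.
  - by rewrite map_inj_uniq ?enum_uniq.
  rewrite size_map size_enum_ord (leq_trans (size_polyD _ _)) // size_polyN size_poly1 geq_max ltnS leq0n andbT.
  apply: (leq_trans (size_sum _ _ _)); apply/bigmax_leqP => i _.
  rewrite mul_polyC (leq_trans (size_scale_leq _ _)) // (prodE _ (fun b => 'X - b%:P)) .
  by rewrite size_prod_XsubC size_si.
have K : \sum_i fC (c i) * \prod_(j < m.+1 | j != i) lin (a j) = fX ^+ m.
  apply: fpsP => e; rewrite fcoef_sum fcoefXn.
  case: (leqP e m) => [le|gt]; last first.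
    rewrite gtn_eqF // big1 // => i _; rewrite fcoefCM prodE lin_prod_coef_gt ?mulr0 //.
    by rewrite size_si.
  transitivity (L`_(m - e)); last first.
    by rewrite L1 coef1 subn_eq0; congr _%:R; congr nat_of_bool; apply/idP/eqP => [ge|->//]; apply/eqP; rewrite eqn_leq le.
  rewrite coef_sum; apply: eq_bigr => i _.
  by rewrite fcoefCM coefCM !(prodE _ (fun b => 'X - b%:P), prodE _ (@lin F)) lin_prod_coef ?size_si.
have partial : fX ^+ m * \prod_(i < m.+1) finv (lin (a i)) = \sum_i fC (c i) * finv (lin (a i)).
  rewrite -K mulr_suml; apply: eq_bigr => i _; rewrite [X in _ * X = _](bigD1 i) //=.
  transitivity (fC (c i) * finv (lin (a i)) *
     \prod_(j < m.+1 | j != i) (lin (a j) * finv (lin (a j)))).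
    by rewrite big_split /=; ring.
  by rewrite big1 ?mulr1 // => j _; rewrite fmulV ?lin0.
set P := \prod_(b <- s) lin b.
transitivity ((P * (fX ^+ m * \prod_(i < m.+1) finv (lin (a i)))) (n + m)%N).
  by rewrite mulrCA fcoefXnM leq_addl addnK.
rewrite partial mulr_sumr fcoef_sum; apply: eq_bigr => i _.
rewrite mulrCA fcoefCM mulrC; congr (_ * _).
rewrite -ss fcoefM; transitivity ((\prod_(b <- s) ('X - b%:P)).[a i]).
  rewrite horner_coef size_prod_XsubC [RHS](reindex_inj rev_ord_inj) /=.
  apply: eq_bigr => e _; rewrite finv_lin subSS /P lin_prod_coef //.
  by rewrite -ltnS.
by rewrite horner_prod; apply: eq_bigr => b _; rewrite !hornerE.
Qed.

Lemma size_enum_map n (h : 'I_n -> F) : size [seq h j | j <- enum 'I_n] = n.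
Proof. by rewrite size_map size_enum_ord. Qed.

Lemma prod_enum (T : comNzRingType) (f : F -> T) n (h : 'I_n -> F) :
  \prod_(b <- [seq h j | j <- enum 'I_n]) f b = \prod_(j < n) f (h j).
Proof. by rewrite big_map big_enum. Qed.

(** The sum over the rows in Frobenius' formula is a sum of residues of the
    product of the shifts of G; the factor - k comes from the row itself. *)
Lemma gseries_frobenius m (l : 'I_m -> F) k (a := fun r : 'I_m => l r - (r : nat).+1%:R) :
  (0 < m)%N -> injective a ->
  (\prod_(j < k) shift_series (gseries l) j) k.+1 =
  \sum_i (\prod_(j < k) (a i + m%:R - (j : nat)%:R)) * (- k%:R) *
    \prod_(j < m | j != i) ((a i - k%:R - a j) / (a i - a j)).
Proof.
case: m l @a => // m l a _ inj; rewrite shift_gseries_prod.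
have -> : \prod_(r < m.+1) (lin (l r - (r : nat).+1%:R + k%:R) * finv (lin (l r - (r : nat).+1%:R))) =
   \prod_(r < m.+1) lin (a r + k%:R) * \prod_(r < m.+1) finv (lin (a r)) by rewrite -big_split; apply: eq_bigr => r _.
pose s := [seq (nat_of_ord j)%:R - m.+1%:R | j <- enum 'I_k] ++
   [seq a r + k%:R | r <- enum 'I_m.+1].
have e : \prod_(b <- s) lin b =
    \prod_(j < k) lin ((j : nat)%:R - m.+1%:R) * \prod_(r < m.+1) lin (a r + k%:R).
  by rewrite big_cat 2!prod_enum.
transitivity ((\prod_(b <- s) lin b * \prod_(i < m.+1) finv (lin (a i))) k.+1).
  by rewrite e mulrA.
rewrite (residue_sum inj); last by rewrite size_cat 2!size_enum_map addSnnS.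
apply: eq_bigr => i _; rewrite big_cat 2!prod_enum /= -!mulrA; congr (_ * _).
  by apply: eq_bigr => j _; ring.
rewrite (bigD1 i) //= big_split /= prodfV mulrA; congr (_ * _ / _); first by ring.
by apply: eq_bigr => j _; ring.
Qed.

End Residue.

(** ** Free cumulants of a diagram *)

Section CumulantsExist.
Variable R : comNzRingType.
Implicit Types f g : fps R.

Lemma fXI f g : fX * f = fX * g -> f = g.
Proof.
move=> e; apply: fpsP => n.
by have /(congr1 (fun f : fps R => f n.+1)) := e; rewrite !fcoefXM.
Qed.

Lemma fcomp_id f : fcomp f fX = f.
Proof.
apply: fpsP => n; rewrite fcompE (bigD1 ord_max) //= fcoefXn eqxx mulr1.
rewrite big1 ?addr0 // => i ne; rewrite fcoefXn.
suff /negPf -> : n != i by rewrite mulr0.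
by apply: contraNneq ne => e; apply/eqP/val_inj.
Qed.

(** The inverse of t / g(t) under composition is y / R(y). *)
Lemma cumulants_exist g : g 0%N = 1 ->
  exists r : fps R, r 0%N = 1 /\ fcomp g (fX * finv r) = finv r.
Proof.
move=> g0; pose h : fps R := fX * finv g.
have h0 : h 0%N = 0 by rewrite fcoefM0 mul0r.
have h1 : h 1%N = 1 by rewrite fcoefXM finv0.
have [W Wh] := fcomp_surj fX h0 h1.
have W0 : W 0%N = 0 by rewrite -(fcomp0 W h) Wh.
have hW : fcomp h W = fX.
  by apply: (fcomp_inj h0 h1); rewrite fcompA // Wh fcomp_id fcompfX.
pose v : fps R := Fps (fun n => W n.+1).
have Wv : W = fX * v by apply: fpsP => -[|n]; rewrite fcoefXM.
have v0 : v 0%N = 1.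
  have := congr1 (fun f : fps R => f 1%N) Wh.
  by rewrite fcompE !big_ord_recl big_ord0 W0 mul0r add0r addr0 expr1 h1 mulr1.
exists (finv v); split; first exact: finv0.
rewrite finvK // -Wv.
have gW0 : fcomp g W 0%N = 1 by rewrite fcomp0.
have e : v * finv (fcomp g W) = 1.
  by apply: fXI; rewrite mulr1 mulrA -Wv -fcompV // -[W in W * _]fcompfX // -fcompM.
by apply: (fmulI (finv0 gW0)); rewrite [RHS]mulrC e mulrC fmulV.
Qed.

Definition dseries m (w : seq nat) : fps R := gseries (fun r : 'I_m => (nth 0%N w r)%:R).

(** The factor of an empty row cancels the change of the first factor. *)
Lemma dseries_pad m p w : (size w <= m)%N -> dseries (m + p) w = dseries m w.
Proof.
move=> sw; elim: p => [|p IH]; first by rewrite addn0.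
rewrite -IH addnS /dseries /gseries big_ord_recr /= nth_default; last first.
  by apply: leq_trans sw _; rewrite leq_addr.
rewrite !mulr0n !sub0r; move: (m + p)%N => M.
set P := \prod_(i < _) _.
transitivity (lin (- M.+1%:R) * finv (lin (- M.+1%:R)) * (lin (- M%:R) * P) : fps R); first by ring.
by rewrite fmulV ?lin0 // mul1r.
Qed.

Definition pfps (p : {poly R}) : fps R := Fps (fun n => p`_n).

Lemma pfpsM p q : pfps (p * q) = pfps p * pfps q.
Proof. by apply: fpsP => n; rewrite fcoefM -[LHS]/((p * q)`_n) coefM. Qed.

Lemma pfps1 : pfps 1 = 1.
Proof. by apply: fpsP => n; rewrite -[LHS]/((1 : {poly R})`_n) coef1. Qed.

Lemma pfpsX : pfps 'X = fX.
Proof. by apply: fpsP => n; rewrite -[LHS]/(('X : {poly R})`_n) coefX. Qed.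

Lemma pfps_lin x : pfps (1 - x *: 'X) = lin x.
Proof.
apply: fpsP => n; rewrite -[LHS]/((1 - x *: 'X : {poly R})`_n) coefB coef1 coefZ coefX.
by rewrite fcoefB fcoefCM.
Qed.

Lemma pfps_prod_lin (s : seq R) :
  pfps (\prod_(y <- s) (1 - y *: 'X)) = \prod_(y <- s) lin y.
Proof.
by rewrite (big_morph _ pfpsM pfps1); apply: eq_bigr => y _; exact: pfps_lin.
Qed.

End CumulantsExist.

Section HExpansion.

(** Row r + 1 has an addable box exactly when row r has a removable one;
    otherwise its factor cancels against the one of the row above. *)
Lemma corners_telescope w : sorted geq w ->
  \prod_(y <- removable_contents w) lin (y%:~R : rat) *
    (lin (- (size w)%:R) * \prod_(r < size w) lin ((nth 0%N w r)%:R - (r : nat)%:R)) =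
  \prod_(x <- addable_contents w) lin (x%:~R : rat) *
    \prod_(r < size w) lin ((nth 0%N w r)%:R - (r : nat).+1%:R).
Proof.
move=> sw; set M := size w.
have iE n : iota 0 n = index_iota 0 n by rewrite /index_iota subn0.
pose A r : fps rat := lin ((nth 0%N w r)%:R - r%:R).
pose B r : fps rat := lin ((nth 0%N w r)%:R - r.+1%:R).
have AM : lin (- M%:R) = A M :> fps rat by rewrite /A nth_default // sub0r.
have dec r : (nth 0%N w r.+1 <= nth 0%N w r)%N. exact: wpart_dec (sorted_wpart sw erefl) r.
have -> : lin (- M%:R) * \prod_(r < M) lin ((nth 0%N w r)%:R - (r : nat)%:R) =
    A 0%N * \prod_(r < M) A r.+1.
  transitivity (\prod_(r < M.+1) A r); first by rewrite big_ord_recr mulrC AM.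
  by rewrite big_ord_recl.
have -> : \prod_(y <- removable_contents w) lin (y%:~R : rat) =
    \prod_(r < M) (if (nth 0%N w r.+1 < nth 0%N w r)%N then B r else 1).
  rewrite /removable_contents big_map big_filter iE big_mkcond big_mkord.
  apply: eq_bigr => r _; case: ifP => // _; congr lin.
  by rewrite !rmorphB /= -!pmulrn -natr1 /=; ring.
have -> : \prod_(x <- addable_contents w) lin (x%:~R : rat) =
    A 0%N * \prod_(r < M) (if (nth 0%N w r.+1 < nth 0%N w r)%N then A r.+1 else 1).
  rewrite /addable_contents big_map big_filter iE big_mkcond big_mkord.
  rewrite big_ord_recl; congr (_ * _); first by rewrite /= rmorphB.
  apply: eq_bigr => r _; rewrite lift0 /=; case: ifP => // _; congr lin.
  by rewrite rmorphB.
rewrite mulrCA -mulrA; congr (_ * _); rewrite -!big_split; apply: eq_bigr => r _ /=.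
case: ltnP => [_|ge]; first by rewrite mulrC.
suff -> : A r.+1 = B r by [].

by congr lin; congr (_%:R - _); apply/eqP; rewrite eqn_leq ge dec.
Qed.

Lemma H_expansion_dseries w : sorted geq w ->
  Fps (H_expansion w) = fX * finv (dseries rat (size w) w).
Proof.
move=> sw.
have [add0 addV] := @finv_prod rat _ (addable_contents w)
  (fun x : int => lin (x%:~R)) (fun x => lin0 _).
have -> : Fps (H_expansion w) = fX * \prod_(y <- removable_contents w) lin (y%:~R) *
   finv (\prod_(x <- addable_contents w) lin x%:~R).
  transitivity (pfps ('X * \prod_(y <- removable_contents w) (1 - y%:~R *: 'X)) *
    Fps (foldr fps_mul fps_one
       [seq (fun n : nat => (x%:~R : rat) ^+ n) | x <- addable_contents w])) => //.
  congr (_ * _).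
    rewrite pfpsM pfpsX; congr (_ * _).
    have := pfps_prod_lin [seq (y%:~R : rat) | y <- removable_contents w].
    by rewrite !big_map.
  rewrite addV; elim: (addable_contents w) => [|x s IH]; first by rewrite big_nil.
  rewrite big_cons -IH /=; set T := foldr _ _ _.
  transitivity (Fps (fun n : nat => (x%:~R : rat) ^+ n) * Fps T) => //.
  by congr (_ * _); apply: fpsP => n; rewrite finv_lin.
rewrite -mulrA; congr (_ * _).
have tel := corners_telescope sw.
set M := size w in tel *.
set P := \prod_(r < M) _ in tel; set Q := \prod_(r < M) _ in tel.
have [P0 _] := @finv_prod rat _ (index_enum 'I_M)
  (fun r => lin ((nth 0%N w r)%:R - (r : nat)%:R)) (fun r => lin0 _).
have [Q0 QV] := @finv_prod rat _ (index_enum 'I_M)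
  (fun r => lin ((nth 0%N w r)%:R - (r : nat).+1%:R)) (fun r => lin0 _).
have dE : dseries rat M w = lin (- M%:R) * P * finv Q.
  rewrite /dseries /gseries -mulrA; congr (_ * _); rewrite QV -big_split.
  by apply: eq_bigr.
have d0 : dseries rat M w 0%N = 1 by exact: gseries0.
apply: (fmulI d0); rewrite fmulV //.
rewrite dE; set RR := \prod_(y <- removable_contents w) _ in tel *.
set AA := \prod_(y <- addable_contents w) _ in tel add0 *.
transitivity (RR * (lin (- M%:R) * P) * (finv Q * finv AA)); first by ring.
rewrite tel; transitivity ((AA * finv AA) * (Q * finv Q)); first by ring.
by rewrite !fmulV // mulr1.
Qed.

Lemma free_cumulants_dseries w (r : fps rat) : sorted geq w ->
  cumulants_of (dseries rat (size w) w) r -> free_cumulants w r.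
Proof.
move=> sw cr; have [r0 gV] := cr; have g0 := cumulants_g0 cr.
set V := fX * finv r in gV.
have V0 : V 0%N = 0 by rewrite fcoefM0 mul0r.
exists V; split=> n.
  transitivity ((V * r) n).
    rewrite fcoefM; apply: eq_bigr => i _; case: eqP => [->|//].
    by rewrite r0.
  by rewrite /V -mulrA [finv r * r]mulrC fmulV // mulr1.
transitivity (fcomp (Fps (H_expansion w)) V n).
  rewrite fcompE; apply: eq_bigr => m _; congr (_ * _).
  suff -> : forall m, V ^+ m = Fps (fps_exp V m) by [].
  elim=> [|i IH]; first by rewrite expr0.
  by rewrite exprS IH.
rewrite H_expansion_dseries // fcompM // fcompfX // fcompV // gV finvK //.
by rewrite /V -mulrA [finv r * r]mulrC fmulV // mulr1.
Qed.

End HExpansion.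

(** * Kerov polynomials evaluated at diagrams *)

Lemma reshape_index_cat (w s : seq nat) i : (i < sumn w)%N ->
  reshape_index (w ++ s) i = reshape_index w i.
Proof.
rewrite /reshape_index; elim: w i => [//|x w IH] i /= lt.
case: (ltnP i x) => [lt'|le]; first by have -> : (i.+1 - x = 0)%N by lia.
have -> : (i.+1 - x = (i - x).+1)%N by lia.
by rewrite /= IH //; lia.
Qed.

Lemma reshape_offset_cat (w s : seq nat) i : (i < sumn w)%N ->
  reshape_offset (w ++ s) i = reshape_offset w i.
Proof.
move=> lt; rewrite /reshape_offset reshape_index_cat // takel_cat //.
have := find_size (pred1 0%N) (scanl subn i.+1 w).
by rewrite size_scanl.
Qed.

Lemma specht_char_cat n (w s : seq nat) : sumn w = n ->
  specht_char n (w ++ s) = specht_char n w.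
Proof.
move=> sw.
have lt (i : 'I_n) : (i < sumn w)%N by rewrite sw.
have eR : row_stab n (w ++ s) = row_stab n w.
  apply/setP => p; rewrite !inE; apply: eq_forallb => i.
  by rewrite !reshape_index_cat.
have eC : col_stab n (w ++ s) = col_stab n w.
  apply/setP => p; rewrite !inE; apply: eq_forallb => i.
  by rewrite !reshape_offset_cat.
have e : young_symmetrizer n (w ++ s) = young_symmetrizer n w.
  by rewrite /young_symmetrizer eR eC.
by rewrite /specht_char /specht_repr e.
Qed.

Lemma ffact_prod (R : nzRingType) n k : (n ^_ k)%:R = \prod_(j < k) (n%:R - (j : nat)%:R) :> R.
Proof.
elim: k => [|k IH]; first by rewrite big_ord0.
rewrite ffactnSr big_ord_recr /= natrM IH.
case: (leqP k n) => [le|lt]; first by rewrite natrB.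
by rewrite -IH ffact_small // !mul0r.
Qed.

(** Frobenius' formula turns the defining property of a Kerov polynomial into a
    coefficient of a product of shifts of G. *)
Lemma kerov_on_diagrams k0 (k := k0.+1) (Sigma : {mpoly int[k]}) (w : seq nat) (r : fps rat) :
  is_kerov_polynomial Sigma -> sorted geq w -> all (leq 1) w -> (k <= sumn w)%N ->
  cumulants_of (dseries rat (size w) w) r ->
  mmap intr (fun i : 'I_k => r i.+2) Sigma =
  - (k%:R^-1) * (\prod_(j < k) shift_series (dseries rat (size w) w) j) k.+1.
Proof.
move=> hS sw w1 le cr.
pose d := (sumn w - k)%N; have en : (d + k)%N = sumn w by rewrite /d subnK.
set M := (d + k)%N.
have sM : (size w <= M)%N.
  rewrite /M en; elim: (w) w1 => //= x s IH /andP[x1 s1].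
  by rewrite -add1n leq_add // IH.
pose w' := w ++ nseq (M - size w) 0%N.
have nthw' i : nth 0%N w' i = nth 0%N w i.
  by rewrite nth_cat; case: ltnP => // ge; rewrite nth_nseq if_same nth_default.
have pw' : wpart M M w'.
  split; first by rewrite size_cat size_nseq subnKC.
    by move=> i; rewrite !nthw'; exact: wpart_dec (sorted_wpart sw erefl) i.
  by rewrite sumn_cat sumn_nseq mul0n addn0 -en.
have pt : is_partition_of M w by rewrite /is_partition_of sw w1 /M en eqxx.
have ct : has_cycle_type (kcycle k0 d) (k :: nseq (M - k) 1%N).
  by rewrite /M addnK; exact: kcycle_type.
have := hS M w (kcycle k0 d) r (leq_addl _ _) pt ct (free_cumulants_dseries sw cr).
rewrite /normalized_char -(specht_char_cat (nseq (M - size w) 0%N) (esym en)).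
rewrite (frobenius_cycle (leqnn _) pw').
set u : 'I_M -> nat := fun i => (nth 0%N w i + (M - i.+1))%N.
pose l (i : 'I_M) : rat := (nth 0%N w i)%:R.
have M0 : (0 < M)%N by rewrite /M addnS.
have aE i : l i - (i : nat).+1%:R = (u i)%:R - M%:R.
  by rewrite /u natrD natrB //; rewrite /l; ring.
have u_inj : injective u.
  move=> i j e; apply/val_inj; move: e; rewrite /u /=.
  have pw := sorted_wpart sw erefl.
  have := ltn_ord i; have := ltn_ord j.
  case: (ltngtP i j) => // lt; have := wpart_le pw (ltnW lt); lia.
have inj : injective (fun i : 'I_M => l i - (i : nat).+1%:R).
  move=> i j /=; rewrite !aE => /addIr/eqP; rewrite eqr_nat => /eqP; exact: u_inj.
have -> : dseries rat (size w) w = gseries l.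
  by rewrite -(@dseries_pad rat _ (M - size w) w (leqnn _)) subnKC.
rewrite (gseries_frobenius _ M0 inj) => e.
apply: (fmorph_inj (ratr : {rmorphism rat -> algC})); refine (etrans (esym e) _).
rewrite mulr_sumr rmorph_sum; apply: eq_bigr => i _.
rewrite ffact_prod.
have k_neq0 : (k%:R : rat) != 0 by rewrite pnatr_eq0.
transitivity (ratr (\prod_(j < k) ((u i)%:R - (j : nat)%:R) *
  \prod_(j < M | j != i) ((l i - i.+1%:R - k%:R - (l j - j.+1%:R)) / (l i - i.+1%:R - (l j - j.+1%:R)))) : algC).
  rewrite rmorphM !rmorph_prod; congr (_ * _); apply: eq_bigr => j _.
    by rewrite rmorphB !rmorph_nat nthw'.
  rewrite !aE !nthw' fmorph_div !rmorphB !rmorph_nat.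
  have cancelM (x y : algC) : x - y = x - M%:R - (y - M%:R).
    by rewrite opprB addrA subrK.
  by congr (_ / _); [rewrite (addrAC _ (- M%:R) (- k%:R)) -cancelM | exact: cancelM].
congr ratr; rewrite mulrA; congr (_ * _).
have -> : \prod_(j < k) (l i - i.+1%:R + M%:R - (j : nat)%:R) = \prod_(j < k) ((u i)%:R - (j : nat)%:R).
  by apply: eq_bigr => j _; rewrite aE subrK.
by rewrite mulrA [- _ * _]mulrC -mulrA mulrNN mulVf ?mulr1.
Qed.

(** * From diagrams to arbitrary free cumulants *)

Lemma digits_inj N m (a b : nat -> nat) :
  (forall i, (i < m)%N -> (a i < N)%N) -> (forall i, (i < m)%N -> (b i < N)%N) ->
  (\sum_(i < m) a i * N ^ i = \sum_(i < m) b i * N ^ i)%N ->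
  forall i, (i < m)%N -> a i = b i.
Proof.
elim: m a b => // m IH a b aN bN.
have N0 : (0 < N)%N by apply: leq_trans (aN 0%N _).
have E (c : nat -> nat) : (\sum_(i < m.+1) c i * N ^ i =
    (\sum_(i < m) c i.+1 * N ^ i) * N + c 0)%N.
  rewrite big_ord_recl muln1 addnC big_distrl; congr (_ + _)%N.
  by apply: eq_bigr => i _; rewrite lift0 expnS /=; ring.
rewrite !E => e.
have e0 : a 0%N = b 0%N.
  by have := congr1 (modn^~ N) e; rewrite /= !modnMDl !modn_small ?aN ?bN.
case=> [//|i] lt; apply: (IH (fun i => a i.+1) (fun i => b i.+1)) => //.
- by move=> j lj; apply: aN.
- by move=> j lj; apply: bN.
by move/eqP: e; rewrite e0 eqn_add2r eqn_pmul2r // => /eqP.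
Qed.

(** On the points (b^(N^m), ..., b^N), with N large, distinct monomials become
    distinct powers of b, so that p becomes a polynomial in b with infinitely many
    roots and with the same coefficients. *)
Lemma mpoly_eq0_decreasing (F : numFieldType) m (p : {mpoly F[m]}) B :
  (forall l : 'I_m -> nat, (forall i j : 'I_m, (i <= j)%N -> (l j <= l i)%N) ->
     (forall i, (B <= l i)%N) -> p.@[fun i => (l i)%:R] = 0) -> p = 0.
Proof.
move=> pv; apply/eqP; case: (boolP (p == 0)) => // p0.
set N := msize p.
have [mon0 mon0P] : exists mon, mon \in msupp p.
  case: (msupp p) (msupp_eq0 p) => [|mon s _]; first by rewrite eqxx (negPf p0).
  by exists mon; rewrite inE eqxx.
pose E (mon : 'X_{1..m}) := (\sum_(i < m) mon i * N ^ (m - i))%N.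
have digit mon i : mon \in msupp p -> (mon i < N)%N.
  move=> /msize_mdeg_lt; apply: leq_ltn_trans.
  by rewrite mdegE (bigD1 i) //= leq_addr.
have N0 : (0 < N)%N by apply: leq_ltn_trans (msize_mdeg_lt mon0P).
have E_inj mon mon' : mon \in msupp p -> mon' \in msupp p -> E mon = E mon' -> mon = mon'.
  move=> h h' e; apply/mnmP => i.
  pose dg (c : 'X_{1..m}) j := if insub (m - j.+1)%N is Some s then c (s : 'I_m) else 0%N.
  have dgE c (j : 'I_m) : dg c j = c (rev_ord j).
    rewrite /dg; case: insubP => [s _ es|]; first by congr (c _); apply/val_inj; rewrite es.
    by rewrite ltn_subrL /= (leq_ltn_trans _ (ltn_ord j)).
  have EE c : (E c = (\sum_(j < m) dg c j * N ^ j) * N)%N.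
    rewrite /E (reindex_inj rev_ord_inj) big_distrl; apply: eq_bigr => j _.
    by rewrite dgE /= -mulnA -expnSr subKn.
  have ltdg c j : c \in msupp p -> (j < m)%N -> (dg c j < N)%N.
    by move=> hc lj; rewrite (dgE c (Ordinal lj)) digit.
  move/eqP: e; rewrite !EE eqn_pmul2r // => /eqP e.
  have := digits_inj (fun j => ltdg mon j h) (fun j => ltdg mon' j h') e (ltn_ord (rev_ord i)).
  by rewrite !dgE rev_ordK.
pose q : {poly F} := \sum_(mon <- msupp p) p@_mon *: 'X^(E mon).
have q0 : q = 0.
  apply: (@roots_geq_poly_eq0 _ q [seq ((B + i).+1)%:R | i <- iota 0 (size q)]).
  - apply/allP => _ /mapP[i _ ->]; set b := (B + i).+1.
    pose l (j : 'I_m) := (b ^ (N ^ (m - j)))%N.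
    have v0 : p.@[fun j => (l j)%:R] = 0.
      apply: pv => [j j' le|j]; first by rewrite !leq_pexp2l // leq_sub2l.
      have: (b <= l j)%N by rewrite -{1}(expn1 b) leq_pexp2l // expn_gt0 N0.
      by apply: leq_trans; rewrite /b; lia.
    rewrite rootE /q horner_sum -[X in _ == X]v0 mevalE; apply/eqP; apply: eq_bigr => mon _.
    rewrite hornerZ hornerXn; congr (_ * _); rewrite /E -prodrXr; apply: eq_bigr => j _.
    by rewrite /l natrX -exprM mulnC.
  - rewrite map_inj_uniq ?iota_uniq // => i j /eqP; rewrite eqr_nat => /eqP; lia.
  by rewrite size_map size_iota.
have: q`_(E mon0) = p@_mon0.
  rewrite /q coef_sum (bigD1_seq mon0) //= coefZ coefXn eqxx mulr1.
  rewrite big_seq_cond big1 ?addr0 // => mon /andP[h ne].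
  rewrite coefZ coefXn; case: eqP => [e|_]; last by rewrite mulr0.
  by rewrite (E_inj _ _ mon0P h e) eqxx in ne.
by rewrite q0 coef0 => /esym/eqP; rewrite mcoeff_eq0 mon0P.
Qed.

(** ** The identity for indeterminate rows *)

Section FmapNaturality.
Variables (A B : comNzRingType) (psi : {rmorphism A -> B}).

Lemma fmap_fcomp (f h : fps A) : fmap psi (fcomp f h) = fcomp (fmap psi f) (fmap psi h).
Proof.
apply: fpsP => n; rewrite fmapE !fcompE rmorph_sum; apply: eq_bigr => m _.
by rewrite -rmorphXn rmorphM.
Qed.

Lemma fmap_shift_series (g : fps A) j :
  fmap psi (shift_series g j) = shift_series (fmap psi g) j.
Proof.
have d0 : (1 - j%:R * fX : fps A) 0%N = 1 by rewrite fcoefB fcoef1 fcoefM0 mulr0 subr0.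
have dE : fmap psi (1 - j%:R * fX) = 1 - j%:R * fX.
  by rewrite rmorphB rmorph1 rmorphM rmorph_nat /= fmap_fX.
have tE : fmap psi (fX * finv (1 - j%:R * fX)) = fX * finv (1 - j%:R * fX).
  by rewrite -dE -fmapV // -(fmap_fX psi) -rmorphM.
by rewrite /shift_series -tE -dE -fmap_fcomp -rmorphM.
Qed.

Lemma fmap_lin x : fmap psi (lin x) = lin (psi x).
Proof. by rewrite /lin rmorphB rmorph1 rmorphM /= fmapC fmap_fX. Qed.

Lemma fmap_gseries m (l : 'I_m -> A) : fmap psi (gseries l) = gseries (fun i => psi (l i)).
Proof.
rewrite /gseries rmorphM rmorph_prod /= fmap_lin rmorphN rmorph_nat; congr (_ * _).
apply: eq_bigr => r _.
by rewrite rmorphM /= fmapV ?lin0 // !fmap_lin !rmorphB !rmorph_nat.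
Qed.

End FmapNaturality.

Section KerovDefect.
Variables (k0 : nat).
Local Notation k := k0.+1.
Variable Sigma : {mpoly int[k]}.

(** The free cumulants of g according to Lagrange inversion, over a ring A that
    contains the rationals through q. *)
Definition lagrange_cumulant (A : comNzRingType) (q : rat -> A) (g : fps A) n : A :=
  q ((1 - n%:R)^-1) * (g ^+ n.-1) n.

(** The failure of the identity Sigma_k = - (1/k) [x^-1] prod_j G(x - j). It is
    defined over any ring, so that it can be specialized from indeterminate row
    lengths to integers and to complex numbers. *)
Definition kerov_defect (A : comNzRingType) (q : rat -> A) (g : fps A) : A :=
  mmap intr (fun i : 'I_k => lagrange_cumulant q g i.+2) Sigma
  + q (k%:R^-1) * (\prod_(j < k) shift_series g j) k.+1.

Lemma mmap_rmorph (A B : comNzRingType) (psi : {rmorphism A -> B}) (h : 'I_k -> A) :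
  psi (mmap intr h Sigma) = mmap intr (fun i => psi (h i)) Sigma.
Proof.
rewrite /mmap rmorph_sum; apply: eq_bigr => mon _; rewrite rmorphM rmorph_int; congr (_ * _).
by rewrite /mmap1 rmorph_prod; apply: eq_bigr => i _; rewrite rmorphXn.
Qed.

Lemma eq_mmap (A : comNzRingType) (h h' : 'I_k -> A) : h =1 h' ->
  mmap intr h Sigma = mmap intr h' Sigma.
Proof.
move=> e; rewrite /mmap; apply: eq_bigr => mon _; congr (_ * _).
by apply: eq_bigr => i _; rewrite e.
Qed.

Lemma kerov_defect_morph (A B : comNzRingType) (psi : {rmorphism A -> B}) q q' g :
  (forall x, psi (q x) = q' x) -> psi (kerov_defect q g) = kerov_defect q' (fmap psi g).
Proof.
move=> qq; rewrite /kerov_defect rmorphD mmap_rmorph rmorphM qq; congr (_ + _ * _).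
  by apply: eq_mmap => i; rewrite /lagrange_cumulant rmorphM qq -rmorphXn.
rewrite -fmapE rmorph_prod; congr (fcoef _ _).
by apply: eq_bigr => j _; exact: fmap_shift_series.
Qed.

Lemma kerov_defect_eqt (A : comNzRingType) (q : rat -> A) g g' :
  eqt k.+2 g g' -> kerov_defect q g = kerov_defect q g'.
Proof.
move=> e; rewrite /kerov_defect.
have -> : (\prod_(j < k) shift_series g j) k.+1 = (\prod_(j < k) shift_series g' j) k.+1.
  by apply: (eqt_prod (L := k.+2)) => // j; apply: shift_series_eqt.
have e1 : (fun i : 'I_k => lagrange_cumulant q g i.+2) =1
    (fun i : 'I_k => lagrange_cumulant q g' i.+2).
  move=> i; have lt : (i.+2 < k.+2)%N by rewrite !ltnS -ltnS ltn_ord.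
  by rewrite /lagrange_cumulant (eqtX i.+2.-1 e lt).
by rewrite (eq_mmap e1).
Qed.

Lemma lagrange_cumulantE (g r : fps rat) n : cumulants_of g r ->
  lagrange_cumulant id g n.+2 = r n.+2.
Proof.
move=> cr; rewrite /lagrange_cumulant (lagrange cr) // mulKf // subr_eq0.
by rewrite -[1]/(1%:R) eqr_nat.
Qed.

Hypothesis hSigma : is_kerov_polynomial Sigma.

Lemma kerov_defect_diagram m (l : 'I_m.+1 -> nat) :
  (forall i j : 'I_m.+1, (i <= j)%N -> (l j <= l i)%N) -> (forall i, (k <= l i)%N) ->
  kerov_defect id (gseries (fun i => (l i)%:R : rat)) = 0.
Proof.
move=> dec big; pose w := [seq l i | i <- enum 'I_m.+1].
have sw : size w = m.+1 by rewrite size_map size_enum_ord.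
have nthw (i : 'I_m.+1) : nth 0%N w i = l i.
  by rewrite (nth_map i) ?size_enum_ord // nth_ord_enum.
have dE : dseries rat (size w) w = gseries (fun i => (l i)%:R : rat).
  rewrite /dseries sw; congr gseries; apply: boolp.funext => i.
  by rewrite nthw.
have sorted_w : sorted geq w.
  apply/(sortedP 0%N) => i; rewrite sw => lt.
  have lt' : (i < m.+1)%N := ltnW lt.
  by rewrite -[i]/(nat_of_ord (Ordinal lt')) -[i.+1]/(nat_of_ord (Ordinal lt)) !nthw /geq /= dec /=.
have ge1 : all (leq 1) w.
  by apply/allP => _ /mapP[i _ ->]; apply: leq_trans (big i).
have sum_w : (k <= sumn w)%N.
  rewrite /w enum_ordSl /=; apply: leq_trans (big ord0) _; exact: leq_addr.
have [r cr] := cumulants_exist (gseries0 (fun i => (l i)%:R : rat)).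
rewrite -dE in cr *; have := kerov_on_diagrams hSigma sorted_w ge1 sum_w cr.
rewrite /kerov_defect => e; rewrite (eq_mmap (fun i => lagrange_cumulantE i cr)) e.
by rewrite mulNr addNr.
Qed.

(** The defect of a diagram is a polynomial in the lengths of its rows, which
    vanishes on large partitions and hence identically. *)
Lemma kerov_defect_algC m (l : 'I_m.+1 -> algC) : kerov_defect ratr (gseries l) = 0.
Proof.
pose A : comNzRingType := {mpoly rat[m.+1]}.
pose X : 'I_m.+1 -> A := fun i => 'X_i.
have D0 : kerov_defect (fun x => x%:MP : A) (gseries X) = 0.
  apply: (@mpoly_eq0_decreasing _ _ _ k) => h dec big.
  rewrite (@kerov_defect_morph A rat (meval (fun i => (h i)%:R)) _ id) => [|x]; last exact: mevalC.
  rewrite fmap_gseries -[RHS](kerov_defect_diagram dec big); congr (kerov_defect _ (gseries _)).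
  by apply: boolp.funext => i; rewrite /X /= mevalXU.
have := @kerov_defect_morph A algC (mmap (ratr : rat -> algC) l) (fun x => x%:MP : A) ratr (gseries X).
rewrite D0 rmorph0 => e; rewrite [RHS]e; last by move=> x; exact: mmapC.
rewrite fmap_gseries; congr (kerov_defect _ (gseries _)).
by apply: boolp.funext => i; rewrite /X /= mmapX mmap1U.
Qed.

End KerovDefect.

(** ** Prescribing the function G *)

Lemma roots_lin_prod (m : nat) (f : nat -> algC) : f 0%N = 1 ->
  exists a : 'I_m -> algC,
    \prod_(i < m) lin (a i) = \sum_(j < m.+1) fC (f j) * fX ^+ j.
Proof.
move=> f0; pose p : {poly algC} := \poly_(i < m.+1) f (m - i)%N.
have pm : p`_m = 1 by rewrite coef_poly ltnSn subnn f0.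
have sp : size p = m.+1 by rewrite size_poly_eq // subnn f0 oner_eq0.
have lp : lead_coef p = 1 by rewrite lead_coefE sp pm.
have [s ps] := closed_field_poly_normal p.
rewrite lp scale1r in ps.
have ss : size s = m by have := sp; rewrite ps size_prod_XsubC => -[].
exists (fun i => nth 0 s i).
have -> : \prod_(i < m) lin (nth 0 s i) = \prod_(b <- s) lin b.
  by rewrite (big_nth 0) big_mkord ss.
apply: fpsP => e; case: (leqP e m) => [le|gt].
  rewrite lin_prod_coef ss // -ps coef_poly ltnS leq_subr subKn //.
  by rewrite (fps_truncE (Fps f)) ?ltnS.
rewrite lin_prod_coef_gt ?ss // fcoef_sum big1 // => j _.
rewrite fcoefCM fcoefXn; case: eqP => [e1|]; last by rewrite mulr0.
by move: gt; rewrite e1 ltnNge -ltnS ltn_ord.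
Qed.

(** Let phi(z) = prod_i (z - a_i) = sum_j f_j z^(m - j), where a_i = l_i - i - 1. The
    condition on the a_i says that (1 + m t) t^m phi(1/t - 1) and g t^m phi(1/t)
    agree to the given order. In the coefficient of t^(n + 1), the term f_(n + 1)
    cancels and f_n has the factor n, so that the f_n are determined one after the
    other; the equations for n = 0 hold because g = 1 + O(t^2). *)
Lemma gseries_approx (m : nat) (g : fps algC) : g 0%N = 1 -> g 1%N = 0 ->
  exists l : 'I_m -> algC, eqt m.+2 (gseries l) g.
Proof.
move=> g0 g1.
pose D j : fps algC := g - lin (- m%:R) * lin 1 ^+ (m - j).
have D0 j : D j 0%N = 0 by rewrite /D fcoefB fcoefM0 fcoefX0 !lin0 expr1n mul1r g0 subrr.
have D1 j : (j <= m)%N -> D j 1%N = - j%:R.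
  move=> le; rewrite /D fcoefB g1 lin_mul_coef fcoefX0 lin0 expr1n mulr1 opprK.
  have e n : (lin 1 ^+ n : fps algC) 1%N = - n%:R.
    elim: n => [|n IH]; first by rewrite expr0 fcoef1 oppr0.
    by rewrite exprS lin_mul_coef IH fcoefX0 lin0 expr1n -natr1; ring.
  by rewrite e natrB //; ring.
have [|f fE] := @recursive_sequence algC 0
  (fun f n => if n == 0%N then 1 else n%:R^-1 * \sum_(j < n) f j * D j (n.+1 - j)%N).
  by move=> f1 f2 n e; case: eqP => // _; congr (_ * _); apply: eq_bigr => j _; rewrite e.
have f0 : f 0%N = 1 by rewrite fE.
have S0 e : (e < m.+2)%N -> (\sum_(j < m.+1) fC (f j) * (fX ^+ j * D j)) e = 0.
  move=> lt; rewrite fcoef_sum.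
  have termE j : (fC (f j) * (fX ^+ j * D j)) e = if (j <= e)%N then f j * D j (e - j)%N else 0.
    by rewrite fcoefCM fcoefXnM; case: ifP; rewrite ?mulr0.
  rewrite (eq_bigr (fun j : 'I_m.+1 => if (j <= e)%N then f j * D j (e - j)%N else 0)) => [|j _]; last exact: termE.
  case: e lt {termE} => [|n]; rewrite ?ltnS => le.
    by rewrite big1 // => j _; case: ifP => // ; rewrite sub0n D0 mulr0.
  rewrite -big_mkcond.
  transitivity (\sum_(j < n.+1) f j * D j (n.+1 - j)%N).
    rewrite [RHS](big_ord_widen_cond m.+1 predT (fun j => f j * D j (n.+1 - j)%N)) //.
    rewrite big_mkcond [RHS]big_mkcond; apply: eq_bigr => j _; rewrite andTb.
    by case: (ltngtP j n.+1) => // ->; rewrite subnn D0 mulr0.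
  rewrite big_ord_recr -[LHS]/(_ + _) subSnn D1 //; case: (n) => [|n'].
    by rewrite big_ord0 oppr0 mulr0 addr0.
  rewrite [f n'.+1]fE /= mulrN mulrAC mulVf ?pnatr_eq0 // mul1r.
  by rewrite subrr.
have [a aP] := roots_lin_prod m f0.
exists (fun i => a i + (i : nat).+1%:R).
set P := \prod_(i < m) lin (a i) in aP.
have [P0 PV] := @finv_prod algC _ (index_enum 'I_m) (fun i => lin (a i)) (fun i => lin0 _).
rewrite -/P in P0 PV.
pose Q := \prod_(i < m) lin (a i + 1).
have gE : gseries (fun i => a i + (i : nat).+1%:R) = lin (- m%:R) * (Q * finv P).
  rewrite /gseries PV -big_split; congr (_ * _); apply: eq_bigr => i _ /=.
  by congr (lin _ * finv (lin _)); rewrite -natr1; ring.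
have QE : Q = \sum_(j < m.+1) fC (f j) * (fX ^+ j * lin 1 ^+ (m - j)).
  have l1 : (1 - 1%:R * fX : fps algC) = lin 1 by rewrite /lin natr_fC.
  pose T : fps algC := fX * finv (1 - 1%:R * fX).
  have T0 : T 0%N = 0 by rewrite fcoefM0 mul0r.
  have lV : lin 1 * finv (lin 1) = 1 :> fps algC by rewrite fmulV ?lin0.
  have PT : Q = lin 1 ^+ m * fcomp P T.
    rewrite /P fcomp_prod // -[in lin 1 ^+ m](card_ord m) -prodr_const -big_split.
    apply: eq_bigr => i _ /=; rewrite lin_shift /=.
    transitivity (lin 1 * finv (lin 1) * lin (a i + 1) : fps algC); last by ring.
    by rewrite lV mul1r.
  rewrite PT aP (big_morph _ (fun f g => fcompD f g T) (fcomp_nat 0 T0)) mulr_sumr.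
  apply: eq_bigr => j _; rewrite fcompM // fcompC // fcompX // fcompfX //.
  have le : (j <= m)%N by rewrite -ltnS.
  rewrite -{1}(subnK le) exprD /T l1 exprMn.
  transitivity (fC (f j) * (fX ^+ j * lin 1 ^+ (m - j)) * (lin 1 * finv (lin 1)) ^+ j).
    by rewrite exprMn; ring.
  by rewrite lV expr1n mulr1.
have gP : gseries (fun i => a i + (i : nat).+1%:R) - g =
   - (\sum_(j < m.+1) fC (f j) * (fX ^+ j * D j)) * finv P.
  have -> : \sum_(j < m.+1) fC (f j) * (fX ^+ j * D j) = g * P - lin (- m%:R) * Q.
    rewrite aP QE !mulr_sumr -sumrB; apply: eq_bigr => j _.
    by rewrite /D; ring.
  have PP := fmulV P0.
  transitivity (lin (- m%:R) * (Q * finv P) - g * (P * finv P)); last by ring.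
  by rewrite PP mulr1 gE.
move=> e lt; apply/eqP; rewrite -subr_eq0 -fcoefB gP mulNr fcoefN oppr_eq0.
by rewrite (eqtM (L := m.+2) (f' := 0) (g' := finv P)) ?mul0r.
Qed.

Section KerovSeries.
Variables (k0 : nat).
Local Notation k := k0.+1.
Variable Sigma : {mpoly int[k]}.
Hypothesis hSigma : is_kerov_polynomial Sigma.

(** The identity for a generalized diagram whose function G agrees with g to the
    order that matters. *)
Theorem kerov_series (g r : fps rat) : cumulants_of g r -> g 1%N = 0 ->
  mmap intr (fun i : 'I_k => r i.+2) Sigma =
  - (k%:R^-1) * (\prod_(j < k) shift_series g j) k.+1.
Proof.
move=> cr g1; have g0 := cumulants_g0 cr.
have z : kerov_defect Sigma id g = 0.
  apply: (fmorph_inj (ratr : {rmorphism rat -> algC})).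
  rewrite rmorph0 (@kerov_defect_morph _ _ rat algC ratr id ratr) //.
  have h0 : fmap (ratr : {rmorphism rat -> algC}) g 0%N = 1 by rewrite fmapE g0 rmorph1.
  have h1 : fmap (ratr : {rmorphism rat -> algC}) g 1%N = 0 by rewrite fmapE g1 rmorph0.
  have [l e] := gseries_approx k h0 h1.
  by rewrite -(kerov_defect_eqt Sigma ratr e) kerov_defect_algC.
move/eqP: z; rewrite /kerov_defect addr_eq0 => /eqP.
by rewrite (eq_mmap Sigma (fun i => lagrange_cumulantE i cr)) mulNr.
Qed.

End KerovSeries.

(** * The graded piece *)

Section Rescale.
Variable K : numFieldType.

Lemma fcomp_scale (f : fps K) u n : fcomp f (fC u * fX) n = u ^+ n * f n.
Proof.
rewrite fcompE big_ord_recr /= big1 ?add0r => [|i _].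
  by rewrite exprMn -rmorphXn fcoefCM fcoefXn eqxx mulr1 mulrC.
rewrite exprMn -rmorphXn fcoefCM fcoefXn.
by rewrite gtn_eqF ?ltn_ord // !mulr0.
Qed.

Lemma cumulants_of_scale (g r : fps K) u : cumulants_of g r ->
  cumulants_of (fcomp g (fC u * fX)) (fcomp r (fC u * fX)).
Proof.
move=> [r0 gV]; set s := fC u * fX.
have s0 : s 0%N = 0 by rewrite fcoefM0 mulr0.
split; first by rewrite fcomp0.
have -> : finv (fcomp r s) = fcomp (finv r) s by rewrite fcompV.
have W0 : (fX * finv r) 0%N = 0 :> K by rewrite fcoefM0 mul0r.
have X0 : (fX * fcomp (finv r) s) 0%N = 0 :> K by rewrite fcoefM0 mul0r.
have e1 : fcomp s (fX * fcomp (finv r) s) = fcomp (fX * finv r) s.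
  by rewrite /s fcompM // fcompC // fcompfX // -/s fcompM // fcompfX // mulrA.
by rewrite (fcompA _ s0 X0) e1 -(fcompA _ W0 s0) gV.
Qed.

Lemma cumulants_of_exist (r : fps K) : r 0%N = 1 -> r 1%N = 0 ->
  exists2 g, cumulants_of g r & g 1%N = 0.
Proof.
move=> r0 r1; have h0 : (fX * finv r) 0%N = 0 :> K by rewrite fcoefM0 mul0r.
have h1 : (fX * finv r) 1%N = 1 :> K by rewrite fcoefXM finv0.
have [g gV] := fcomp_surj (finv r) h0 h1.
exists g; first by split.
have := congr1 (fun f : fps K => f 1%N) gV.
rewrite fcompE !big_ord_recl big_ord0 expr0 fcoef1 mulr0 add0r addr0 expr1 h1 mulr1 => ->.
have := congr1 (fun f : fps K => f 1%N) (fmulV r0).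
rewrite fcoefM !big_ord_recl big_ord0 addr0 fcoef1 subn0 subnn r0 r1 mul1r mul0r addr0.
by [].
Qed.

End Rescale.

Section GradedPiece.
Variables (N : nat).
Local Notation k := N.+3.
Variable Sigma : {mpoly int[k]}.
Hypothesis hSigma : is_kerov_polynomial Sigma.

Definition weight_poly (r : fps rat) : {poly rat} :=
  mmap intr (fun i : 'I_k => (r i.+2)%:P * 'X^(i.+2)) Sigma.

Lemma meval_graded_piece (r : fps rat) :
  (graded_piece 4 Sigma).@[fun i => r i.+2] = (weight_poly r)`_N.
Proof.
rewrite /graded_piece addn1 subSS -[RHS]/((weight_poly r)`_N).
have -> : (k - 3 = N)%N by rewrite -addn3 addnK.
pose phi : {rmorphism {mpoly rat[k]} -> rat} := meval (fun i : 'I_k => r i.+2).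
rewrite -[LHS]/(phi _) -coef_map; congr ((polyseq _)`_ _).
rewrite [LHS](@mmap_rmorph N.+2 Sigma _ _ (map_poly phi)); apply: eq_mmap => i.
by rewrite rmorphM /= map_polyC map_polyXn /= mevalXU.
Qed.

(** Rescaling R_i by u^i separates the graded pieces on the one side and, by
    [shift_product_graded], the orders in the shifts on the other side. *)
Lemma weight_polyE (g r : fps rat) : cumulants_of g r -> g 1%N = 0 ->
  weight_poly r = - (k%:R^-1) *: \poly_(a < k.+2) (\prod_(j < k) shift_expansion g j) (k.+1 - a)%N a.
Proof.
move=> cr g1; set q := (RHS).
apply/eqP; rewrite -subr_eq0; apply/eqP; set p := weight_poly r - q.
apply: (@roots_geq_poly_eq0 _ p [seq i%:R | i <- iota 0 (size p)]).
- apply/allP => u _; rewrite rootE /p hornerD hornerN subr_eq0.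
  have cu := cumulants_of_scale u cr.
  have gu1 : fcomp g (fC u * fX) 1%N = 0 by rewrite fcomp_scale g1 mulr0.
  have := kerov_series hSigma cu gu1.
  rewrite shift_product_graded => e.
  have -> : q.[u] = - k%:R^-1 * \sum_(a < k.+2) u ^+ a * (\prod_(j < k) shift_expansion g j) (k.+1 - a)%N a.
    by rewrite /q hornerZ horner_poly; congr (_ * _); apply: eq_bigr => a _; rewrite mulrC.
  rewrite -[X in _ == X]e; apply/eqP.
  rewrite -[LHS]/(horner_eval u (weight_poly r)).
  rewrite [LHS](@mmap_rmorph N.+2 Sigma _ _ (horner_eval u)); apply: eq_mmap => i.
  by rewrite -[LHS]/(((r i.+2)%:P * 'X^(i.+2)).[u]) hornerM hornerC hornerXn fcomp_scale mulrC.
- rewrite map_inj_uniq ?iota_uniq // => i j /eqP; rewrite eqr_nat => /eqP; exact: id.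
by rewrite size_map size_iota.
Qed.

Lemma graded4_eval (r : fps rat) : r 0%N = 1 -> r 1%N = 0 ->
  (graded_piece 4 Sigma).@[fun i => r i.+2] =
  alpha k * (Cser r ^+ 3) N + beta k * (Cser r ^+ 2 * theta (theta (Cser r))) N.
Proof.
move=> r0 r1; have [g cr g1] := cumulants_of_exist r0 r1.
rewrite meval_graded_piece (weight_polyE cr g1) coefZ coef_poly.
have -> : (N < k.+2)%N by lia.
have -> : (k.+1 - N = 4)%N by lia.
have ea : alpha k = alphaK (k%:R : rat) by rewrite /alpha /alphaK; cbv zeta; reflexivity.
have eb : beta k = betaK (k%:R : rat) by rewrite /beta /betaK; cbv zeta; reflexivity.
by rewrite ea eb; exact: (sigma4_series N cr).
Qed.

End GradedPiece.

(** * The polynomials C_m *)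

Lemma prod_monomials (R : comNzRingType) (I : finType) (c : I -> R) (e : I -> nat) :
  \prod_s (fC (c s) * fX ^+ e s) = fC (\prod_s c s) * fX ^+ (\sum_s e s)%N.
Proof. by rewrite big_split rmorph_prod prodrXr. Qed.

Section Multinomial.
Variable K : numFieldType.
Implicit Types y z : fps K.

Let fact_neq0 a : (a`!%:R : K) != 0.
Proof. by rewrite pnatr_eq0 -lt0n fact_gt0. Qed.

(** The exponential of y in a second variable that records the degree. *)
Definition exp_series y : fps (fps K) := Fps (fun a => fC ((a`!%:R)^-1) * y ^+ a).

Lemma exp_seriesE y n : exp_series y n = fC ((n`!%:R)^-1) * y ^+ n.
Proof. by []. Qed.

Lemma exp_seriesD y z : exp_series (y + z) = exp_series y * exp_series z.
Proof.
apply: fpsP => n; rewrite fcoefM.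
rewrite (exp_seriesE (y + z) n) addrC exprDn mulr_sumr; apply: eq_bigr => i _.
rewrite (exp_seriesE y i) (exp_seriesE z (n - i)).
have le : (i <= n)%N by rewrite -ltnS.
have -> : z ^+ (n - i) * y ^+ i *+ 'C(n, i) = fC ('C(n, i)%:R) * (z ^+ (n - i) * y ^+ i).
  by rewrite -natr_fC mulr_natl.
transitivity (fC (i`!%:R^-1) * fC ((n - i)`!%:R^-1) * (y ^+ i * z ^+ (n - i))); last by ring.
rewrite [LHS]mulrA [z ^+ _ * _]mulrC -!rmorphM; congr (fC _ * _).
by rewrite -(bin_fact le) !natrM; field; rewrite !fact_neq0 pnatr_eq0 -lt0n bin_gt0 le.
Qed.

Lemma exp_series0 : exp_series 0 = 1.
Proof.
apply: fpsP => n; rewrite exp_seriesE fcoef1 expr0n.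
by case: n => [|n]; rewrite ?mulr0 // mulr1 fact0 invr1 rmorph1.
Qed.

(** Compare the coefficients of the product of the exponential series of the y_s
    with those of the exponential series of their sum. *)
Lemma multinomial m L p (y : 'I_m -> fps K) : (p <= L)%N ->
  (\sum_s y s) ^+ p = \sum_(f : {ffun 'I_m -> 'I_L.+1} | (\sum_s f s)%N == p)
    fC p`!%:R * \prod_s (fC ((f s)`!%:R^-1) * y s ^+ f s).
Proof.
move=> le; have e : exp_series (\sum_s y s) = \prod_s exp_series (y s).
  exact: (big_morph exp_series exp_seriesD exp_series0).
have tr s : eqt L.+1 (exp_series (y s))
    (\sum_(a < L.+1) fC (fC (a`!%:R^-1) * y s ^+ a) * fX ^+ a).
  by move=> n lt; rewrite (fps_truncE (exp_series (y s))).
have := eqt_prod (index_enum 'I_m) tr (leq_ltn_trans le (ltnSn L)).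
rewrite -e bigA_distr_bigA fcoef_sum exp_seriesE => e1.
rewrite -mulr_sumr [in RHS]big_mkcond.
transitivity (fC p`!%:R * (fC (p`!%:R^-1) * (\sum_s y s) ^+ p)).
  by rewrite mulrA -rmorphM mulfV // rmorph1 mul1r.
rewrite e1; congr (_ * _); apply: eq_bigr => f _.
rewrite prod_monomials fcoefCM fcoefXn eq_sym.
by case: eqP; rewrite ?mulr1 ?mulr0.
Qed.

End Multinomial.

Section CSeries.
Variable K : numFieldType.

Lemma geometric (S : fps K) n L : S 0%N = 0 -> (n < L)%N ->
  finv (1 - S) n = \sum_(p < L) (S ^+ p) n.
Proof.
move=> S0 lt.
have d0 : (1 - S) 0%N = 1 by rewrite fcoefB fcoef1 S0 subr0.
have e : (1 - S) * \sum_(p < L) S ^+ p = 1 - S ^+ L by rewrite -[RHS]opprB subrX1 -mulNr opprB.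
have -> : finv (1 - S) = \sum_(p < L) S ^+ p + finv (1 - S) * S ^+ L.
  apply: (fmulI d0); rewrite fmulV // mulrDr e mulrA fmulV // mul1r.
  by rewrite subrK.
rewrite fcoefD fcoef_sum [X in _ + X](_ : _ = 0) ?addr0 //.
have eq0 : eqt L (S ^+ L) 0 by move=> i il; rewrite fcoefX_lt.
by rewrite (eqtM (L := L) (f' := finv (1 - S)) (g' := 0)) // mulr0.
Qed.

(** The geometric series of S = sum_i (i - 1) R_i t^i, with its powers expanded by
    the multinomial theorem. *)
Lemma Cser_multinomial (r : fps K) m : r 0%N = 1 ->
   r 1%N = 0 -> Cser r m =
  \sum_(f : {ffun 'I_m -> 'I_m.+1} | (\sum_(s < m) s.+2 * f s)%N == m)
    ((\sum_(s < m) f s)%N`!)%:R *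
    \prod_(s < m) (((f s)`!%:R)^-1 * (s.+1%:R * r s.+2) ^+ f s).
Proof.
move=> r0 r1.
pose S : fps K := Fps (fun n => (n%:R - 1) * r n * (n != 0%N)%:R).
have -> : Cser r = finv (1 - S).
  congr finv; apply: fpsP => -[|n]; rewrite !fcoefB fcoef1 thetaE /=.
    by rewrite mulr0 r0 !mul0r.
  by rewrite mulr1; ring.
have S0 : S 0%N = 0 by rewrite /= mulr0.
rewrite (geometric S0 (ltnSn m)).
pose y (s : 'I_m) : fps K := fC (s.+1%:R * r s.+2) * fX ^+ s.+2.
have yS : eqt m.+1 S (\sum_s y s).
  move=> n; rewrite ltnS fcoef_sum => le; case: n le => [|[|n]] le.
  - by rewrite big1 // => s _; rewrite fcoefCM fcoefXn mulr0.
  - rewrite big1 => [|s _]; last by rewrite fcoefCM fcoefXn mulr0.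
    by rewrite /= r1 mulr0 mul0r.
  rewrite (bigD1 (Ordinal (ltnW le : (n < m)%N))) // big1 => [|s ne].
    by rewrite [RHS]addr0 fcoefCM fcoefXn eqxx mulr1 /= mulr1 -[n.+2%:R]natr1 addrK.
  rewrite fcoefCM fcoefXn; case: eqP => [[en]|_]; last by rewrite mulr0.
  by case/eqP: ne; apply/val_inj.
rewrite (eq_bigr (fun p : 'I_m.+1 => \sum_(f : {ffun 'I_m -> 'I_m.+1})
   if (\sum_(s < m) s.+2 * f s)%N == m then
    (if (\sum_s f s)%N == p then ((\sum_(s < m) f s)%N`!)%:R *
    \prod_(s < m) (((f s)`!%:R)^-1 * (s.+1%:R * r s.+2) ^+ f s) else 0) else 0)) => [|p _]; last first.
  rewrite (eqtX p yS (ltnSn m)) (@multinomial K m m p y) -1?ltnS //.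
  rewrite fcoef_sum big_mkcond; apply: eq_bigr => f _.
  case: eqP => [ep|_]; last by rewrite if_same.
  rewrite ep (eq_bigr (fun s => fC ((f s)`!%:R^-1 * (s.+1%:R * r s.+2) ^+ f s) * fX ^+ (s.+2 * f s))); last first.
    by move=> s _; rewrite /y exprMn -rmorphXn -exprM mulrA -rmorphM.
  rewrite prod_monomials fcoefCM fcoefCM fcoefXn eq_sym.
  by case: eqP; rewrite ?mulr1 ?mulr0.
rewrite exchange_big [RHS]big_mkcond; apply: eq_bigr => f _.
case: eqP => [em|_]; last by rewrite big1.
have lt : (\sum_s f s < m.+1)%N.
  rewrite ltnS -[X in (_ <= X)%N]em; apply: leq_sum => s _.
  by rewrite leq_pmull.
rewrite (bigD1 (Ordinal lt)) //= eqxx [X in _ + X]big1 ?addr0 // => p ne.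
by case: eqP => // ep; case/eqP: ne; apply/val_inj.
Qed.

End CSeries.

Lemma meval_C k m (r : fps rat) : r 0%N = 1 -> r 1%N = 0 -> (m <= k)%N ->
  (C_ k m).@[fun i : 'I_k => r i.+2] = Cser r m.
Proof.
move=> r0 r1 le.
have RE s : (s < m)%N -> (R_ k s.+2).@[fun i : 'I_k => r i.+2] = r s.+2.
  move=> lt; have lt' : (s < k)%N by apply: leq_trans le.
  by rewrite /R_ !subSS subn0 insubT mevalXU.
rewrite Cser_multinomial //; case: m le RE => [|[|m]] le RE.
- rewrite meval1 (big_pred1 [ffun=> ord0]) => [|f].
    by rewrite !big_ord0 mulr1.
  by rewrite big_ord0 eqxx; apply/esym/eqP/ffunP => -[].
- rewrite meval0 big_pred0 // => f; rewrite big_ord1.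
  by apply/negP => /eqP; lia.
rewrite rmorph_sum; apply: eq_bigr => f _; rewrite /= mevalZ rmorph_prod; congr (_ * _).
apply: eq_bigr => s _; rewrite /= mevalZ rmorphXn /= mevalZ RE //.
Qed.

(** * The fourth graded piece *)

Lemma fcoefM3 (R : comNzRingType) (f g h : fps R) n :
  (f * g * h) n = \sum_(i < n.+1) \sum_(j < n.+1)
     \sum_(m < n.+1 | (i + j + m)%N == n) f i * g j * h m.
Proof.
have tr (u : fps R) : eqt n.+1 u (\sum_(i < n.+1) fC (u i) * fX ^+ i).
  by move=> i lt; rewrite fps_truncE.
rewrite (eqtM (eqtM (tr f) (tr g)) (tr h) (ltnSn n)).
rewrite big_distrlr mulr_suml fcoef_sum; apply: eq_bigr => i _.
rewrite mulr_suml fcoef_sum; apply: eq_bigr => j _.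
rewrite mulr_sumr fcoef_sum [RHS]big_mkcond; apply: eq_bigr => m _.
transitivity ((fC (f i * g j * h m) * fX ^+ (i + j + m)) n).
  rewrite -[LHS]/((fC (f i) * fX ^+ i * (fC (g j) * fX ^+ j) * (fC (h m) * fX ^+ m)) n).
  by congr (fcoef _ n); rewrite !rmorphM !exprD; ring.
rewrite fcoefCM fcoefXn eq_sym.
by case: eqP; rewrite ?mulr1 ?mulr0.
Qed.

Theorem theorem3p2 (k : nat) (Sigma : {mpoly int[k]})
    (hk : (3 <= k)%N) (hSigma : is_kerov_polynomial Sigma) :
  graded_piece 4 Sigma =
    alpha k *: (\sum_(i < (k - 3).+1) \sum_(j < (k - 3).+1)
                 \sum_(m < (k - 3).+1 | (i + j + m)%N == (k - 3)%N)
                   C_ k i * C_ k j * C_ k m)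
    + beta k *: (\sum_(i < (k - 3).+1) \sum_(j < (k - 3).+1)
                  \sum_(m < (k - 3).+1 | (i + j + m)%N == (k - 3)%N)
                    (i ^ 2)%:R *: (C_ k i * C_ k j * C_ k m)).
Proof.
case: k Sigma hk hSigma => [|[|[|N]]] // Sigma _ hSigma.
have -> : (N.+3 - 3 = N)%N by rewrite -addn3 addnK.
apply/eqP; rewrite -subr_eq0; apply/eqP.
apply: (@mpoly_eq0_decreasing _ _ _ 0%N) => l _ _.
pose r : fps rat := Fps (fun n => match n with
  | 0%N => 1 | 1%N => 0
  | n'.+2 => if insub n' is Some s then (l (s : 'I_N.+3))%:R else 0 end).
have -> : (fun i => (l i)%:R) = (fun i : 'I_N.+3 => r i.+2).
  by apply: boolp.funext => i; rewrite /= insubT //= => lt; congr (l _)%:R; apply/val_inj.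
have r0 : r 0%N = 1 by [].
have r1 : r 1%N = 0 by [].
have CE (i : 'I_N.+1) : (C_ N.+3 i).@[fun i => r i.+2] = Cser r i.
  by apply: meval_C => //; apply: leq_trans (ltnW (ltn_ord i)) _; rewrite leqW.
have := graded4_eval hSigma r0 r1.
move: (graded_piece 4 Sigma) (alpha N.+3) (beta N.+3) => G a b GE.
rewrite mevalB mevalD !mevalZ GE.
apply/eqP; rewrite subr_eq0; apply/eqP; congr (_ * _ + _ * _).
  have -> : Cser r ^+ 3 = Cser r * Cser r * Cser r by rewrite !exprS expr0 mulr1 mulrA.
  rewrite fcoefM3 rmorph_sum; apply: eq_bigr => i _.
  rewrite rmorph_sum; apply: eq_bigr => j _; rewrite rmorph_sum; apply: eq_bigr => m _.
  by rewrite /= !mevalM !CE.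
have -> : Cser r ^+ 2 * theta (theta (Cser r)) = theta (theta (Cser r)) * Cser r * Cser r.
  by ring.
rewrite fcoefM3 rmorph_sum; apply: eq_bigr => i _.
rewrite rmorph_sum; apply: eq_bigr => j _; rewrite rmorph_sum; apply: eq_bigr => m _.
by rewrite /= mevalZ !mevalM !CE natrX; ring.
Qed.
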